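(* Let $\mathcal A$ and $\mathcal B$ be finitely generated unital MF algebras. Then their unital full free product $\mathcal A*_{\mathbb C}\mathcal B$ is an MF algebra.
   Context: MF algebra: a unital C$^*$-algebra $\mathcal A$ is MF if there exist positive integers $n_k$ and a unital injective $*$-homomorphism from $\mathcal A$ into $\prod_k\mathcal M_{n_k}(\mathbb C)/\bigoplus_k\mathcal M_{n_k}(\mathbb C)$ (bounded sequences of matrices modulo sequences tending to $0$ in norm). Unital full free product $\mathcal A*_{\mathbb C}\mathcal B$: a unital C$^*$-algebra $\mathcal D$ with unital embeddings $\sigma_1:\mathcal A\to\mathcal D$, $\sigma_2:\mathcal B\to\mathcal D$ such that $\sigma_1(\mathcal A)\cup\sigma_2(\mathcal B)$ generates $\mathcal D$ and for any unital $*$-homomorphisms $\phi_1:\mathcal A\to\bar{\mathcal D}$, $\phi_2:\mathcal B\to\bar{\mathcal D}$ into a unital C$^*$-algebra there is a unital $*$-homomorphism $\psi:\mathcal D\to\bar{\mathcal D}$ with $\phi_i=\psi\circ\sigma_i$. *)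

(* Defs.v *)
From Stdlib Require Import Reals List.
From Coquelicot Require Import Coquelicot.
Open Scope R_scope.

Record CStar := {
  cs :> Type;
  cs_zero : cs;
  cs_one : cs;
  cs_add : cs -> cs -> cs;
  cs_opp : cs -> cs;
  cs_scal : C -> cs -> cs;
  cs_mul : cs -> cs -> cs;
  cs_star : cs -> cs;
  cs_norm : cs -> R;
  cs_addA : forall x y z, cs_add x (cs_add y z) = cs_add (cs_add x y) z;
  cs_addC : forall x y, cs_add x y = cs_add y x;
  cs_add0 : forall x, cs_add cs_zero x = x;
  cs_addN : forall x, cs_add (cs_opp x) x = cs_zero;
  cs_scalDr : forall a x y, cs_scal a (cs_add x y) = cs_add (cs_scal a x) (cs_scal a y);
  cs_scalDl : forall a b x, cs_scal (Cplus a b) x = cs_add (cs_scal a x) (cs_scal b x);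
  cs_scalM : forall a b x, cs_scal (Cmult a b) x = cs_scal a (cs_scal b x);
  cs_scal1 : forall x, cs_scal (RtoC 1) x = x;
  cs_mulA : forall x y z, cs_mul x (cs_mul y z) = cs_mul (cs_mul x y) z;
  cs_mul1l : forall x, cs_mul cs_one x = x;
  cs_mul1r : forall x, cs_mul x cs_one = x;
  cs_mulDl : forall x y z, cs_mul (cs_add x y) z = cs_add (cs_mul x z) (cs_mul y z);
  cs_mulDr : forall x y z, cs_mul x (cs_add y z) = cs_add (cs_mul x y) (cs_mul x z);
  cs_scal_mull : forall a x y, cs_scal a (cs_mul x y) = cs_mul (cs_scal a x) y;
  cs_scal_mulr : forall a x y, cs_scal a (cs_mul x y) = cs_mul x (cs_scal a y);
  cs_starK : forall x, cs_star (cs_star x) = x;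
  cs_starD : forall x y, cs_star (cs_add x y) = cs_add (cs_star x) (cs_star y);
  cs_starZ : forall a x, cs_star (cs_scal a x) = cs_scal (Cconj a) (cs_star x);
  cs_starM : forall x y, cs_star (cs_mul x y) = cs_mul (cs_star y) (cs_star x);
  cs_norm_eq0 : forall x, cs_norm x = 0 -> x = cs_zero;
  cs_normD : forall x y, cs_norm (cs_add x y) <= cs_norm x + cs_norm y;
  cs_normZ : forall a x, cs_norm (cs_scal a x) = Cmod a * cs_norm x;
  cs_normM : forall x y, cs_norm (cs_mul x y) <= cs_norm x * cs_norm y;
  cs_Cstar : forall x, cs_norm (cs_mul (cs_star x) x) = cs_norm x * cs_norm x;
  cs_complete : forall u : nat -> cs,
    (forall eps, 0 < eps -> exists N, forall m n, (N <= m)%nat -> (N <= n)%nat ->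
        cs_norm (cs_add (u m) (cs_opp (u n))) < eps) ->
    exists l, forall eps, 0 < eps -> exists N, forall n, (N <= n)%nat ->
        cs_norm (cs_add (u n) (cs_opp l)) < eps
}.

Arguments cs_zero {c}. Arguments cs_one {c}. Arguments cs_add {c}.
Arguments cs_opp {c}. Arguments cs_scal {c}. Arguments cs_mul {c}.
Arguments cs_star {c}. Arguments cs_norm {c}.

Definition is_ustarhom (A B : CStar) (f : A -> B) : Prop :=
  (forall x y, f (cs_add x y) = cs_add (f x) (f y)) /\
  (forall a x, f (cs_scal a x) = cs_scal a (f x)) /\
  (forall x y, f (cs_mul x y) = cs_mul (f x) (f y)) /\
  (forall x, f (cs_star x) = cs_star (f x)) /\
  f cs_one = cs_one.

Inductive star_gen (A : CStar) (S : A -> Prop) : A -> Prop :=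
| sg_in : forall x, S x -> star_gen A S x
| sg_one : star_gen A S cs_one
| sg_add : forall x y, star_gen A S x -> star_gen A S y -> star_gen A S (cs_add x y)
| sg_scal : forall a x, star_gen A S x -> star_gen A S (cs_scal a x)
| sg_mul : forall x y, star_gen A S x -> star_gen A S y -> star_gen A S (cs_mul x y)
| sg_star : forall x, star_gen A S x -> star_gen A S (cs_star x).

(** S generates A as a unital C*-algebra: the generated unital *-subalgebra is
    norm-dense (so its closure, the generated C*-subalgebra, is all of A) *)
Definition generates (A : CStar) (S : A -> Prop) : Prop :=
  forall a eps, 0 < eps -> exists p, star_gen A S p /\
    cs_norm (cs_add a (cs_opp p)) < eps.

Definition fin_generated (A : CStar) : Prop :=
  exists l : list A, generates A (fun x => In x l).

(** * Matrices M_n(C): n x n matrices are functions nat -> nat -> C, only the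
    entries with indices < n are relevant. *)
Definition Mat := nat -> nat -> C.
Definition Vec := nat -> C.

Fixpoint csum (n : nat) (f : nat -> C) : C :=
  match n with O => RtoC 0 | S m => Cplus (csum m f) (f m) end.
Fixpoint rsum (n : nat) (f : nat -> R) : R :=
  match n with O => 0 | S m => rsum m f + f m end.

Definition mat_add (M N : Mat) : Mat := fun i j => Cplus (M i j) (N i j).
Definition mat_sub (M N : Mat) : Mat := fun i j => Cminus (M i j) (N i j).
Definition mat_scal (a : C) (M : Mat) : Mat := fun i j => Cmult a (M i j).
Definition mat_mul (n : nat) (M N : Mat) : Mat :=
  fun i j => csum n (fun k => Cmult (M i k) (N k j)).
Definition mat_adj (M : Mat) : Mat := fun i j => Cconj (M j i).
Definition mat_id : Mat := fun i j => if Nat.eqb i j then RtoC 1 else RtoC 0.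

Definition mat_apply (n : nat) (M : Mat) (v : Vec) : Vec :=
  fun i => csum n (fun j => Cmult (M i j) (v j)).
Definition vnorm (n : nat) (v : Vec) : R :=
  sqrt (rsum n (fun i => Cmod (v i) ^ 2)).

Definition opnorm_le (n : nat) (M : Mat) (c : R) : Prop :=
  forall v, vnorm n (mat_apply n M v) <= c * vnorm n v.

Definition mseq_bounded (nk : nat -> nat) (X : nat -> Mat) : Prop :=
  exists c, forall k, opnorm_le (nk k) (X k) c.
Definition mseq_null (nk : nat -> nat) (X : nat -> Mat) : Prop :=
  forall eps, 0 < eps -> exists K, forall k, (K <= k)%nat -> opnorm_le (nk k) (X k) eps.

(** MF algebra: a unital injective *-homomorphism
      A -> prod_k M_{n_k}(C) / (+)_k M_{n_k}(C),
    presented by choosing for each a a bounded representative sequence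
    Phi a = (Phi a k)_k; the *-homomorphism identities hold modulo
    sequences tending to 0, and injectivity means that equal classes
    come from equal elements. *)
Definition MF (A : CStar) : Prop :=
  exists (nk : nat -> nat) (Phi : A -> nat -> Mat),
    (forall k, (0 < nk k)%nat) /\
    (forall a, mseq_bounded nk (Phi a)) /\
    (forall x y, mseq_null nk (fun k => mat_sub (Phi (cs_add x y) k) (mat_add (Phi x k) (Phi y k)))) /\
    (forall c x, mseq_null nk (fun k => mat_sub (Phi (cs_scal c x) k) (mat_scal c (Phi x k)))) /\
    (forall x y, mseq_null nk (fun k => mat_sub (Phi (cs_mul x y) k) (mat_mul (nk k) (Phi x k) (Phi y k)))) /\
    (forall x, mseq_null nk (fun k => mat_sub (Phi (cs_star x) k) (mat_adj (Phi x k)))) /\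
    mseq_null nk (fun k => mat_sub (Phi cs_one k) mat_id) /\
    (forall x y, mseq_null nk (fun k => mat_sub (Phi x k) (Phi y k)) -> x = y).

Definition is_full_free_product (A B D : CStar) (s1 : A -> D) (s2 : B -> D) : Prop :=
  is_ustarhom A D s1 /\ is_ustarhom B D s2 /\
  (forall x y, s1 x = s1 y -> x = y) /\
  (forall x y, s2 x = s2 y -> x = y) /\
  generates D (fun d => (exists a, d = s1 a) \/ (exists b, d = s2 b)) /\
  (forall (E : CStar) (p1 : A -> E) (p2 : B -> E),
     is_ustarhom A E p1 -> is_ustarhom B E p2 ->
     exists psi : D -> E, is_ustarhom D E psi /\
       (forall a, p1 a = psi (s1 a)) /\ (forall b, p2 b = psi (s2 b))).

(* Main.v *)
(** Let [Phi_A], [Phi_B] be sequences of matrix-valued maps witnessing that [A]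
    and [B] are MF, and call a direct sum of unitary conjugates of maps
    [Phi_A(.)(k)], [k >= m], a map of level [m]. If [rho_j] on [A] and [rho'_j]
    on [B] have level [j] and the same size [d_j], their classes are unital
    *-homomorphisms into the matrix sequences of sizes [d_j] modulo null
    sequences, so the universal property yields [psi] on the free product [D].
    It has to be made isometric: for each noncommutative polynomial [P] in
    elements of [A] and [B] one needs [rho], [rho'] of high level with
    [||P(rho, rho')||] nearly [||P||_D] (an approximate form of the Exel-Loring
    argument).

    Take a state [f] of [D] attaining the norm at [P^* P] and consider the
    finitely many vectors [w xi] of its GNS representation, [w] running through
    the suffixes of words of [P]. Gram matrices of vectors in representations of
    level [m], together with the defects [||rho(a) v_w - v_(aw)||^2], form a
    convex cone. If the Gram matrix of the [w xi], with zero defect, were not in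
    its closure, Hahn-Banach would give a hermitian [X] in [M_r(A)] that is
    positive in all [Phi_A(.)(k)], [k >= m], but negative at the [w xi]; this is
    impossible, since the moments of the contraction [Z = 1 - X/t] stay bounded:
    the entries of [Z^n] have norm at most [1] in [A], as injective
    *-homomorphisms of C*-algebras are isometric. Adding a small multiple of the
    identity, the Gram matrices on the [A] side and on the [B] side can be made
    exactly equal, and a unitary then identifies the two systems of vectors. *)

(* Two obstacles shape the argument. A single map $a\mapsto\Phi(a)(k)$ need not be multiplicative,
   so vectors cannot be asked to satisfy the relations exactly; the defect is carried along as one
   more real coordinate. Being quadratic, it enters a separating functional as a multiple of a sum
   of squares of the relations, and this term vanishes at the vectors $w\xi$, where the relations do
   hold. Secondly, the two sides fit together only on common vectors, which demands equal Gram
   matrices, not close ones. The summand $\theta I$ leaves room to correct a small hermitian error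
   by a further direct summand, at the cost of a defect of order $\theta$. Norms in the matrix
   quotient are upper limits, so a single sequence of pairs of representations can serve all
   polynomials as soon as countably many of them are dense; finite generation provides these.
   Spectra and Hilbert space completions are avoided: square roots come from an iteration, GNS
   vectors stay in [D] with a degenerate form, and operator norms of matrices occur only as
   bounds. *)
Require Import Defs.
From Stdlib Require Import Reals List Lra Lia.
From Stdlib Require Cantor.
From Stdlib Require Import FunctionalExtensionality PropExtensionality ClassicalEpsilon.
From Coquelicot Require Import Coquelicot.
From mathcomp Require boolp classical_sets.
From Stdlib Require Import ssreflect.
Import ListNotations.
Open Scope R_scope.

(** * Normalisation in noncommutative complex algebras *)

Declare Scope cs_scope.
Delimit Scope cs_scope with cs.
Bind Scope cs_scope with cs.
Arguments cs_norm {c} _%_cs_scope.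
Arguments cs_star {c} _%_cs_scope.
Notation "x + y" := (cs_add x y) : cs_scope.
Notation "- x" := (cs_opp x) : cs_scope.
Notation "x - y" := (cs_add x (cs_opp y)) : cs_scope.
Notation "x * y" := (cs_mul x y) : cs_scope.
Notation "a ** x" := (cs_scal a x) (at level 38, right associativity) : cs_scope.
Notation "x ^*" := (cs_star x) (at level 2, left associativity, format "x ^*") : cs_scope.
Notation "0" := cs_zero : cs_scope.
Notation "1" := cs_one : cs_scope.

Section Module.
Local Open Scope cs_scope.
Context {A : CStar}.
Implicit Types x y z : A.

Lemma cs_addr0 x : x + 0 = x.
Proof. by rewrite cs_addC cs_add0. Qed.
Lemma cs_subrr x : x - x = 0.
Proof. by rewrite cs_addC cs_addN. Qed.
Lemma cs_addKr x y : - x + (x + y) = y.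
Proof. by rewrite cs_addA cs_addN cs_add0. Qed.
Lemma cs_addIl x y z : x + y = x + z -> y = z.
Proof. by move=> H; rewrite -(cs_addKr x y) H cs_addKr. Qed.
Lemma cs_scal0l x : RtoC 0 ** x = 0.
Proof.
  apply (cs_addIl (RtoC 0 ** x)); rewrite -cs_scalDl cs_addr0.
  by f_equal; apply injective_projections; simpl; ring.
Qed.
Lemma cs_oppE x : - x = RtoC (-1) ** x.
Proof.
  apply (cs_addIl x); rewrite cs_subrr -{1}(cs_scal1 _ x) -cs_scalDl -(cs_scal0l x).
  by f_equal; apply injective_projections; simpl; ring.
Qed.
Lemma cs_scal0r a : a ** (0 : A) = 0.
Proof. by apply (cs_addIl (a ** 0)); rewrite -cs_scalDr cs_add0 cs_addr0. Qed.
Lemma cs_mul0l x : 0 * x = 0.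
Proof. by apply (cs_addIl (0 * x)); rewrite -cs_mulDl cs_add0 cs_addr0. Qed.
Lemma cs_mul0r x : x * 0 = 0.
Proof. by apply (cs_addIl (x * 0)); rewrite -cs_mulDr cs_add0 cs_addr0. Qed.
Lemma cs_sub_eq0 x y : x - y = 0 -> x = y.
Proof.
  move=> H; apply (cs_addIl (- y)); rewrite cs_addN -H; exact: cs_addC.
Qed.

End Module.

(** Syntax for reflection. Scalars remain elements of [C] and adjoints count as atoms, so a normal
    form is a list of coefficients attached to words of atom numbers. *)
Inductive nex : Type :=
| NV (n : nat) | N0 | N1
| NAdd (e f : nex) | NOpp (e : nex) | NMul (e f : nex) | NScal (a : C) (e : nex).

Fixpoint nnf (e : nex) : list (C * list nat) :=
  match e with
  | NV n => [(RtoC 1, [n])]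
  | N0 => []
  | N1 => [(RtoC 1, [])]
  | NAdd e f => nnf e ++ nnf f
  | NOpp e => map (fun m => (Cmult (RtoC (-1)) (fst m), snd m)) (nnf e)
  | NMul e f => flat_map (fun m =>
      map (fun m' => (Cmult (fst m) (fst m'), snd m ++ snd m')) (nnf f)) (nnf e)
  | NScal a e => map (fun m => (Cmult a (fst m), snd m)) (nnf e)
  end.

Fixpoint word_eqb (v w : list nat) : bool :=
  match v, w with
  | [], [] => true
  | i :: v, j :: w => if Nat.eqb i j then word_eqb v w else false
  | _, _ => false
  end.

Fixpoint ncollect1 (c : C) (w : list nat) (l : list (C * list nat)) :=
  match l with
  | [] => [(c, w)]
  | (c', w') :: l => if word_eqb w w' then (Cplus c c', w') :: l
                     else (c', w') :: ncollect1 c w l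
  end.

Fixpoint ncollect (l : list (C * list nat)) :=
  match l with [] => [] | (c, w) :: l => ncollect1 c w (ncollect l) end.

Fixpoint nallz (l : list (C * list nat)) : Prop :=
  match l with [] => True | (c, _) :: l => c = RtoC 0 /\ nallz l end.

Section Normalise.
Local Open Scope cs_scope.
Context {A : CStar}.
Implicit Type env : nat -> A.

Fixpoint nden env (e : nex) : A :=
  match e with
  | NV n => env n
  | N0 => 0
  | N1 => 1
  | NAdd e f => nden env e + nden env f
  | NOpp e => - nden env e
  | NMul e f => nden env e * nden env f
  | NScal a e => a ** nden env e
  end.

Fixpoint wden env (w : list nat) : A :=
  match w with [] => 1 | i :: w => env i * wden env w end.
Fixpoint pden env (l : list (C * list nat)) : A :=
  match l with [] => 0 | m :: l => fst m ** wden env (snd m) + pden env l end.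

Lemma wden_app env v w : wden env (v ++ w) = wden env v * wden env w.
Proof. by elim: v => [|i v IH] /=; rewrite ?cs_mul1l // IH cs_mulA. Qed.
Lemma pden_app env l l' : pden env (l ++ l') = pden env l + pden env l'.
Proof. by elim: l => [|m l IH] /=; rewrite ?cs_add0 // IH cs_addA. Qed.
Lemma pden_scal env a l :
  pden env (map (fun m => (Cmult a (fst m), snd m)) l) = a ** pden env l.
Proof.
  by elim: l => [|m l IH] /=; rewrite ?cs_scal0r // IH cs_scalDr cs_scalM.
Qed.
Lemma pden_mul1 env c w l :
  pden env (map (fun m => (Cmult c (fst m), w ++ snd m)) l)
  = (c ** wden env w) * pden env l.
Proof.
  elim: l => [|m l IH] /=; first by rewrite cs_mul0r.
  rewrite IH wden_app cs_mulDr -(cs_scal_mulr _ (fst m)) -(cs_scal_mull _ c _ (wden env (snd m))) -cs_scalM.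
  by rewrite Cmult_comm.
Qed.
Lemma pden_nnf env e : pden env (nnf e) = nden env e.
Proof.
  elim: e => [n| | |e IHe f IHf|e IH|e IHe f IHf|a e IH] /=.
  - by rewrite cs_mul1r cs_scal1 cs_addr0.
  - by [].
  - by rewrite cs_scal1 cs_addr0.
  - by rewrite pden_app IHe IHf.
  - by rewrite pden_scal IH cs_oppE.
  - rewrite -IHe; elim: (nnf e) => [|m l IHl] /=; first by rewrite cs_mul0l.
    by rewrite pden_app IHl pden_mul1 IHf cs_mulDl.
  - by rewrite pden_scal IH.
Qed.
Lemma word_eqb_eq v w : word_eqb v w = true -> v = w.
Proof.
  elim: v w => [|i v IH] [|j w] //=.
  by case E: (Nat.eqb i j) => // /IH ->; rewrite (proj1 (Nat.eqb_eq i j) E).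
Qed.
Lemma pden_collect env l : pden env (ncollect l) = pden env l.
Proof.
  have H1 c w l' : pden env (ncollect1 c w l') = c ** wden env w + pden env l'.
    elim: l' => [|[c' w'] l' IH] //=.
    case E: (word_eqb w w') => /=.
      by rewrite (word_eqb_eq _ _ E) cs_scalDl cs_addA.
    by rewrite IH !cs_addA (cs_addC _ (c' ** _)).
  by elim: l => [|[c w] l IH] //=; rewrite H1 IH.
Qed.
Lemma pden_allz env l : nallz l -> pden env l = 0.
Proof.
  by elim: l => [|[c w] l IH] //= [-> /IH ->]; rewrite cs_scal0l cs_add0.
Qed.

(** Words are compared syntactically while coefficients stay symbolic, so after evaluation the
    premise is a finite conjunction of identities between complex numbers. *)
Lemma ncP env e f :
  nallz (ncollect (nnf (NAdd e (NOpp f)))) -> nden env e = nden env f.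
Proof.
  move=> H; apply cs_sub_eq0.
  rewrite -/(nden env (NAdd e (NOpp f))) -pden_nnf -pden_collect.
  exact: pden_allz.
Qed.

End Normalise.

Ltac nc_index x l :=
  match l with
  | x :: _ => constr:(O)
  | _ :: ?l => let n := nc_index x l in constr:(S n)
  end.
Ltac nc_add x l :=
  match l with
  | _ => let _ := nc_index x l in l
  | _ => constr:(x :: l)
  end.
Ltac nc_atoms t l :=
  match t with
  | cs_add ?a ?b => let l := nc_atoms a l in nc_atoms b l
  | cs_mul ?a ?b => let l := nc_atoms a l in nc_atoms b l
  | cs_opp ?a => nc_atoms a l
  | cs_scal _ ?a => nc_atoms a l
  | cs_zero => l
  | cs_one => l
  | _ => nc_add t l
  end.
Ltac nc_reify t l :=
  match t with
  | cs_add ?a ?b => let a := nc_reify a l in let b := nc_reify b l in constr:(NAdd a b)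
  | cs_mul ?a ?b => let a := nc_reify a l in let b := nc_reify b l in constr:(NMul a b)
  | cs_opp ?a => let a := nc_reify a l in constr:(NOpp a)
  | cs_scal ?c ?a => let a := nc_reify a l in constr:(NScal c a)
  | cs_zero => constr:(N0)
  | cs_one => constr:(N1)
  | _ => let n := nc_index t l in constr:(NV n)
  end.
Ltac C_solve :=
  apply injective_projections; simpl; first [ring | field | lra]; try lra.
(** Proves identities of noncommutative [*]-polynomials with complex coefficients;
    adjoints must already have been pushed to the atoms. *)
Ltac nc :=
  lazymatch goal with
  | |- @eq (cs ?A) ?x ?y =>
    let l := nc_atoms x (@nil (cs A)) in
    let l := nc_atoms y l in
    let e := nc_reify x l in
    let f := nc_reify y l in
    let env := constr:(fun i => nth i l (@cs_zero A)) in
    change (nden env e = nden env f); apply ncP;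
    cbv [nnf ncollect ncollect1 nallz flat_map map app word_eqb Nat.eqb fst snd];
    repeat split; C_solve
  end.
Lemma le_of_sq_le x y : 0 <= y -> x * x <= y * y -> x <= y.
Proof. by move=> Hy H; case: (Rle_lt_dec x y) => // Hlt; nra. Qed.

(** * Square roots and positivity in C*-algebras *)

Section Norm.
Local Open Scope cs_scope.
Context {A : CStar}.
Implicit Types x y z c : A.

Definition cs_const (t : R) : A := RtoC t ** cs_one.

Lemma cs_norm0 : cs_norm (0 : A) = 0%R.
Proof. by rewrite -(cs_scal0l 0) cs_normZ Cmod_0 Rmult_0_l. Qed.
Lemma cs_normZR t x : cs_norm (RtoC t ** x) = (Rabs t * cs_norm x)%R.
Proof. by rewrite cs_normZ Cmod_R. Qed.
Lemma cs_normN x : cs_norm (- x) = cs_norm x.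
Proof. by rewrite cs_oppE cs_normZR Rabs_Ropp Rabs_R1 Rmult_1_l. Qed.
Lemma cs_norm_ge0 x : (0 <= cs_norm x)%R.
Proof.
  have := cs_normD _ x (- x); rewrite cs_normN cs_subrr cs_norm0; lra.
Qed.
Lemma cs_norm_subC x y : cs_norm (x - y) = cs_norm (y - x).
Proof. rewrite -cs_normN; congr cs_norm; nc. Qed.
Lemma cs_norm_tri x y z : (cs_norm (x - z) <= cs_norm (x - y) + cs_norm (y - z))%R.
Proof. have -> : x - z = (x - y) + (y - z) by nc. exact: cs_normD. Qed.
Lemma cs_norm_le0 x : (cs_norm x <= 0)%R -> x = 0.
Proof. by move=> H; apply cs_norm_eq0; have := cs_norm_ge0 x; lra. Qed.

Lemma cs_star1 : cs_star (1 : A) = 1.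
Proof. by rewrite -{2}(cs_starK _ 1) -{1}(cs_mul1r _ (1^*)) -{2}(cs_starK _ 1) -cs_starM cs_mul1r cs_starK. Qed.
Lemma cs_starN x : cs_star (- x) = - cs_star x.
Proof. rewrite !cs_oppE cs_starZ; congr cs_scal; C_solve. Qed.
Lemma cs_star0 : cs_star (0 : A) = 0.
Proof.
  rewrite -{1}(cs_scal0l 0) cs_starZ.
  have -> : Cconj (RtoC 0) = RtoC 0 by C_solve.
  exact: cs_scal0l.
Qed.
Lemma cs_starZR t x : cs_star (RtoC t ** x) = RtoC t ** cs_star x.
Proof. rewrite cs_starZ; congr cs_scal; C_solve. Qed.

Lemma cs_norm_star x : cs_norm (x^*) = cs_norm x.
Proof.
  have H y : (cs_norm y <= cs_norm (y^*))%R.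
    have := cs_Cstar _ y; have := cs_normM _ (y^*) y.
    have := cs_norm_ge0 y; have := cs_norm_ge0 (y^*); nra.
  by have := H x; have := H (x^*); rewrite cs_starK; lra.
Qed.
Lemma cs_norm_sa x : x^* = x -> cs_norm (x * x) = (cs_norm x * cs_norm x)%R.
Proof. by move=> H; rewrite -cs_Cstar H. Qed.
Lemma cs_norm1 : (cs_norm (1 : A) <= 1)%R.
Proof.
  have := cs_norm_sa 1 cs_star1; rewrite cs_mul1l; have := cs_norm_ge0 1; nra.
Qed.
Lemma cs_norm_const t : (cs_norm (cs_const t) <= Rabs t)%R.
Proof.
  rewrite /cs_const cs_normZR; have := cs_norm1; have := Rabs_pos t; nra.
Qed.
Lemma cs_star_const t : cs_star (cs_const t) = cs_const t.
Proof. by rewrite /cs_const cs_starZR cs_star1. Qed.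
Lemma cs_sa_sq0 x : x^* = x -> x * x = 0 -> x = 0.
Proof.
  move=> Hx H; apply cs_norm_eq0; have := cs_norm_sa x Hx.
  rewrite H cs_norm0; nra.
Qed.

Definition cs_lim (u : nat -> A) (l : A) : Prop :=
  forall eps, (0 < eps)%R -> exists N, forall n, (N <= n)%nat -> (cs_norm (u n - l) < eps)%R.

Lemma cs_lim_unique u l m : cs_lim u l -> cs_lim u m -> l = m.
Proof.
  move=> Hl Hm; apply cs_sub_eq0, cs_norm_le0.
  apply Rnot_lt_le => H.
  have [N HN] := Hl (cs_norm (l - m) / 2)%R ltac:(lra).
  have [M HM] := Hm (cs_norm (l - m) / 2)%R ltac:(lra).
  have := HN (N + M)%nat ltac:(lia); have := HM (N + M)%nat ltac:(lia).
  have := cs_norm_tri l (u (N + M)%nat) m; rewrite (cs_norm_subC l (u _)); lra.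
Qed.
Lemma cs_lim_dom u l (v : nat -> R) k :
  (0 <= k)%R -> (forall n, cs_norm (u n - l) <= k * v n)%R ->
  (forall eps, (0 < eps)%R -> exists N, forall n, (N <= n)%nat -> (v n < eps)%R) ->
  cs_lim u l.
Proof.
  move=> Hk H Hv eps He.
  have [N HN] := Hv (eps / (k + 1))%R ltac:(apply Rdiv_lt_0_compat; lra).
  exists N => n Hn; apply: Rle_lt_trans (H n) _.
  have := HN n Hn => H1.
  have H2 := Rmult_lt_compat_r (k + 1)%R _ _ ltac:(lra) H1.
  have E : (eps / (k + 1) * (k + 1) = eps)%R by field; lra.
  rewrite E in H2; case: (Rle_lt_dec 0 (v n)) => Hv0; nra.
Qed.
Lemma cs_lim_mull c u l : cs_lim u l -> cs_lim (fun n => c * u n) (c * l).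
Proof.
  move=> H; apply (cs_lim_dom _ _ (fun n => cs_norm (u n - l)) (cs_norm c)) => // [|n].
    exact: cs_norm_ge0.
  have -> : c * u n - c * l = c * (u n - l) by nc.
  exact: cs_normM.
Qed.
Lemma cs_lim_mulr c u l : cs_lim u l -> cs_lim (fun n => u n * c) (l * c).
Proof.
  move=> H; apply (cs_lim_dom _ _ (fun n => cs_norm (u n - l)) (cs_norm c)) => // [|n].
    exact: cs_norm_ge0.
  have -> : u n * c - l * c = (u n - l) * c by nc.
  by rewrite Rmult_comm; exact: cs_normM.
Qed.
Lemma cs_lim_star u l : cs_lim u l -> cs_lim (fun n => (u n)^*) (l^*).
Proof.
  move=> H; apply (cs_lim_dom _ _ (fun n => cs_norm (u n - l)) 1) => // [|n]; first lra.
  rewrite -cs_starN -cs_starD cs_norm_star; lra.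
Qed.
Lemma cs_lim_norm u l t : (forall n, (cs_norm (u n) <= t)%R) -> cs_lim u l -> (cs_norm l <= t)%R.
Proof.
  move=> H Hl; apply Rnot_lt_le => Hlt.
  have [N HN] := Hl (cs_norm l - t)%R ltac:(lra).
  have := HN N (le_n _); have := H N.
  have := cs_norm_tri l (u N) 0; rewrite (cs_norm_subC l (u _)).
  have -> : u N - 0 = u N by nc.
  have -> : l - 0 = l by nc.
  lra.
Qed.

End Norm.

(** The iteration [y <- (z + y^2)/2] has polynomials in [z] with
    nonnegative coefficients as iterates, so the scalar sequence at [z = 1]
    dominates its increments; its limit [y] satisfies [(1-y)^2 = 1-z]. *)
Fixpoint sqr_it {A : CStar} (z : A) (n : nat) : A :=
  match n with
  | O => cs_zero
  | S n => cs_scal (RtoC (1/2)) (cs_add z (cs_mul (sqr_it z n) (sqr_it z n)))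
  end.
Fixpoint sqr_itR (n : nat) : R :=
  match n with O => 0 | S n => (1 + sqr_itR n * sqr_itR n) / 2 end.

Lemma sqr_itR_bounds n : 0 <= sqr_itR n <= 1.
Proof. by elim: n => [|n IH] /=; [lra|nra]. Qed.
Lemma sqr_itR_growing : Un_growing sqr_itR.
Proof.
  move=> n /=; have := sqr_itR_bounds n => H.
  have := Rle_0_sqr (1 - sqr_itR n); rewrite /Rsqr; lra.
Qed.

Section Sqrt.
Local Open Scope cs_scope.
Context {A : CStar}.
Implicit Types x y z c h : A.

(** To be read as $1-\sqrt{1-z}$; it is used only for [z] of norm at most 1, where the iterates
    converge. *)
Definition cs_sqy z : A := epsilon (inhabits (0 : A)) (fun y => cs_lim (sqr_it z) y).

Lemma sqr_it_norm z n : (cs_norm z <= 1)%R -> (cs_norm (sqr_it z n) <= sqr_itR n)%R.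
Proof.
  move=> Hz; elim: n => [|n IH] /=; first by rewrite cs_norm0; lra.
  rewrite cs_normZR Rabs_pos_eq; last lra.
  have := cs_normD _ z (sqr_it z n * sqr_it z n).
  have := cs_normM _ (sqr_it z n) (sqr_it z n); have := cs_norm_ge0 (sqr_it z n); nra.
Qed.

Lemma sqr_it_step z n : (cs_norm z <= 1)%R ->
  (cs_norm (sqr_it z (S n) - sqr_it z n) <= sqr_itR (S n) - sqr_itR n)%R.
Proof.
  move=> Hz; elim: n => [|n IH].
    have -> : sqr_it z 1 - sqr_it z 0 = RtoC (1/2) ** z by rewrite /=; nc.
    rewrite cs_normZR Rabs_pos_eq /=; lra.
  set a := sqr_it z (S n) in IH *; set b := sqr_it z n in IH *.
  have -> : sqr_it z (S (S n)) - a
    = RtoC (1/4) ** ((a - b) * (a + b) + (a + b) * (a - b)).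
    have Ea : a = RtoC (1/2) ** (z + b * b) by [].
    have -> : sqr_it z (S (S n)) = RtoC (1/2) ** (z + a * a) by [].
    have -> : RtoC (1/2) ** (z + a * a) - a
      = RtoC (1/2) ** (z + a * a) - RtoC (1/2) ** (z + b * b) by rewrite -Ea.
    nc.
  have -> : sqr_itR (S (S n)) = ((1 + sqr_itR (S n) * sqr_itR (S n)) / 2)%R by [].
  have -> : (((1 + sqr_itR (S n) * sqr_itR (S n)) / 2 - sqr_itR (S n))
    = (sqr_itR (S n) - sqr_itR n) * (sqr_itR (S n) + sqr_itR n) / 2)%R.
    have -> : sqr_itR (S n) = ((1 + sqr_itR n * sqr_itR n) / 2)%R by []; field.
  rewrite cs_normZR Rabs_pos_eq; last lra.
  have := cs_normD _ ((a - b) * (a + b)) ((a + b) * (a - b)).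
  have := cs_normM _ (a - b) (a + b); have := cs_normM _ (a + b) (a - b).
  have := cs_normD _ a b; have := cs_norm_ge0 (a - b); have := cs_norm_ge0 (a + b).
  have := sqr_it_norm z (S n) Hz; have := sqr_it_norm z n Hz; rewrite -/a -/b.
  move: IH; move: (sqr_itR (S n)) (sqr_itR n) => Y y.
  move: (cs_norm (a - b)) (cs_norm (a + b)) (cs_norm a) (cs_norm b) => d s na nb.
  move=> H1 H2 H3 H4 H5 H6 H7 H8 H9.
  have : (d * s <= (Y - y) * (Y + y))%R by apply Rmult_le_compat; lra.
  nra.
Qed.

Lemma sqr_it_cauchy z n k : (cs_norm z <= 1)%R ->
  (cs_norm (sqr_it z (n + k) - sqr_it z n) <= sqr_itR (n + k) - sqr_itR n)%R.
Proof.
  move=> Hz; elim: k => [|k IH].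
    by rewrite Nat.add_0_r cs_subrr cs_norm0; lra.
  rewrite Nat.add_succ_r; have := sqr_it_step z (n + k) Hz.
  have := cs_norm_tri (sqr_it z (S (n + k))) (sqr_it z (n + k)) (sqr_it z n); lra.
Qed.

Lemma cs_sqy_lim z : (cs_norm z <= 1)%R -> cs_lim (sqr_it z) (cs_sqy z).
Proof.
  move=> Hz; apply (epsilon_spec (inhabits (0 : A)) (fun y => cs_lim (sqr_it z) y)).
  have [l Hl] : exists l, Un_cv sqr_itR l.
    have [|l Hl] := growing_cv sqr_itR sqr_itR_growing; last by exists l.
    by exists 1%R => x [n ->]; apply sqr_itR_bounds.
  have Hle m : (sqr_itR m <= l)%R by apply (growing_ineq _ _ sqr_itR_growing Hl).
  apply (cs_complete A (sqr_it z)) => eps He.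
  have [N HN] := Hl eps He; exists N => m n Hm Hn.
  have Hnm p k : (N <= p)%nat -> (cs_norm (sqr_it z (p + k) - sqr_it z p) < eps)%R.
    move=> Hp; have := sqr_it_cauchy z p k Hz; have := Hle (p + k)%nat.
    have := HN p Hp; rewrite /R_dist Rabs_left1; last by have := Hle p; lra.
    lra.
  case: (Compare_dec.le_lt_dec m n) => Hmn.
    by rewrite cs_norm_subC -(Nat.sub_add m n) // Nat.add_comm; apply Hnm.
  by rewrite -(Nat.sub_add n m) 1?Nat.add_comm; [apply Hnm|lia].
Qed.

Lemma cs_sqy_norm z : (cs_norm z <= 1)%R -> (cs_norm (cs_sqy z) <= 1)%R.
Proof.
  move=> Hz; apply: cs_lim_norm (cs_sqy_lim z Hz) => n.
  by have := sqr_it_norm z n Hz; have := sqr_itR_bounds n; lra.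
Qed.

(** The iterates at [z] and [z'] are values of the same polynomials, so [c] intertwines them and
    then their limits. Besides commutation with one element, this covers the passage between $x^*x$
    and $xx^*$. *)
Lemma cs_sqy_comm c z z' : (cs_norm z <= 1)%R -> (cs_norm z' <= 1)%R ->
  c * z = z' * c -> c * cs_sqy z = cs_sqy z' * c.
Proof.
  move=> Hz Hz' H.
  have Hn n : c * sqr_it z n = sqr_it z' n * c.
    elim: n => [|n IH] /=; first by rewrite cs_mul0l cs_mul0r.
    rewrite -cs_scal_mulr -cs_scal_mull cs_mulDr cs_mulDl H.
    by rewrite cs_mulA IH -cs_mulA IH cs_mulA.
  apply: cs_lim_unique (cs_lim_mull c _ _ (cs_sqy_lim z Hz)) _.
  have := cs_lim_mulr c _ _ (cs_sqy_lim z' Hz').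
  by move=> H1 eps He; have [N HN] := H1 eps He; exists N => n Hn1; rewrite Hn; apply HN.
Qed.

Lemma cs_sqy_sa z : (cs_norm z <= 1)%R -> z^* = z -> (cs_sqy z)^* = cs_sqy z.
Proof.
  move=> Hz H.
  have Hn n : (sqr_it z n)^* = sqr_it z n.
    by elim: n => [|n IH] /=; rewrite ?cs_star0 // cs_starZR cs_starD cs_starM IH H.
  apply: cs_lim_unique (cs_lim_star _ _ (cs_sqy_lim z Hz)) _ => eps He.
  by have [N HN] := cs_sqy_lim z Hz eps He; exists N => n Hn1; rewrite Hn; apply HN.
Qed.

Lemma cs_sqyE z : (cs_norm z <= 1)%R ->
  (1 - cs_sqy z) * (1 - cs_sqy z) = 1 - z.
Proof.
  move=> Hz; set y := cs_sqy z.
  suff H : RtoC 2 ** y = z + y * y.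
    have -> : (1 - y) * (1 - y) = 1 - RtoC 2 ** y + y * y by nc.
    by rewrite H; nc.
  have Hl := cs_sqy_lim z Hz; rewrite -/y in Hl.
  apply: (cs_lim_unique (fun n => RtoC 2 ** sqr_it z (S n))).
    apply (cs_lim_dom _ _ (fun n => cs_norm (sqr_it z (S n) - y)) 2) => [|n|eps He].
    - lra.
    - have -> : RtoC 2 ** sqr_it z (S n) - RtoC 2 ** y = RtoC 2 ** (sqr_it z (S n) - y) by nc.
      rewrite cs_normZR Rabs_pos_eq; lra.
    - by have [N HN] := Hl eps He; exists N => n Hn; apply HN; lia.
  apply (cs_lim_dom _ _ (fun n => cs_norm (sqr_it z n - y)) 2) => [|n|eps He].
  - lra.
  - set a := sqr_it z n.
    have -> : RtoC 2 ** sqr_it z (S n) - (z + y * y) = a * (a - y) + (a - y) * y.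
      by rewrite /= -/a; nc.
    have := cs_normD _ (a * (a - y)) ((a - y) * y).
    have := cs_normM _ a (a - y); have := cs_normM _ (a - y) y.
    have := cs_norm_ge0 (a - y); have := cs_sqy_norm z Hz; rewrite -/y.
    have := sqr_it_norm z n Hz; have := sqr_itR_bounds n; rewrite -/a.
    have := cs_norm_ge0 a; have := cs_norm_ge0 y; nra.
  - by have [N HN] := Hl eps He; exists N => n Hn; apply HN.
Qed.

End Sqrt.

(** * Positive elements, treated without spectra *)

Section Positive.
Local Open Scope cs_scope.
Context {A : CStar}.
Implicit Types x y z c h k r s : A.

(** For self-adjoint [h] the norm condition places the spectrum in $[0,2t]$. In this form closure
    under sums is just the triangle inequality. *)
Definition cs_pos h : Prop :=
  h^* = h /\ exists t, (0 <= t)%R /\ (cs_norm (cs_const t - h) <= t)%R.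

Lemma cs_const1 : cs_const 1 = (1 : A).
Proof. rewrite /cs_const; nc. Qed.

Lemma cs_pos_large h : cs_pos h ->
  exists t, (0 < t)%R /\ forall u, (t <= u)%R -> (cs_norm (cs_const u - h) <= u)%R.
Proof.
  move=> [_ [t [Ht H]]]; exists (t + 1)%R; split => [|u Hu]; first lra.
  have -> : cs_const u - h = cs_const (u - t) + (cs_const t - h) by rewrite /cs_const; nc.
  have := cs_normD _ (cs_const (u - t)) (cs_const t - h).
  have := @cs_norm_const A (u - t); rewrite Rabs_pos_eq; lra.
Qed.

Lemma cs_posD h k : cs_pos h -> cs_pos k -> cs_pos (h + k).
Proof.
  move=> [Hh [t [Ht H]]] [Hk [u [Hu H']]]; split; first by rewrite cs_starD Hh Hk.
  exists (t + u)%R; split; first lra.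
  have -> : cs_const (t + u) - (h + k) = (cs_const t - h) + (cs_const u - k)
    by rewrite /cs_const; nc.
  have := cs_normD _ (cs_const t - h) (cs_const u - k); lra.
Qed.

Lemma cs_posZ a h : (0 <= a)%R -> cs_pos h -> cs_pos (RtoC a ** h).
Proof.
  move=> Ha [Hh [t [Ht H]]]; split; first by rewrite cs_starZR Hh.
  exists (a * t)%R; split; first nra.
  have -> : cs_const (a * t) - RtoC a ** h = RtoC a ** (cs_const t - h)
    by rewrite /cs_const; nc.
  rewrite cs_normZR Rabs_pos_eq //; nra.
Qed.

Lemma cs_pos_const t : (0 <= t)%R -> cs_pos (cs_const t).
Proof.
  move=> Ht; split; first exact: cs_star_const.
  by exists t; split => //; rewrite cs_subrr cs_norm0.
Qed.
Lemma cs_pos0 : cs_pos 0.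
Proof. by have := cs_pos_const 0 (Rle_refl _); rewrite /cs_const cs_scal0l. Qed.

(** The commutation clause is the functional-calculus fact that [s] is a limit
    of polynomials in [h]. *)
Lemma cs_pos_sqrt h : cs_pos h ->
  exists s, cs_pos s /\ s * s = h /\ forall c, c * h = h * c -> c * s = s * c.
Proof.
  move=> Hh; have [t [Ht Hl]] := cs_pos_large h Hh.
  have Hsa : h^* = h by case: Hh.
  set z := 1 - RtoC (/ t) ** h.
  have Hz : (cs_norm z <= 1)%R.
    have -> : z = RtoC (/ t) ** (cs_const t - h).
      rewrite /z /cs_const; nc.
    rewrite cs_normZR Rabs_pos_eq; last by apply Rlt_le, Rinv_0_lt_compat.
    have := Hl t (Rle_refl _) => H.
    rewrite -(Rinv_l t); last lra.
    apply Rmult_le_compat_l => //; by apply Rlt_le, Rinv_0_lt_compat.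
  have Hzs : z^* = z by rewrite /z cs_starD cs_starN cs_starZR Hsa cs_star1.
  have Hst : (sqrt t * sqrt t = t)%R by apply sqrt_sqrt; lra.
  have Hst0 : (0 < sqrt t)%R by apply sqrt_lt_R0.
  exists (RtoC (sqrt t) ** (1 - cs_sqy z)); split; last split.
  - apply cs_posZ; first lra; split.
      by rewrite cs_starD cs_starN cs_star1 cs_sqy_sa.
    exists 1%R; split; first lra.
    have -> : cs_const 1 - (1 - cs_sqy z) = cs_sqy z by rewrite /cs_const; nc.
    exact: cs_sqy_norm.
  - have -> : (RtoC (sqrt t) ** (1 - cs_sqy z)) * (RtoC (sqrt t) ** (1 - cs_sqy z))
      = RtoC (sqrt t * sqrt t) ** ((1 - cs_sqy z) * (1 - cs_sqy z)) by nc.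
    rewrite Hst cs_sqyE //.
    have -> : 1 - z = RtoC (/ t) ** h by rewrite /z; nc.
    rewrite -cs_scalM -{2}(cs_scal1 _ h); congr cs_scal; C_solve.
  - move=> c Hc.
    have H : c * cs_sqy z = cs_sqy z * c.
      apply cs_sqy_comm => //; rewrite /z cs_mulDl cs_mulDr cs_mul1l cs_mul1r.
      have -> : c * - (RtoC (/ t) ** h) = - (RtoC (/ t) ** (c * h)) by nc.
      rewrite Hc; nc.
    have -> : c * (RtoC (sqrt t) ** (1 - cs_sqy z))
      = RtoC (sqrt t) ** (c - c * cs_sqy z) by nc.
    rewrite H; nc.
Qed.

(** By commutation $u=s+ir$ satisfies $u^*u=s^2+r^2=t$, so the C*-identity bounds [u], and [s] is
    the real part of [u]. This replaces spectral estimates throughout. *)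
Lemma cs_sum_sq_norm s r t : (0 <= t)%R -> s^* = s -> r^* = r -> s * r = r * s ->
  s * s + r * r = cs_const t -> (cs_norm s * cs_norm s <= t)%R.
Proof.
  move=> Ht Hs Hr Hc H; set u := s + Ci ** r.
  have Hu : u^* = s - Ci ** r.
    rewrite /u cs_starD cs_starZ Hs Hr cs_oppE -cs_scalM; congr (_ + _ ** _).
    C_solve.
  have Huu : u^* * u = cs_const t.
    rewrite Hu /u -H.
    have -> : (s - Ci ** r) * (s + Ci ** r) = s * s + r * r + Ci ** (s * r - r * s) by nc.
    rewrite Hc; nc.
  have Hn : (cs_norm u * cs_norm u <= t)%R.
    rewrite -cs_Cstar Huu -{2}(Rabs_pos_eq t) //; exact: cs_norm_const.
  have E : s = RtoC (1/2) ** (u + u^*) by rewrite Hu /u; nc.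
  have : (cs_norm s <= cs_norm u)%R.
    rewrite {1}E cs_normZR Rabs_pos_eq; last lra.
    by have := cs_normD _ u (u^*); rewrite cs_norm_star; lra.
  have := cs_norm_ge0 s; nra.
Qed.

(** With $w=\sqrt{1-r^2}$, which commutes with [r], one has $w^2+r^2=1$, and [cs_sum_sq_norm] bounds
    [w]. This is what makes squares positive. *)
Lemma cs_norm_one_sub_sq r : r^* = r -> (cs_norm r <= 1)%R -> (cs_norm (1 - r * r) <= 1)%R.
Proof.
  move=> Hr Hn.
  have Hz : (cs_norm (r * r) <= 1)%R.
    by rewrite cs_norm_sa //; have := cs_norm_ge0 r; nra.
  have Hzs : (r * r)^* = r * r by rewrite cs_starM Hr.
  rewrite -cs_sqyE //; set w := 1 - _.
  have Hw : w^* = w by rewrite /w cs_starD cs_starN cs_star1 cs_sqy_sa.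
  have Hc : r * cs_sqy (r * r) = cs_sqy (r * r) * r.
    by apply cs_sqy_comm => //; rewrite cs_mulA.
  rewrite cs_norm_sa //; apply (cs_sum_sq_norm w r 1) => //; first lra.
  - have -> : w * r = r - cs_sqy (r * r) * r by rewrite /w; nc.
    rewrite -Hc /w; nc.
  - rewrite /w cs_sqyE //; rewrite /cs_const; nc.
Qed.

Lemma cs_pos_sq s : s^* = s -> cs_pos (s * s).
Proof.
  have H1 r : r^* = r -> (cs_norm r <= 1)%R -> cs_pos (r * r).
    move=> Hr Hn; split; first by rewrite cs_starM Hr.
    exists 1%R; split; first lra.
    rewrite cs_const1; exact: cs_norm_one_sub_sq.
  move=> Hs; set M := (cs_norm s + 1)%R.
  have HM : (0 < M)%R by have := cs_norm_ge0 s; rewrite /M; lra.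
  have -> : s * s = RtoC (M * M) ** ((RtoC (/ M) ** s) * (RtoC (/ M) ** s)).
    nc.
  apply cs_posZ; first nra.
  apply H1; first by rewrite cs_starZR Hs.
  rewrite cs_normZR Rabs_pos_eq; last by apply Rlt_le, Rinv_0_lt_compat.
  rewrite -(Rinv_l M); last lra.
  apply Rmult_le_compat_l; first by apply Rlt_le, Rinv_0_lt_compat.
  rewrite /M; lra.
Qed.

(** The square roots of [h] and $t-h$ commute and their squares add up to [t], which is the
    situation of [cs_sum_sq_norm]. *)
Lemma cs_pos_le h t : (0 <= t)%R -> cs_pos h -> cs_pos (cs_const t - h) ->
  (cs_norm h <= t)%R.
Proof.
  move=> Ht Hh Hk.
  have [s [[Hs _] [Hss Hsc]]] := cs_pos_sqrt h Hh.
  have [r [[Hr _] [Hrr Hrc]]] := cs_pos_sqrt _ Hk.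
  rewrite -Hss cs_norm_sa //; apply (cs_sum_sq_norm s r t) => //; last first.
    rewrite Hss Hrr; nc.
  have Hsh : s * h = h * s by rewrite -Hss cs_mulA.
  apply Hrc; have -> : s * (cs_const t - h) = cs_const t * s - s * h by rewrite /cs_const; nc.
  rewrite Hsh; nc.
Qed.

Lemma cs_pos_antisym h : cs_pos h -> cs_pos (- h) -> h = 0.
Proof.
  move=> H H'; apply cs_norm_le0, cs_pos_le => //; first lra.
  by rewrite /cs_const cs_scal0l cs_add0.
Qed.

Lemma cs_pos_norm h t : h^* = h -> (cs_norm h <= t)%R -> cs_pos (cs_const t - h).
Proof.
  move=> Hh Ht; split; first by rewrite cs_starD cs_starN cs_star_const Hh.
  have := cs_norm_ge0 h => H0.
  exists t; split; first lra.
  by have -> : cs_const t - (cs_const t - h) = h by nc.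
Qed.

Lemma cs_pos_sum0 h k : cs_pos h -> cs_pos k -> h + k = 0 -> h = 0.
Proof.
  move=> Hh Hk H; apply cs_pos_antisym => //.
  have -> : - h = k; last by [].
  have -> : k = (h + k) - h by nc.
  rewrite H; nc.
Qed.

Lemma mul_sq_comm x y : x * y = y * x -> (x * y) * (x * y) = (x * x) * (y * y).
Proof. by move=> H; rewrite -!cs_mulA (cs_mulA _ y x y) -H -!cs_mulA. Qed.

(** For $d=r-s$ the sum of squares $(d\sqrt r)^2+(d\sqrt s)^2=d^2(r+s)=d(r^2-s^2)$ is zero. Hence
    $d\sqrt r=d\sqrt s=0$, and $d^2=dr-ds=0$. *)
Lemma cs_pos_sqrt_unique r s : cs_pos r -> cs_pos s -> r * s = s * r ->
  r * r = s * s -> r = s.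
Proof.
  move=> Hr Hs Hc Heq.
  have [a [[Ha _] [Haa Hac]]] := cs_pos_sqrt r Hr.
  have [b [[Hb _] [Hbb Hbc]]] := cs_pos_sqrt s Hs.
  have [Hrs _] := Hr; have [Hss _] := Hs.
  set d := r - s.
  have Hd : d^* = d by rewrite /d cs_starD cs_starN Hrs Hss.
  have Hda : d * a = a * d.
    apply Hac; have -> : d * r = r * r - s * r by rewrite /d; nc.
    rewrite -Hc /d; nc.
  have Hdb : d * b = b * d.
    apply Hbc; have -> : d * s = r * s - s * s by rewrite /d; nc.
    rewrite Hc /d; nc.
  have Hsum : (d * a) * (d * a) + (d * b) * (d * b) = 0.
    rewrite !mul_sq_comm // Haa Hbb.
    have -> : d * d * r + d * d * s = d * (r * r - s * s) + d * (r * s - s * r).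
      by rewrite /d; nc.
    rewrite Heq Hc; nc.
  have Hsa x : x^* = x -> d * x = x * d -> (d * x)^* = d * x.
    by move=> Hx Hdx; rewrite cs_starM Hx Hd.
  have H1 : d * a = 0.
    apply cs_sa_sq0; first exact: Hsa.
    by apply: cs_pos_sum0 Hsum; apply cs_pos_sq; apply Hsa.
  have H2 : d * b = 0.
    apply cs_sa_sq0; first exact: Hsa.
    by rewrite -Hsum H1 cs_mul0l cs_add0.
  apply cs_sub_eq0, cs_sa_sq0; first exact: Hd.
  rewrite -/d {2}/d.
  have -> : d * (r - s) = (d * a) * a - (d * b) * b by rewrite -!cs_mulA Haa Hbb; nc.
  rewrite H1 H2; nc.
Qed.

Lemma cs_abs h : h^* = h ->
  exists m, cs_pos m /\ m * m = h * h /\ forall c, c * h = h * c -> c * m = m * c.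
Proof.
  move=> Hh; have [m [Hm [Hmm Hc]]] := cs_pos_sqrt _ (cs_pos_sq h Hh).
  exists m; do 2 split => //; move=> c Hch; apply Hc.
  by rewrite cs_mulA Hch -cs_mulA Hch cs_mulA.
Qed.

(** The left side is the positive square root of $h^2$ supplied by the iteration, so uniqueness
    applies. It upgrades an intertwiner of squares of positive contractions to one of the
    contractions themselves. *)
Lemma cs_sqy_pos h : cs_pos h -> (cs_norm h <= 1)%R -> 1 - cs_sqy (1 - h * h) = h.
Proof.
  move=> Hh Hnh; have [Hhs _] := Hh.
  have Hz := cs_norm_one_sub_sq h Hhs Hnh.
  have Hzs : (1 - h * h)^* = 1 - h * h.
    by rewrite cs_starD cs_starN cs_starM cs_star1 Hhs.
  apply cs_pos_sqrt_unique => //.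
  - split; first by rewrite cs_starD cs_starN cs_star1 cs_sqy_sa.
    exists 1%R; split; first lra.
    have -> : cs_const 1 - (1 - cs_sqy (1 - h * h)) = cs_sqy (1 - h * h).
      by rewrite /cs_const; nc.
    exact: cs_sqy_norm.
  - have Hc : h * cs_sqy (1 - h * h) = cs_sqy (1 - h * h) * h.
      apply cs_sqy_comm => //; nc.
    have -> : (1 - cs_sqy (1 - h * h)) * h = h - cs_sqy (1 - h * h) * h by nc.
    rewrite -Hc; nc.
  - rewrite cs_sqyE //; nc.
Qed.

(** [x^* x] and [x x^*] have the same continuous functional calculus up to the
    intertwiner [x]; applied to the absolute value this replaces the usual
    comparison of the nonzero spectra of [xy] and [yx]. *)
Lemma cs_neg_square0 x : cs_pos (- (x^* * x)) -> (cs_norm x <= 1)%R -> x = 0.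
Proof.
  move=> Hk Hn; set k := - (x^* * x) in Hk *; set l := x * x^*.
  have Hks : k^* = k by case: Hk.
  have Hls : l^* = l by rewrite /l cs_starM cs_starK.
  have Hl : cs_pos l.
    set a := RtoC (1/2) ** (x + x^*).
    set b := (Cmult (RtoC (1/2)) (Copp Ci)) ** (x - x^*).
    have Ha : a^* = a by rewrite /a cs_starZR cs_starD cs_starK cs_addC.
    have Hb : b^* = b.
      rewrite /b cs_starZ cs_starD cs_starN cs_starK.
      have -> : Cconj (Cmult (RtoC (1/2)) (Copp Ci)) = Cmult (RtoC (1/2)) Ci by C_solve.
      nc.
    (* With $x=a+ib$ one has $x^*x+xx^*=2(a^2+b^2)$, so a nonpositive $x^*x$ forces $xx^*$ to be
       positive. *)
    have -> : l = RtoC 2 ** (a * a + b * b) + k by rewrite /l /a /b /k; nc.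
    apply cs_posD => //; apply cs_posZ; first lra.
    by apply cs_posD; apply cs_pos_sq.
  have Hnk : (cs_norm k <= 1)%R.
    by rewrite /k cs_normN cs_Cstar; have := cs_norm_ge0 x; nra.
  have Hnl : (cs_norm l <= 1)%R.
    have := cs_Cstar _ (x^*); rewrite cs_starK -/l cs_norm_star => ->.
    by have := cs_norm_ge0 x; nra.
  have Hxk : x * k = - (l * x) by rewrite /k /l; nc.
  have Hc : x * cs_sqy (1 - k * k) = cs_sqy (1 - l * l) * x.
    apply cs_sqy_comm; try exact: cs_norm_one_sub_sq.
    have -> : x * (1 - k * k) = x - (x * k) * k by nc.
    have -> : (1 - l * l) * x = x + l * - (l * x) by nc.
    rewrite -Hxk Hxk.
    have -> : x - - (l * x) * k = x + l * (x * k) by nc.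
    by rewrite Hxk.
  (* The sign in [Hxk] disappears for $k^2$ and $l^2$; positive square roots bring back the opposite
     sign, so [x * k] is its own negative. *)
  have Hxk' : x * k = l * x.
    rewrite -(cs_sqy_pos k) // -(cs_sqy_pos l) //.
    have -> : x * (1 - cs_sqy (1 - k * k)) = x - x * cs_sqy (1 - k * k) by nc.
    rewrite Hc; nc.
  have H0 : x * k = 0.
    have -> : x * k = RtoC (1/2) ** (x * k + x * k) by nc.
    rewrite {1}Hxk Hxk'; nc.
  have Hk0 : k = 0.
    apply cs_sa_sq0 => //; rewrite {1}/k.
    have -> : - (x^* * x) * k = - (x^* * (x * k)) by nc.
    rewrite H0; nc.
  apply cs_norm_eq0; have := cs_Cstar _ x.
  have -> : x^* * x = - k by rewrite /k; nc.
  rewrite Hk0 cs_oppE cs_scal0r cs_norm0; nra.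
Qed.

Lemma cs_rescale x : exists t y, (0 < t)%R /\ (cs_norm y <= 1)%R /\ x = RtoC t ** y.
Proof.
  set M := (cs_norm x + 1)%R.
  have HM : (0 < M)%R by have := cs_norm_ge0 x; rewrite /M; lra.
  have Hi : (0 < / M)%R by apply Rinv_0_lt_compat.
  exists M, (RtoC (/ M) ** x); split => //; split; last nc.
  rewrite cs_normZR Rabs_pos_eq; last lra.
  rewrite -(Rinv_l M); last lra.
  apply Rmult_le_compat_l; first lra; rewrite /M; lra.
Qed.

(** Let $h=q^*q$, $a=|h|$, and let $m=a-h$ be twice the negative part of [h]. Since $hm=-am$, the
    element $y=qm$ has $y^*y=-(\sqrt a\,m)^2\le 0$, so $y=0$ by [cs_neg_square0] after rescaling.
    Then $am=0$ and $m^2=am-hm=0$, that is $h=a$. *)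
Theorem cs_pos_star_mul q : cs_pos (q^* * q).
Proof.
  set h := q^* * q.
  have Hh : h^* = h by rewrite /h cs_starM cs_starK.
  have [a [Ha [Haa Hac]]] := cs_abs h Hh.
  have [Has _] := Ha.
  have [r [[Hr _] [Hrr Hrc]]] := cs_pos_sqrt a Ha.
  set m := a - h.
  have Hms : m^* = m by rewrite /m cs_starD cs_starN Has Hh.
  have Hah : a * h = h * a by rewrite Hac.
  have Hma : m * a = a * m.
    rewrite /m; have -> : (a - h) * a = a * a - h * a by nc.
    rewrite -Hah; nc.
  have Hmr : m * r = r * m by apply Hrc.
  have Hhm : h * m = - (a * m).
    rewrite /m; have -> : h * (a - h) = h * a - h * h by nc.
    rewrite -Haa -Hah; nc.
  set k := (r * m) * (r * m).
  have Hks : (r * m)^* = r * m by rewrite cs_starM Hr Hms.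
  have Hym : (q * m)^* * (q * m) = - k.
    rewrite cs_starM Hms.
    have -> : m * q^* * (q * m) = m * (h * m) by rewrite /h; nc.
    rewrite Hhm /k mul_sq_comm // Hrr.
    have -> : m * - (a * m) = - ((m * a) * m) by nc.
    rewrite Hma; nc.
  have Hqm : q * m = 0.
    have [t [y [Ht [Hy Ey]]]] := cs_rescale (q * m).
    have Eyy : - (y^* * y) = RtoC (/ (t * t)) ** k.
      have -> : k = - ((q * m)^* * (q * m)) by rewrite Hym; nc.
      rewrite Ey cs_starZR; nc.
    suff Hy0 : y = 0 by rewrite Ey Hy0 cs_scal0r.
    apply cs_neg_square0 => //; rewrite Eyy; apply cs_posZ; last exact: cs_pos_sq.
    apply Rlt_le, Rinv_0_lt_compat; nra.
  have Hrm : r * m = 0.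
    apply cs_sa_sq0 => //; rewrite -/k.
    have -> : k = - ((q * m)^* * (q * m)) by rewrite Hym; nc.
    rewrite Hqm; nc.
  have Ham : a * m = 0 by rewrite -Hrr -cs_mulA Hrm cs_mul0r.
  have Hm0 : m = 0.
    apply cs_sa_sq0 => //; rewrite {1}/m cs_mulDl Ham.
    have -> : - h * m = - (h * m) by nc.
    rewrite Hhm Ham; nc.
  suff Eh : h = a by rewrite Eh.
  transitivity (a - m); first by rewrite /m; nc.
  rewrite Hm0; nc.
Qed.

End Positive.

(** * Homomorphisms *)

Section Hom.
Local Open Scope cs_scope.
Context {A B : CStar} (f : A -> B) (Hf : is_ustarhom A B f).

Lemma homD x y : f (x + y) = f x + f y. Proof. by case: Hf => [H _]; apply H. Qed.
Lemma homZ a x : f (a ** x) = a ** f x. Proof. by case: Hf => [_ [H _]]; apply H. Qed.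
Lemma homM x y : f (x * y) = f x * f y. Proof. by case: Hf => [_ [_ [H _]]]; apply H. Qed.
Lemma hom_star x : f (x^*) = (f x)^*. Proof. by case: Hf => [_ [_ [_ [H _]]]]; apply H. Qed.
Lemma hom1 : f 1 = 1. Proof. by case: Hf => [_ [_ [_ [_ H]]]]. Qed.
Lemma homN x : f (- x) = - f x. Proof. by rewrite !cs_oppE homZ. Qed.
Lemma homB x y : f (x - y) = f x - f y. Proof. by rewrite homD homN. Qed.
Lemma hom0 : f 0 = 0. Proof. by rewrite -(cs_scal0l 0) homZ cs_scal0l. Qed.
Lemma hom_const t : f (cs_const t) = cs_const t. Proof. by rewrite /cs_const homZ hom1. Qed.

(** For self-adjoint [h], write $\|h\|^2-h^2=r^2$ with [r] commuting with [h]. The images satisfy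
    the same identity, and [cs_sum_sq_norm] bounds $f(h)$; the C*-identity gives the general
    case. *)
Lemma hom_contractive x : (cs_norm (f x) <= cs_norm x)%R.
Proof.
  have Hsa h : h^* = h -> (cs_norm (f h) <= cs_norm h)%R.
    move=> Hh; have [r [[Hr _] [Hrr Hrc]]] :=
      cs_pos_sqrt _ (cs_pos_norm (h * h) (cs_norm h * cs_norm h)
        ltac:(by rewrite cs_starM Hh) ltac:(rewrite cs_norm_sa //; lra)).
    apply le_of_sq_le; first exact: cs_norm_ge0.
    apply (cs_sum_sq_norm (f h) (f r)); try by rewrite -hom_star ?Hh ?Hr.
    - by have := cs_norm_ge0 h; nra.
    - rewrite -!homM; congr f; apply Hrc; rewrite /cs_const; nc.
    - rewrite -!homM -homD Hrr -hom_const; congr f; nc.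
  apply le_of_sq_le; first exact: cs_norm_ge0.
  rewrite -!cs_Cstar -hom_star -homM; apply Hsa; by rewrite cs_starM cs_starK.
Qed.

Lemma hom_pos h : cs_pos h -> cs_pos (f h).
Proof.
  move=> [Hh [t [Ht H]]]; split; first by rewrite -hom_star Hh.
  exists t; split => //; rewrite -hom_const -homB.
  by apply: Rle_trans H; exact: hom_contractive.
Qed.

(** With $h=x^*x$ and $t=\|f(h)\|$, the element $f(t-h)$ is positive, so it equals $f(|t-h|)$ by
    uniqueness of positive square roots. Injectivity gives $t-h=|t-h|\ge 0$, hence $\|h\|\le t$. *)
Lemma hom_isometric : (forall x y, f x = f y -> x = y) ->
  forall x, cs_norm (f x) = cs_norm x.
Proof.
  move=> Hinj x; apply Rle_antisym; first exact: hom_contractive.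
  apply le_of_sq_le; first exact: cs_norm_ge0.
  rewrite -!cs_Cstar -hom_star -homM.
  set h := x^* * x; set t := cs_norm (f h).
  have Hp : cs_pos h by exact: cs_pos_star_mul.
  have Ht : (0 <= t)%R by exact: cs_norm_ge0.
  have [Hh _] := Hp.
  have Hsa : (cs_const t - h)^* = cs_const t - h.
    by rewrite cs_starD cs_starN cs_star_const Hh.
  have [m [Hm [Hmm Hmc]]] := cs_abs _ Hsa.
  have E : m = cs_const t - h.
    apply Hinj; apply cs_pos_sqrt_unique.
    - exact: hom_pos.
    - rewrite homB hom_const; apply cs_pos_norm; first by rewrite -hom_star Hh.
      rewrite -/t; lra.
    - by rewrite -!homM Hmc.
    - by rewrite -!homM Hmm.
  by apply cs_pos_le => //; rewrite -E.
Qed.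

End Hom.
(** * The Hahn-Banach theorem and states *)

(** The value is 0 by convention when the greatest lower bound is infinite; the lemmas below require
    a member and a lower bound. *)
Definition Inf (E : R -> Prop) : R := real (Glb_Rbar E).

Lemma Inf_glb E b x : (forall y, E y -> b <= y) -> E x ->
  (forall y, E y -> Inf E <= y) /\ (forall c, (forall y, E y -> c <= y) -> c <= Inf E).
Proof.
  move=> Hb Hx; have [H1 H2] := Glb_Rbar_correct E; rewrite /Inf.
  have Hlb : Rbar_le b (Glb_Rbar E) by apply H2 => y Hy; apply Hb.
  case E1: (Glb_Rbar E) H1 H2 Hlb => [g| |] H1 H2 Hlb //=.
  - by split => [y Hy|c Hc]; [apply (H1 y Hy)|apply (H2 c) => y Hy; apply Hc].
  - by have := H1 x Hx.
Qed.
Lemma Inf_le E b x : (forall y, E y -> b <= y) -> E x -> Inf E <= x.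
Proof. by move=> Hb Hx; have [H _] := Inf_glb E b x Hb Hx; apply H. Qed.
Lemma Inf_ge E b x : E x -> (forall y, E y -> b <= y) -> b <= Inf E.
Proof. by move=> Hx Hb; have [_ H] := Inf_glb E b x Hb Hx; apply H. Qed.

Section HahnBanach.
Context {V : Type} (add : V -> V -> V) (zero : V) (scal : R -> V -> V).
Hypothesis addA : forall x y z, add x (add y z) = add (add x y) z.
Hypothesis addC : forall x y, add x y = add y x.
Hypothesis add0 : forall x, add zero x = x.
Hypothesis scalDr : forall a x y, scal a (add x y) = add (scal a x) (scal a y).
Hypothesis scalDl : forall a b x, scal (a + b) x = add (scal a x) (scal b x).
Hypothesis scalM : forall a b x, scal (a * b) x = scal a (scal b x).
Hypothesis scal1 : forall x, scal 1 x = x.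
Hypothesis scal0 : forall x, scal 0 x = zero.

Definition sublinear (q : V -> R) : Prop :=
  (forall x y, q (add x y) <= q x + q y) /\
  (forall t x, 0 < t -> q (scal t x) <= t * q x).

Lemma sublinear0 q : sublinear q -> q zero = 0.
Proof.
  move=> [H1 H2]; have H := H1 zero zero; rewrite add0 in H.
  have H3 := H2 (1/2) zero ltac:(lra).
  rewrite -(scal0 zero) -scalM Rmult_0_r scal0 in H3; lra.
Qed.
Lemma add_scalN x : add x (scal (-1) x) = zero.
Proof. by rewrite -{1}(scal1 x) -scalDl Rplus_opp_r scal0. Qed.
Lemma sublinearN q x : sublinear q -> - q (scal (-1) x) <= q x.
Proof.
  move=> Hq; have := proj1 Hq x (scal (-1) x).
  rewrite add_scalN sublinear0 //; lra.
Qed.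
Lemma sublinear_pos q t x : sublinear q -> 0 <= t -> q (scal t x) = t * q x.
Proof.
  move=> Hq [Ht|<-]; last by rewrite scal0 sublinear0 //; ring.
  apply Rle_antisym; first by apply Hq.
  have := proj2 Hq (/ t) (scal t x) ltac:(by apply Rinv_0_lt_compat).
  rewrite -scalM Rinv_l ?scal1; last lra.
  move=> H; have := Rmult_le_compat_l t _ _ ltac:(lra) H.
  by rewrite -Rmult_assoc Rinv_r ?Rmult_1_l //; lra.
Qed.

(** Serves four infima: the lowering [directed], lower bounds of chains in Zorn's lemma, [re_max],
    and the distance to a convex cone. *)
Lemma Inf_sublinear (E : V -> R -> Prop) :
  (forall x, exists b r, E x r /\ forall t, E x t -> b <= t) ->
  (forall x y t u, E x t -> E y u -> exists v, E (add x y) v /\ v <= t + u) ->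
  (forall a x t, 0 < a -> E x t -> exists v, E (scal a x) v /\ v <= a * t) ->
  sublinear (fun x => Inf (E x)).
Proof.
  move=> HE HD HZ.
  have le x t : E x t -> Inf (E x) <= t.
    by move=> H; have [b [r [_ Hb]]] := HE x; apply: Inf_le Hb H.
  have ge x c : (forall t, E x t -> c <= t) -> c <= Inf (E x).
    by move=> H; have [b [r [Hr _]]] := HE x; apply: Inf_ge Hr H.
  split=> [x y|a x Ha].
    suff : Inf (E (add x y)) - Inf (E x) <= Inf (E y) by lra.
    apply ge => u Hu; suff : Inf (E (add x y)) - u <= Inf (E x) by lra.
    by apply ge => t Ht; have [v [Hv Hle]] := HD x y t u Ht Hu; have := le _ _ Hv; lra.
  suff H : / a * Inf (E (scal a x)) <= Inf (E x).
    have := Rmult_le_compat_l a _ _ ltac:(lra) H.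
    by rewrite -Rmult_assoc Rinv_r ?Rmult_1_l //; lra.
  apply ge => t Ht; have [v [Hv Hle]] := HZ a x t Ha Ht; have := le _ _ Hv => H.
  have := Rmult_le_compat_l (/ a) _ _ ltac:(by apply Rlt_le, Rinv_0_lt_compat)
    (Rle_trans _ _ _ H Hle).
  by rewrite -Rmult_assoc Rinv_l ?Rmult_1_l //; lra.
Qed.

(** The largest sublinear functional below [q] whose value at $-e$ is at most $-q(e)$; it makes [q]
    odd in the direction of [e]. *)
Definition directed (q : V -> R) (e x : V) : R :=
  Inf (fun r => exists s, 0 <= s /\ r = q (add x (scal s e)) - s * q e).

Lemma directed_lb q e x : sublinear q -> forall r,
  (exists s, 0 <= s /\ r = q (add x (scal s e)) - s * q e) -> - q (scal (-1) x) <= r.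
Proof.
  move=> Hq r [s [Hs ->]]; rewrite -(sublinear_pos q s) //.
  have := proj1 Hq (add x (scal s e)) (scal (-1) x).
  have -> : add (add x (scal s e)) (scal (-1) x) = scal s e; last lra.
  by rewrite -addA (addC (scal s e)) addA add_scalN add0.
Qed.
Lemma directed_le q e x s : sublinear q -> 0 <= s ->
  directed q e x <= q (add x (scal s e)) - s * q e.
Proof.
  by move=> Hq Hs; apply: Inf_le; [exact: directed_lb|exists s].
Qed.
Lemma directed_sublinear q e : sublinear q -> sublinear (directed q e) /\
  (forall x, directed q e x <= q x) /\ directed q e (scal (-1) e) <= - q e.
Proof.
  move=> Hq; split; [|split].
  - apply Inf_sublinear => [x|x y _ _ [s [Hs ->]] [t [Ht ->]]|a x _ Ha [s [Hs ->]]].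
    + exists (- q (scal (-1) x)), (q (add x (scal 0 e)) - 0 * q e).
      by split; [exists 0; split; [lra|]|exact: directed_lb].
    + eexists; split; first by exists (s + t); split; [lra|].
      have := proj1 Hq (add x (scal s e)) (add y (scal t e)).
      have -> : add (add x (scal s e)) (add y (scal t e)) = add (add x y) (scal (s + t) e).
        by rewrite scalDl -!addA; f_equal; rewrite !addA; f_equal; rewrite addC.
      lra.
    + eexists; split; first by exists (a * s); split; [nra|].
      by rewrite scalM -scalDr sublinear_pos //; lra.
  - move=> x; have := directed_le q e x 0 Hq (Rle_refl _).
    by rewrite scal0 addC add0; lra.
  - have := directed_le q e (scal (-1) e) 1 Hq ltac:(lra).
    by rewrite -scalDl Rplus_opp_l scal0 sublinear0 //; lra.
Qed.

(** Zorn's lemma with the pointwise order reversed. A nonempty chain is bounded by its pointwise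
    infimum, which stays finite because every sublinear $q\le p$ satisfies $q(x)\ge -p(-x)$. *)
Lemma sublinear_minimal p : sublinear p -> exists q, sublinear q /\
  (forall x, q x <= p x) /\
  forall q', sublinear q' -> (forall x, q' x <= q x) -> forall x, q x <= q' x.
Proof.
  move=> Hp; pose T := {q : V -> R | sublinear q /\ forall x, q x <= p x}.
  pose Rb (s t : T) := boolp.asbool (forall x, proj1_sig t x <= proj1_sig s x).
  have RbE s t : is_true (Rb s t) <-> forall x, proj1_sig t x <= proj1_sig s x.
    by rewrite /Rb boolp.asboolE.
  have lbT (s : T) x : - p (scal (-1) x) <= proj1_sig s x.
    case: s => q [Hq Hqp] /=; have := sublinearN q x Hq; have := Hqp (scal (-1) x); lra.
  pose t0 : T := exist _ p (conj Hp (fun x => Rle_refl _)).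
  have [| | |[q [Hq Hqp]] Hmax] := @classical_sets.ZL_preorder T t0 Rb.
  - by move=> t; apply RbE => x; lra.
  - move=> r s t /RbE H1 /RbE H2; apply RbE => x.
    by have := H1 x; have := H2 x; lra.
  - move=> F tot; case: (classic (exists s, F s)) => [[s0 Fs0]|HF]; last first.
      by exists t0 => s Fs; case: HF; exists s.
    pose q x := Inf (fun r => exists s, F s /\ r = proj1_sig s x).
    have qlb x r : (exists s, F s /\ r = proj1_sig s x) -> - p (scal (-1) x) <= r.
      by move=> [s [_ ->]].
    have qle s x : F s -> q x <= proj1_sig s x.
      by move=> Fs; apply: Inf_le (qlb x) _; exists s.
    have Hq : sublinear q.
      apply Inf_sublinear => [x|x y _ _ [s [Fs ->]] [t [Ft ->]]|a x _ Ha [s [Fs ->]]].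
      + by exists (- p (scal (-1) x)), (proj1_sig s0 x); split; [exists s0|exact: qlb].
      + case: (tot s t Fs Ft) => /RbE Hst.
          exists (proj1_sig t (add x y)); split; first by exists t.
          by have := proj1 (proj1 (proj2_sig t)) x y; have := Hst x; lra.
        exists (proj1_sig s (add x y)); split; first by exists s.
        by have := proj1 (proj1 (proj2_sig s)) x y; have := Hst y; lra.
      + exists (proj1_sig s (scal a x)); split; first by exists s.
        by apply (proj1 (proj2_sig s)).
    have Hqp x : q x <= p x.
      by apply: Rle_trans (qle s0 x Fs0) _; apply (proj2 (proj2_sig s0)).
    exists (exist _ q (conj Hq Hqp)) => s Fs.
    by apply RbE => x /=; apply qle.
  exists q; split => //; split => // q' Hq' Hle x.
  have Hq'p y : q' y <= p y by apply: Rle_trans (Hle y) _.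
  have H := Hmax (exist _ q' (conj Hq' Hq'p)).
  have /RbE H1 := H ltac:(by apply RbE); exact: H1.
Qed.

(** A minimal sublinear [f] is not lowered by [directed f x], so $f(-x)\le -f(x)$ for all [x], and
    an odd sublinear functional is linear. Minimising below [directed p x0] instead of [p] forces
    the value at [x0]. *)
Theorem hahn_banach p x0 : sublinear p -> exists f : V -> R,
  (forall x y, f (add x y) = f x + f y) /\ (forall t x, f (scal t x) = t * f x) /\
  (forall x, f x <= p x) /\ f x0 = p x0.
Proof.
  move=> Hp; have [Hd [Hdp Hd0]] := directed_sublinear p x0 Hp.
  have [f [Hf [Hfd Hmin]]] := sublinear_minimal _ Hd.
  have HN x : f (scal (-1) x) = - f x.
    have [He [Hef He0]] := directed_sublinear f x Hf.
    have := Hmin _ He Hef (scal (-1) x); have := sublinearN f x Hf; lra.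
  have Hfp x : f x <= p x by apply: Rle_trans (Hdp x).
  exists f; split; last split; last split => //.
  - move=> x y; apply Rle_antisym; first by apply Hf.
    have := proj1 Hf (scal (-1) x) (scal (-1) y); rewrite -scalDr !HN; lra.
  - move=> t x; case: (Rle_lt_dec 0 t) => Ht; first exact: sublinear_pos.
    have -> : t = (- t) * (-1) by ring.
    rewrite scalM sublinear_pos //; last lra.
    rewrite HN; ring.
  - apply Rle_antisym => //; have := Hfd (scal (-1) x0); rewrite HN; lra.
Qed.

End HahnBanach.

(** This is the real part of a state, the form in which the real Hahn-Banach theorem delivers it;
    [st_c] recovers the complex state as $f(d)-if(id)$. *)
Record state (D : CStar) := {
  st :> D -> R;
  st_add : forall x y, st (cs_add x y) = st x + st y;
  st_scal : forall t x, st (cs_scal (RtoC t) x) = t * st x;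
  st_star : forall x, st (cs_star x) = st x;
  st_pos : forall x, 0 <= st (cs_mul (cs_star x) x);
  st_one : st cs_one = 1;
  st_norm : forall x, st x <= cs_norm x
}.

Section State.
Local Open Scope cs_scope.
Context {D : CStar}.
Hypothesis nontrivial : (1 : D) <> 0.
Implicit Types x y h : D.

Definition re_part x : D := RtoC (1/2) ** (x + x^*).

Lemma cs_pos_const_ge0 t : cs_pos (@cs_const D t) -> (0 <= t)%R.
Proof.
  move=> H; apply Rnot_lt_le => Ht; apply nontrivial.
  have H' : cs_pos (- @cs_const D t).
    have -> : - cs_const t = @cs_const D (- t) by rewrite /cs_const; nc.
    apply cs_pos_const; lra.
  have E := cs_pos_antisym _ H H'.
  have -> : (1 : D) = RtoC (/ t) ** cs_const t by rewrite /cs_const; nc.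
  by rewrite E cs_scal0r.
Qed.

(** The maximum of the spectrum of the real part of [x]. A linear functional dominated by it is
    automatically positive, unital and invariant under the adjoint, which domination by the norm
    would not give at once. *)
Definition re_max x : R := Inf (fun t => cs_pos (cs_const t - re_part x)).

Lemma re_part_sa x : (re_part x)^* = re_part x.
Proof. by rewrite /re_part cs_starZR cs_starD cs_starK cs_addC. Qed.
Lemma re_part_norm x : (cs_norm (re_part x) <= cs_norm x)%R.
Proof.
  rewrite /re_part cs_normZR Rabs_pos_eq; last lra.
  by have := cs_normD _ x (x^*); rewrite cs_norm_star; lra.
Qed.
Lemma re_max_norm x : cs_pos (cs_const (cs_norm x) - re_part x).
Proof. by apply cs_pos_norm; [exact: re_part_sa|exact: re_part_norm]. Qed.
Lemma re_max_lb x t : cs_pos (cs_const t - re_part x) -> (- cs_norm x <= t)%R.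
Proof.
  move=> H; suff : (0 <= t + cs_norm x)%R by lra.
  apply cs_pos_const_ge0.
  have -> : @cs_const D (t + cs_norm x)
    = (cs_const t - re_part x) + (cs_const (cs_norm (- x)) - re_part (- x)).
    by rewrite cs_normN /re_part cs_starN /cs_const; nc.
  apply cs_posD => //; exact: re_max_norm.
Qed.
Lemma re_max_le x t : cs_pos (cs_const t - re_part x) -> (re_max x <= t)%R.
Proof. by move=> H; apply: Inf_le H; exact: re_max_lb. Qed.
Lemma re_max_ge x b : (forall t, cs_pos (cs_const t - re_part x) -> b <= t)%R ->
  (b <= re_max x)%R.
Proof. by move=> H; apply: Inf_ge H; exact: re_max_norm. Qed.

Lemma re_max_sublinear : sublinear cs_add (fun t x => RtoC t ** x) re_max.
Proof.
  apply Inf_sublinear => [x|x y t u Ht Hu|a x t Ha Ht].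
  - by exists (- cs_norm x)%R, (cs_norm x); split; [exact: re_max_norm|exact: re_max_lb].
  - exists (t + u)%R; split; last lra.
    have -> : cs_const (t + u) - re_part (x + y)
      = (cs_const t - re_part x) + (cs_const u - re_part y).
      by rewrite /re_part cs_starD /cs_const; nc.
    exact: cs_posD.
  - exists (a * t)%R; split; last lra.
    have -> : cs_const (a * t) - re_part (RtoC a ** x) = RtoC a ** (cs_const t - re_part x).
      by rewrite /re_part cs_starZR /cs_const; nc.
    apply cs_posZ => //; lra.
Qed.

(** On the positive element [h] the functional [re_max] equals the norm, so Hahn-Banach with
    prescribed value at [h] suffices. Invariance under the adjoint holds because $x^*-x$ has real
    part zero. *)
Lemma exists_norming_state q : exists f : state D, f (q^* * q) = cs_norm (q^* * q).
Proof.
  set h := q^* * q.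
  have [f [fD [fZ [fle f0]]]] : exists f : D -> R,
      (forall x y, f (x + y) = (f x + f y)%R) /\
      (forall t x, f (RtoC t ** x) = (t * f x)%R) /\
      (forall x, (f x <= re_max x)%R) /\ f h = re_max h.
    apply (hahn_banach cs_add 0 (fun t x => RtoC t ** x)).
    - exact: cs_addA.
    - exact: cs_addC.
    - exact: cs_add0.
    - by move=> a x y; exact: cs_scalDr.
    - by move=> a b x; nc.
    - by move=> a b x; nc.
    - by move=> x; exact: cs_scal1.
    - by move=> x; exact: cs_scal0l.
    - exact: re_max_sublinear.
  have fN x : f (- x) = (- f x)%R by rewrite cs_oppE fZ; ring.
  have fpos x : cs_pos x -> (0 <= f x)%R.
    move=> Hx; have [Hs _] := Hx.
    suff : (f (- x)%cs <= 0)%R by rewrite fN; lra.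
    apply: Rle_trans (fle _) _; apply re_max_le.
    have -> : cs_const 0 - re_part (- x) = x; last by [].
    by rewrite /re_part cs_starN Hs /cs_const; nc.
  have f1 t : (t * f 1%cs <= t)%R.
    rewrite -fZ; apply: Rle_trans (fle _) _; apply re_max_le.
    have -> : cs_const t - re_part (RtoC t ** 1) = 0; last exact: cs_pos0.
    by rewrite /re_part cs_starZR cs_star1 /cs_const; nc.
  have fstar_le x : (f (x^* - x)%cs <= 0)%R.
    apply: Rle_trans (fle _) _; apply re_max_le.
    have -> : cs_const 0 - re_part (x^* - x) = 0; last exact: cs_pos0.
    by rewrite /re_part cs_starD cs_starN cs_starK /cs_const; nc.
  unshelve eexists.
  { apply (Build_state D f) => //.
    - move=> x; have := fstar_le x; have := fstar_le (x^*).
      by rewrite cs_starK !fD !fN; lra.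
    - by move=> x; apply fpos, cs_pos_star_mul.
    - by have := f1 1%R; have := f1 (-1)%R; lra.
    - by move=> x; apply: Rle_trans (fle x) _; apply re_max_le, re_max_norm. }
  rewrite /= f0; have Hh : cs_pos h by exact: cs_pos_star_mul.
  have [Hs _] := Hh.
  have Hr : re_part h = h by rewrite /re_part Hs; nc.
  apply Rle_antisym; first by apply re_max_le, re_max_norm.
  apply re_max_ge => t; rewrite Hr => Ht; apply cs_pos_le => //.
  apply cs_pos_const_ge0; have -> : @cs_const D t = (cs_const t - h) + h by nc.
  exact: cs_posD.
Qed.

End State.
(** * Semi-inner products *)

Lemma csum_ext n f g : (forall i, (i < n)%nat -> f i = g i) -> csum n f = csum n g.
Proof.
  elim: n => [|n IH] H //=; rewrite IH; last by move=> i Hi; apply H; lia.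
  by rewrite H.
Qed.
Lemma csum_add n f g : csum n (fun i => Cplus (f i) (g i)) = Cplus (csum n f) (csum n g).
Proof. elim: n => [|n IH] /=; [C_solve|rewrite IH; C_solve]. Qed.
Lemma csum_scal n a f : csum n (fun i => Cmult a (f i)) = Cmult a (csum n f).
Proof. elim: n => [|n IH] /=; [C_solve|rewrite IH; C_solve]. Qed.
Lemma csum_conj n f : csum n (fun i => Cconj (f i)) = Cconj (csum n f).
Proof. elim: n => [|n IH] /=; [C_solve|rewrite IH; C_solve]. Qed.
Lemma csum_re n f : Re (csum n f) = rsum n (fun i => Re (f i)).
Proof. by elim: n => [|n IH] //=; rewrite -IH. Qed.
Lemma csum0 n : csum n (fun _ => RtoC 0) = RtoC 0.
Proof. elim: n => [|n IH] //=; rewrite IH; C_solve. Qed.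
Lemma csum_eq0 n f : (forall i, (i < n)%nat -> f i = RtoC 0) -> csum n f = RtoC 0.
Proof. by move=> /csum_ext ->; exact: csum0. Qed.
Lemma csum_swap n m f :
  csum n (fun i => csum m (fun j => f i j)) = csum m (fun j => csum n (fun i => f i j)).
Proof.
  elim: n => [|n IH] /=; first by rewrite csum0.
  by rewrite IH -csum_add.
Qed.
Lemma rsum_ext n f g : (forall i, (i < n)%nat -> f i = g i) -> rsum n f = rsum n g.
Proof.
  elim: n => [|n IH] H //=; rewrite IH; last by move=> i Hi; apply H; lia.
  by rewrite H.
Qed.
Lemma rsum_le n f g : (forall i, (i < n)%nat -> f i <= g i) -> rsum n f <= rsum n g.
Proof.
  elim: n => [|n IH] H /=; first lra.
  have := IH ltac:(by move=> i Hi; apply H; lia); have := H n ltac:(lia); lra.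
Qed.
Lemma rsum_ge0 n f : (forall i, (i < n)%nat -> 0 <= f i) -> 0 <= rsum n f.
Proof.
  elim: n => [|n IH] H /=; first lra.
  have := IH ltac:(by move=> i Hi; apply H; lia); have := H n ltac:(lia); lra.
Qed.
Lemma rsum_add n f g : rsum n (fun i => f i + g i) = rsum n f + rsum n g.
Proof. elim: n => [|n IH] /=; [ring|rewrite IH; ring]. Qed.
Lemma rsum_scal n a f : rsum n (fun i => a * f i) = a * rsum n f.
Proof. elim: n => [|n IH] /=; [ring|rewrite IH; ring]. Qed.
Lemma rsum_const n a : rsum n (fun _ => a) = INR n * a.
Proof. elim: n => [|n IH]; [rewrite /=; ring|rewrite S_INR /= IH; ring]. Qed.
Lemma rsum_term n f i : (forall i, (i < n)%nat -> 0 <= f i) -> (i < n)%nat -> f i <= rsum n f.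
Proof.
  elim: n => [|n IH] H Hi /=; first lia.
  have H0 := H n ltac:(lia).
  have H' j : (j < n)%nat -> 0 <= f j by move=> Hj; apply H; lia.
  have Hs := rsum_ge0 n f H'.
  case: (Nat.eq_dec i n) => [->|Hne]; first lra.
  by have := IH H' ltac:(lia); lra.
Qed.

(** The form may be degenerate: vectors of $\mathbb C^n$ are functions on all of [nat] of which [n]
    entries count, and GNS vectors are not taken modulo null vectors. It is linear in the first
    argument. *)
Record prehilb := {
  pt :> Type;
  padd : pt -> pt -> pt;
  pscal : C -> pt -> pt;
  pip : pt -> pt -> C;
  pipD : forall x y z, pip (padd x y) z = Cplus (pip x z) (pip y z);
  pipZ : forall a x z, pip (pscal a x) z = Cmult a (pip x z);
  pip_conj : forall x y, pip y x = Cconj (pip x y);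
  pip_pos : forall x, 0 <= Re (pip x x)
}.
Arguments padd {p}. Arguments pscal {p}. Arguments pip {p}.

Section PreHilbert.
Context {H : prehilb}.
Implicit Types x y z : H.

Definition psq x : R := Re (pip x x).
Definition pnorm x : R := sqrt (psq x).

Lemma pipDr x y z : pip z (padd x y) = Cplus (pip z x) (pip z y).
Proof. rewrite pip_conj pipD (pip_conj _ z x) (pip_conj _ z y); C_solve. Qed.
Lemma pipZr a x z : pip z (pscal a x) = Cmult (Cconj a) (pip z x).
Proof. rewrite pip_conj pipZ (pip_conj _ z x); C_solve. Qed.
Lemma pip_diag x : pip x x = RtoC (psq x).
Proof.
  have := pip_conj _ x x; rewrite /psq; case: (pip x x) => a b [Hb].
  apply injective_projections => //=; lra.
Qed.

Lemma psq_comb s t x y : psq (padd (pscal s x) (pscal t y)) =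
  Cmod s ^ 2 * psq x + 2 * Re (Cmult (Cmult s (Cconj t)) (pip x y)) + Cmod t ^ 2 * psq y.
Proof.
  rewrite {1}/psq pipD !pipDr !pipZ !pipZr (pip_conj _ x y) !pip_diag.
  rewrite /Cmod !pow2_sqrt; try nra.
  by move: (pip x y) => [u v]; case: s => s1 s2; case: t => t1 t2; rewrite /=; ring.
Qed.

Lemma cauchy_schwarz x y : Cmod (pip x y) ^ 2 <= psq x * psq y.
Proof.
  set a := pip x y; have HX : 0 <= psq x := pip_pos _ x; have HY : 0 <= psq y := pip_pos _ y.
  have key (s k : R) : 0 <= s ^ 2 * psq x - 2 * s * k * Cmod a ^ 2
      + k ^ 2 * Cmod a ^ 2 * psq y.
    have := pip_pos _ (padd (pscal (RtoC s) x) (pscal (Cmult (RtoC (- k)) a) y)).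
    rewrite -/(psq _) psq_comb -/a Cmod_mult !Cmod_R Rpow_mult_distr !pow2_abs.
    have -> : Re (Cmult (Cmult (RtoC s) (Cconj (Cmult (RtoC (- k)) a))) a)
       = - s * k * Cmod a ^ 2.
      by rewrite /Cmod pow2_sqrt; [case: a => u v; rewrite /=; ring|nra].
    lra.
  have Hm : 0 <= Cmod a ^ 2 by nra.
  move: key Hm; move: (Cmod a ^ 2) => m key Hm.
  case: HY => [HY|HY].
    have := key (psq y) 1 => K.
    have : 0 <= psq y * (psq x * psq y - m) by nra.
    move=> K2; apply Rnot_lt_le => Hlt; nra.
  rewrite -HY Rmult_0_r; apply Rnot_lt_le => Hlt.
  (* For a null vector [y] the quadratic expression is affine in [k]; this [k] makes it equal to
     $-1$. *)
  have := key 1 ((psq x + 1) / (2 * m)); rewrite -HY.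
  have -> : 1 ^ 2 * psq x - 2 * 1 * ((psq x + 1) / (2 * m)) * m +
     ((psq x + 1) / (2 * m)) ^ 2 * m * 0 = -1 by field; lra.
  lra.
Qed.

Lemma pnorm_ge0 x : 0 <= pnorm x.
Proof. exact: sqrt_pos. Qed.
Lemma pnorm_sq x : pnorm x ^ 2 = psq x.
Proof. rewrite pow2_sqrt //; exact: pip_pos. Qed.
Lemma pip_re_le x y : Re (pip x y) <= pnorm x * pnorm y.
Proof.
  apply Rle_trans with (Cmod (pip x y)).
    by apply: Rle_trans (Rle_abs _) _; exact: re_le_Cmod.
  apply le_of_sq_le.
    by apply Rmult_le_pos; exact: pnorm_ge0.
  have := cauchy_schwarz x y; rewrite -!pnorm_sq; nra.
Qed.
Lemma pnorm_add x y : pnorm (padd x y) <= pnorm x + pnorm y.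
Proof.
  apply le_of_sq_le; first by have := pnorm_ge0 x; have := pnorm_ge0 y; lra.
  have := pnorm_sq (padd x y); rewrite {1}/psq pipD !pipDr (pip_conj _ x y) !pip_diag -!pnorm_sq.
  have := pip_re_le x y; move: (pip x y) => [u v]; rewrite /=; nra.
Qed.
Lemma psq_scal a x : psq (pscal a x) = Cmod a ^ 2 * psq x.
Proof.
  rewrite {1}/psq pipZ pipZr pip_diag /Cmod pow2_sqrt; last nra.
  by case: a => a1 a2; rewrite /=; ring.
Qed.
Lemma pnorm_scal a x : pnorm (pscal a x) = Cmod a * pnorm x.
Proof.
  rewrite /pnorm psq_scal sqrt_mult; try exact: pip_pos; last nra.
  by rewrite sqrt_pow2 //; exact: Cmod_ge_0.
Qed.

End PreHilbert.

(** * Symmetric operators: contractions and growth of moments *)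

Section Symmetric.
Context {H : prehilb} (S : H -> H).
Hypothesis S_sym : forall x y, pip (S x) y = pip x (S y).

Section Contraction.
Hypothesis S_pos : forall x, 0 <= Re (pip (S x) x).

Definition twisted : prehilb.
Proof.
  refine {| pt := pt H; padd := padd; pscal := pscal; pip := fun x y => pip (S x) y |}.
  - by move=> x y z; rewrite S_sym pipD -!S_sym.
  - by move=> a x z; rewrite S_sym pipZ -!S_sym.
  - by move=> x y; rewrite S_sym; exact: pip_conj.
  - exact: S_pos.
Defined.

(** Cauchy-Schwarz for the form $\langle Sx,y\rangle$ at [x] and $Sx$ gives $\|Sx\|^4\le\langle
    Sx,x\rangle\langle S^2x,Sx\rangle\le\|x\|^2\|Sx\|^2$. *)
Lemma positive_contraction : (forall x, Re (pip (S x) x) <= psq x) ->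
  forall x, psq (S x) <= psq x.
Proof.
  move=> Hle x.
  have CS := @cauchy_schwarz twisted x (S x).
  rewrite /psq /= (pip_diag (S x)) Cmod_R -/(psq (S x)) in CS.
  have H0 := Hle x; have H1 := Hle (S x).
  have H2 := S_pos x; have H3 := S_pos (S x); have H4 : 0 <= psq (S x) := pip_pos _ _.
  rewrite Rabs_pos_eq // Rmult_1_r in CS.
  have H5 : 0 <= psq x := pip_pos _ x.
  apply Rnot_lt_le => Hlt.
  have : Re (pip (S x) x) * Re (pip (S (S x)) (S x)) <= psq x * psq (S x).
    by apply Rmult_le_compat.
  nra.
Qed.
End Contraction.

Lemma iter_sym n x y : pip (Nat.iter n S x) y = pip x (Nat.iter n S y).
Proof.
  elim: n y => [|n IH] y //=.
  by rewrite S_sym IH -Nat.iter_succ_r.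
Qed.

(** Put $a_j=\langle S^{2^j}x,x\rangle$. Cauchy-Schwarz gives $a_j^2\le\|x\|^2a_{j+1}$, so
    $a_j/\|x\|^2$ is at least squared at each step, starting from some $1+d>1$. The linear lower
    bound $1+(j+1)d$ is enough and survives the squaring. *)
Lemma moments_unbounded x B : psq x < Re (pip (S x) x) ->
  exists n, B < Re (pip (Nat.iter n S x) x).
Proof.
  move=> Hx; have H0 : 0 <= psq x := pip_pos _ x.
  pose a j := Re (pip (Nat.iter (2 ^ j) S x) x).
  have step j : a j * a j <= psq x * a (Datatypes.S j).
    have E : psq (Nat.iter (2 ^ j) S x) = a (Datatypes.S j).
      rewrite /psq -iter_sym -Nat.iter_add /a; congr (Re (pip (Nat.iter _ S x) x)).
      by rewrite /=; lia.
    have := cauchy_schwarz (Nat.iter (2 ^ j) S x) x; rewrite E.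
    have : Rabs (a j) <= Cmod (pip (Nat.iter (2 ^ j) S x) x) := re_le_Cmod _.
    have := Rabs_pos (a j); have := Rsqr_abs (a j); rewrite /Rsqr; nra.
  have N0 : 0 < psq x.
    case: H0 => // N0; have := cauchy_schwarz (S x) x; rewrite -N0 Rmult_0_r.
    have : Rabs (Re (pip (S x) x)) <= Cmod (pip (S x) x) := re_le_Cmod _.
    rewrite Rabs_pos_eq; last lra.
    have := Cmod_ge_0 (pip (S x) x); nra.
  set d := (Re (pip (S x) x) - psq x) / psq x.
  have Hd : 0 < d by apply Rdiv_lt_0_compat; lra.
  have Hd1 : Re (pip (S x) x) = psq x * (1 + d) by rewrite /d; field; lra.
  have grow j : psq x * (1 + INR (Datatypes.S j) * d) <= a j.
    elim: j => [|j IH]; first by rewrite /a /= Hd1; lra.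
    have := step j; have Hj := pos_INR j; rewrite !S_INR in IH *.
    move=> K; set c := 1 + (INR j + 1) * d in IH.
    have Hc : 1 + (INR j + 1 + 1) * d <= c * c by rewrite /c; nra.
    have Hc1 : 1 <= c by rewrite /c; nra.
    have : psq x * (psq x * (c * c)) <= psq x * a (Datatypes.S j).
      apply: Rle_trans K.
      have -> : psq x * (psq x * (c * c)) = (psq x * c) * (psq x * c) by ring.
      by apply Rmult_le_compat; nra.
    move=> K2; have := Rmult_le_reg_l _ _ _ N0 K2; nra.
  have [j Hj] := INR_unbounded (B / (psq x * d)).
  exists (2 ^ j)%nat; rewrite -/(a j); apply: Rlt_le_trans (grow j).
  have Hpd : 0 < psq x * d by nra.
  have := Rmult_lt_compat_r _ _ _ Hpd Hj.
  have -> : B / (psq x * d) * (psq x * d) = B by field; split; lra.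
  rewrite S_INR; nra.
Qed.

End Symmetric.

Definition tuples (H : prehilb) (r : nat) : prehilb.
Proof.
  refine {| pt := nat -> H; padd := fun x y i => padd (x i) (y i);
            pscal := fun a x i => pscal a (x i);
            pip := fun x y => csum r (fun i => pip (x i) (y i)) |}.
  - by move=> x y z; rewrite -csum_add; apply csum_ext => i _; rewrite pipD.
  - by move=> a x z; rewrite -csum_scal; apply csum_ext => i _; rewrite pipZ.
  - by move=> x y; rewrite -csum_conj; apply csum_ext => i _; exact: pip_conj.
  - by move=> x; rewrite csum_re; apply rsum_ge0 => i _; exact: pip_pos.
Defined.

Section StateForm.
Context {D : CStar} (f : state D).

Definition st_c (d : D) : C := (f d, - f (cs_scal Ci d)).

Lemma st_opp d : f (cs_opp d) = - f d.
Proof. by rewrite cs_oppE st_scal; ring. Qed.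
Lemma st_cD d e : st_c (cs_add d e) = Cplus (st_c d) (st_c e).
Proof. rewrite /st_c cs_scalDr !st_add; C_solve. Qed.
Lemma st_cZ a d : st_c (cs_scal a d) = Cmult a (st_c d).
Proof.
  rewrite /st_c; case: a => a b.
  have -> : cs_scal (a, b) d = cs_add (cs_scal (RtoC a) d) (cs_scal (RtoC b) (cs_scal Ci d)) by nc.
  have -> : cs_scal Ci (cs_add (cs_scal (RtoC a) d) (cs_scal (RtoC b) (cs_scal Ci d)))
    = cs_add (cs_scal (RtoC a) (cs_scal Ci d)) (cs_scal (RtoC (- b)) d) by nc.
  rewrite !st_add !st_scal; C_solve.
Qed.
Lemma st_c_star d : st_c (cs_star d) = Cconj (st_c d).
Proof.
  rewrite /st_c st_star; have -> : cs_scal Ci (cs_star d) = cs_star (cs_opp (cs_scal Ci d)).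
    by rewrite cs_starN cs_starZ; nc.
  rewrite st_star st_opp; C_solve.
Qed.

(** The GNS space before quotient and completion: [D] acts by left multiplication, and the cyclic
    vector is the unit. *)
Definition st_hilb : prehilb.
Proof.
  refine {| pt := cs D; padd := cs_add; pscal := cs_scal;
            pip := fun x y => st_c (cs_mul (cs_star y) x) |}.
  - by move=> x y z; rewrite cs_mulDr st_cD.
  - by move=> a x z; rewrite -cs_scal_mulr st_cZ.
  - by move=> x y; rewrite -st_c_star cs_starM cs_starK.
  - by move=> x; exact: st_pos.
Defined.

End StateForm.
(** * Matrices and their operator norm bounds *)

Definition vec (n : nat) : prehilb.
Proof.
  refine {| pt := Vec; padd := fun u v i => Cplus (u i) (v i);
            pscal := fun a u i => Cmult a (u i);
            pip := fun u v => csum n (fun i => Cmult (u i) (Cconj (v i))) |}.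
  - by move=> x y z; rewrite -csum_add; apply csum_ext => i _; C_solve.
  - by move=> a x z; rewrite -csum_scal; apply csum_ext => i _; C_solve.
  - by move=> x y; rewrite -csum_conj; apply csum_ext => i _; C_solve.
  - move=> x; rewrite csum_re; apply rsum_ge0 => i _.
    by case: (x i) => a b /=; nra.
Defined.

Notation vip n := (@pip (vec n)).

Lemma mat_ext (M N : Mat) : (forall i j, M i j = N i j) -> M = N.
Proof.
  move=> H; apply functional_extensionality => i.
  by apply functional_extensionality => j.
Qed.

Lemma vnormE n v : vnorm n v = @pnorm (vec n) v.
Proof.
  rewrite /vnorm /pnorm /psq.
  have -> : Re (vip n v v) = rsum n (fun i => Re (Cmult (v i) (Cconj (v i)))).
    exact: csum_re.
  congr sqrt; apply rsum_ext => i _.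
  rewrite /Cmod pow2_sqrt; last nra.
  by case: (v i) => a b /=; ring.
Qed.
Lemma vnorm_ge0 n v : 0 <= vnorm n v.
Proof. exact: sqrt_pos. Qed.
Lemma vnorm_ext n u v : (forall i, (i < n)%nat -> u i = v i) -> vnorm n u = vnorm n v.
Proof. by move=> H; rewrite /vnorm; congr sqrt; apply rsum_ext => i Hi; rewrite H. Qed.
Lemma pip_vec_ext n (u v u' v' : vec n) :
  (forall i, (i < n)%nat -> u i = u' i) -> (forall i, (i < n)%nat -> v i = v' i) ->
  pip u v = pip u' v'.
Proof. by move=> H H'; apply csum_ext => i Hi; rewrite H // H'. Qed.

Definition vadd (u v : Vec) : Vec := fun i => Cplus (u i) (v i).
Definition vscal (a : C) (u : Vec) : Vec := fun i => Cmult a (u i).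
Definition vsub (u v : Vec) : Vec := vadd u (vscal (RtoC (-1)) v).

Lemma vnorm_add n u v : vnorm n (vadd u v) <= vnorm n u + vnorm n v.
Proof. rewrite !vnormE; exact: (@pnorm_add (vec n)). Qed.
Lemma vnorm_scal n a v : vnorm n (vscal a v) = Cmod a * vnorm n v.
Proof. rewrite !vnormE; exact: (@pnorm_scal (vec n)). Qed.
Lemma vnorm_scalN n v : vnorm n (vscal (RtoC (-1)) v) = vnorm n v.
Proof. rewrite vnorm_scal Cmod_R Rabs_Ropp Rabs_R1; ring. Qed.
Lemma vnorm_sub n u v : vnorm n (vsub u v) <= vnorm n u + vnorm n v.
Proof. by apply: Rle_trans (vnorm_add _ _ _) _; rewrite vnorm_scalN; lra. Qed.

Lemma apply_vadd n M u v : mat_apply n M (vadd u v) = vadd (mat_apply n M u) (mat_apply n M v).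
Proof.
  apply functional_extensionality => i; rewrite /mat_apply /vadd -csum_add.
  by apply csum_ext => j _; C_solve.
Qed.
Lemma apply_vscal n M a v : mat_apply n M (vscal a v) = vscal a (mat_apply n M v).
Proof.
  apply functional_extensionality => i; rewrite /mat_apply /vscal -csum_scal.
  by apply csum_ext => j _; C_solve.
Qed.
Lemma apply_add n M N v :
  mat_apply n (mat_add M N) v = vadd (mat_apply n M v) (mat_apply n N v).
Proof.
  apply functional_extensionality => i; rewrite /mat_apply /vadd -csum_add.
  by apply csum_ext => j _; rewrite /mat_add; C_solve.
Qed.
Lemma apply_scal n a M v : mat_apply n (mat_scal a M) v = vscal a (mat_apply n M v).
Proof.
  apply functional_extensionality => i; rewrite /mat_apply /vscal -csum_scal.
  by apply csum_ext => j _; rewrite /mat_scal; C_solve.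
Qed.
Lemma mat_subE M N : mat_sub M N = mat_add M (mat_scal (RtoC (-1)) N).
Proof.
  apply mat_ext => i j.
  by rewrite /mat_sub /mat_add /mat_scal; C_solve.
Qed.
Lemma apply_sub n M N v :
  mat_apply n (mat_sub M N) v = vsub (mat_apply n M v) (mat_apply n N v).
Proof. by rewrite mat_subE apply_add apply_scal. Qed.
Lemma apply_mul n M N v :
  mat_apply n (mat_mul n M N) v = mat_apply n M (mat_apply n N v).
Proof.
  apply functional_extensionality => i; rewrite /mat_apply /mat_mul.
  transitivity (csum n (fun j => csum n (fun k => Cmult (Cmult (M i k) (N k j)) (v j)))).
    by apply csum_ext => j _; rewrite Cmult_comm -csum_scal; apply csum_ext => k _; C_solve.
  by rewrite csum_swap; apply csum_ext => k _; rewrite -csum_scal; apply csum_ext => j _; C_solve.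
Qed.
Lemma pip_adj n M (u v : vec n) :
  vip n (mat_apply n M u) v = vip n u (mat_apply n (mat_adj M) v).
Proof.
  rewrite /= /mat_apply /mat_adj.
  transitivity (csum n (fun i => csum n (fun j => Cmult (Cmult (M i j) (u j)) (Cconj (v i))))).
    by apply csum_ext => i _; rewrite Cmult_comm -csum_scal; apply csum_ext => k _; C_solve.
  rewrite csum_swap; apply csum_ext => j _.
  by rewrite -csum_conj -csum_scal; apply csum_ext => i _; C_solve.
Qed.
Lemma csum_delta n i (f : nat -> C) : (i < n)%nat ->
  csum n (fun j => Cmult (if Nat.eqb i j then RtoC 1 else RtoC 0) (f j)) = f i.
Proof.
  elim: n => [|n IH] Hi /=; first lia.
  case: (Nat.eqb_spec i n) => [->|Hne].
    rewrite csum_eq0; first C_solve.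
    move=> j Hj; case: (Nat.eqb_spec n j) => [E|_]; first lia; C_solve.
  by rewrite IH; [C_solve|lia].
Qed.
Lemma apply_id n v i : (i < n)%nat -> mat_apply n mat_id v i = v i.
Proof. exact: csum_delta. Qed.
Lemma apply_ext n M v v' : (forall i, (i < n)%nat -> v i = v' i) ->
  mat_apply n M v = mat_apply n M v'.
Proof.
  move=> H; apply functional_extensionality => i.
  by apply csum_ext => j Hj; rewrite H.
Qed.

(** The unit laws and the identities for direct sums hold only on the relevant entries, whereas
    associativity and distributivity hold for the functions themselves. *)
Definition mat_eq (n : nat) (M N : Mat) : Prop :=
  forall i j, (i < n)%nat -> (j < n)%nat -> M i j = N i j.

Lemma opnorm_ext n M N c : mat_eq n M N -> opnorm_le n M c -> opnorm_le n N c.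
Proof.
  move=> E H v; have := H v.
  rewrite (vnorm_ext n (mat_apply n M v) (mat_apply n N v)) // => i Hi.
  by apply csum_ext => j Hj; rewrite E.
Qed.
Lemma opnorm_mono n M c d : c <= d -> opnorm_le n M c -> opnorm_le n M d.
Proof. by move=> Hcd H v; have := H v; have := vnorm_ge0 n v; nra. Qed.
Lemma opnorm_add n M N c d :
  opnorm_le n M c -> opnorm_le n N d -> opnorm_le n (mat_add M N) (c + d).
Proof.
  move=> H H' v; rewrite apply_add.
  by have := vnorm_add n (mat_apply n M v) (mat_apply n N v); have := H v; have := H' v; lra.
Qed.
Lemma opnorm_scal n a M c : opnorm_le n M c -> opnorm_le n (mat_scal a M) (Cmod a * c).
Proof.
  move=> H v; rewrite apply_scal vnorm_scal; have := H v; have := Cmod_ge_0 a; nra.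
Qed.
Lemma opnorm_sub n M N c d :
  opnorm_le n M c -> opnorm_le n N d -> opnorm_le n (mat_sub M N) (c + d).
Proof.
  move=> H H'; rewrite mat_subE; apply opnorm_add => //.
  have := opnorm_scal n (RtoC (-1)) N d H'.
  by rewrite Cmod_R Rabs_Ropp Rabs_R1 Rmult_1_l.
Qed.
Lemma opnorm_mul n M N c d : 0 <= c ->
  opnorm_le n M c -> opnorm_le n N d -> opnorm_le n (mat_mul n M N) (c * d).
Proof.
  move=> Hc H H' v; rewrite apply_mul.
  by have := H (mat_apply n N v); have := H' v; nra.
Qed.
Lemma opnorm_cstar n M c : 0 <= c ->
  opnorm_le n (mat_mul n (mat_adj M) M) (c * c) -> opnorm_le n M c.
Proof.
  move=> Hc H v.
  apply le_of_sq_le; first by have := vnorm_ge0 n v; nra.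
  have := H v; rewrite apply_mul => Hv.
  have := @pip_re_le (vec n) v (mat_apply n (mat_adj M) (mat_apply n M v)).
  rewrite -pip_adj -/(psq _) -pnorm_sq -!vnormE => K.
  have := Rmult_le_compat_l _ _ _ (vnorm_ge0 n v) Hv; lra.
Qed.
Lemma adjK M : mat_adj (mat_adj M) = M.
Proof.
  apply mat_ext => i j.
  by rewrite /mat_adj; C_solve.
Qed.
Lemma opnorm_adj n M c : 0 <= c -> opnorm_le n M c -> opnorm_le n (mat_adj M) c.
Proof.
  move=> Hc H v; set w := mat_apply n (mat_adj M) v.
  have := @pip_re_le (vec n) (mat_apply n M w) v.
  rewrite pip_adj -/w -/(psq _) -pnorm_sq -!vnormE.
  have := H w; have := vnorm_ge0 n v; have := vnorm_ge0 n w => Hw Hv Hm K.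
  apply Rnot_lt_le => Hlt.
  have : vnorm n (mat_apply n M w) * vnorm n v <= c * vnorm n w * vnorm n v.
    by apply Rmult_le_compat_r.
  have HcV : 0 <= c * vnorm n v by apply Rmult_le_pos.
  have : 0 < vnorm n w * (vnorm n w - c * vnorm n v) by apply Rmult_lt_0_compat; lra.
  lra.
Qed.
(** Tested on the first basis vector; in size 0 every real number would be a bound. *)
Lemma opnorm_ge0 n M c : (0 < n)%nat -> opnorm_le n M c -> 0 <= c.
Proof.
  move=> Hn H; pose e : Vec := fun i => if Nat.eqb 0 i then RtoC 1 else RtoC 0.
  have He : 1 <= vnorm n e.
    rewrite /vnorm -sqrt_1; apply sqrt_le_1_alt.
    have := rsum_term n (fun i => Cmod (e i) ^ 2) 0 ltac:(by move=> i _; nra) Hn.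
    by rewrite /e /= Cmod_1; lra.
  have := H e; have := vnorm_ge0 n (mat_apply n M e); nra.
Qed.
Lemma opnorm_zero n c : 0 <= c -> opnorm_le n (fun _ _ => RtoC 0) c.
Proof.
  move=> Hc v; rewrite (vnorm_ext n _ (vscal (RtoC 0) v)).
    rewrite vnorm_scal Cmod_0 Rmult_0_l; apply Rmult_le_pos => //; exact: sqrt_pos.
  move=> i _; rewrite /mat_apply csum_eq0; first by rewrite /vscal; C_solve.
  by move=> j _; C_solve.
Qed.
Lemma opnorm_id n : opnorm_le n mat_id 1.
Proof. by move=> v; rewrite (vnorm_ext n _ v (apply_id n v)); lra. Qed.

Lemma mat_eq_refl n M : mat_eq n M M. Proof. by []. Qed.
Lemma mat_eq_apply n M N v i : mat_eq n M N -> (i < n)%nat ->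
  mat_apply n M v i = mat_apply n N v i.
Proof. by move=> E Hi; apply csum_ext => j Hj; rewrite E. Qed.
(** * The C*-algebra of bounded matrix sequences modulo null sequences *)

Ltac mat_ring :=
  apply mat_ext; intros;
  rewrite /mat_add /mat_sub /mat_scal /mat_adj; C_solve.

Lemma mat_mulE n M N i j : mat_mul n M N i j = mat_apply n M (fun k => N k j) i.
Proof. by []. Qed.
Lemma mat_mulA n M N P : mat_mul n M (mat_mul n N P) = mat_mul n (mat_mul n M N) P.
Proof.
  apply mat_ext => i j.
  by rewrite [RHS]mat_mulE apply_mul.
Qed.
Lemma mat_mulDl n M N P : mat_mul n (mat_add M N) P = mat_add (mat_mul n M P) (mat_mul n N P).
Proof.
  apply mat_ext => i j.
  by rewrite mat_mulE apply_add.
Qed.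
Lemma mat_mulDr n M N P : mat_mul n M (mat_add N P) = mat_add (mat_mul n M N) (mat_mul n M P).
Proof.
  apply mat_ext => i j.
  exact: (f_equal (fun v => v i) (apply_vadd n M (fun k => N k j) (fun k => P k j))).
Qed.
Lemma mat_scal_mull n a M N : mat_scal a (mat_mul n M N) = mat_mul n (mat_scal a M) N.
Proof.
  apply mat_ext => i j.
  by rewrite mat_mulE apply_scal.
Qed.
Lemma mat_scal_mulr n a M N : mat_scal a (mat_mul n M N) = mat_mul n M (mat_scal a N).
Proof.
  apply mat_ext => i j.
  exact: (f_equal (fun v => v i) (eq_sym (apply_vscal n M a (fun k => N k j)))).
Qed.
Lemma mat_adj_mul n M N : mat_adj (mat_mul n M N) = mat_mul n (mat_adj N) (mat_adj M).
Proof.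
  apply mat_ext => i j.
  rewrite /mat_adj /mat_mul -csum_conj; apply csum_ext => k _; C_solve.
Qed.
Lemma mat_mul1l n M : mat_eq n (mat_mul n mat_id M) M.
Proof. by move=> i j Hi _; rewrite mat_mulE apply_id. Qed.
Lemma mat_adj_id : mat_adj mat_id = mat_id.
Proof.
  apply mat_ext => i j.
  by rewrite /mat_adj /mat_id Nat.eqb_sym; case: (Nat.eqb i j); C_solve.
Qed.
Lemma mat_mul1r n M : mat_eq n (mat_mul n M mat_id) M.
Proof.
  move=> i j Hi Hj.
  have -> : mat_mul n M mat_id = mat_adj (mat_mul n mat_id (mat_adj M)).
    by rewrite mat_adj_mul adjK mat_adj_id.
  by rewrite {1}/mat_adj mat_mul1l // /mat_adj; C_solve.
Qed.

Section SeqAlgebra.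
Context (nk : nat -> nat) (nk_pos : forall k, (0 < nk k)%nat).
Implicit Types X Y Z : nat -> Mat.
Local Notation bdd := (mseq_bounded nk).
Local Notation null := (mseq_null nk).

Definition sadd X Y k := mat_add (X k) (Y k).
Definition ssub X Y k := mat_sub (X k) (Y k).
Definition sscal a X k := mat_scal a (X k).
Definition smul X Y k := mat_mul (nk k) (X k) (Y k).
Definition sadj X k := mat_adj (X k).
Definition sid (k : nat) : Mat := mat_id.
Definition szero (k : nat) : Mat := fun _ _ => RtoC 0.

Ltac seq_ring := rewrite /sadd /ssub /sscal /sadj; mat_ring.

Definition tail_le X (c : R) : Prop :=
  exists K, forall k, (K <= k)%nat -> opnorm_le (nk k) (X k) c.

Lemma tail_le_ge0 X c : tail_le X c -> 0 <= c.
Proof. by move=> [K H]; apply: opnorm_ge0 (nk_pos K) (H K (le_n _)). Qed.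
Lemma tail_le_and X Y c d (P : nat -> Prop) : tail_le X c -> tail_le Y d ->
  (forall k, opnorm_le (nk k) (X k) c -> opnorm_le (nk k) (Y k) d -> P k) ->
  exists K, forall k, (K <= k)%nat -> P k.
Proof.
  move=> [K H] [K' H'] HP; exists (K + K')%nat => k Hk.
  by apply HP; [apply H|apply H']; lia.
Qed.
Lemma tail_le_mono X c d : c <= d -> tail_le X c -> tail_le X d.
Proof. by move=> Hcd [K H]; exists K => k Hk; apply: opnorm_mono Hcd (H k Hk). Qed.
Lemma tail_le_add X Y c d : tail_le X c -> tail_le Y d -> tail_le (sadd X Y) (c + d).
Proof. by move=> H H'; apply: (tail_le_and _ _ _ _ _ H H') => k; exact: opnorm_add. Qed.
Lemma tail_le_sub X Y c d : tail_le X c -> tail_le Y d -> tail_le (ssub X Y) (c + d).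
Proof. by move=> H H'; apply: (tail_le_and _ _ _ _ _ H H') => k; exact: opnorm_sub. Qed.
Lemma tail_le_mul X Y c d : tail_le X c -> tail_le Y d -> tail_le (smul X Y) (c * d).
Proof.
  move=> H H'; apply: (tail_le_and _ _ _ _ _ H H') => k; apply opnorm_mul.
  exact: tail_le_ge0 H.
Qed.
Lemma tail_le_scal a X c : tail_le X c -> tail_le (sscal a X) (Cmod a * c).
Proof. by move=> [K H]; exists K => k Hk; apply opnorm_scal, H. Qed.
Lemma tail_le_adj X c : tail_le X c -> tail_le (sadj X) c.
Proof.
  move=> H; have Hc := tail_le_ge0 _ _ H; case: H => K H.
  by exists K => k Hk; apply opnorm_adj => //; apply H.
Qed.
Lemma tail_le_ext X Y c : (forall k, mat_eq (nk k) (X k) (Y k)) -> tail_le X c -> tail_le Y c.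
Proof. by move=> E [K H]; exists K => k Hk; apply: opnorm_ext (E k) (H k Hk). Qed.

Lemma bdd_tail_le X : bdd X -> exists c, tail_le X c.
Proof. by move=> [c H]; exists c, O => k _; apply H. Qed.
Lemma bdd_add X Y : bdd X -> bdd Y -> bdd (sadd X Y).
Proof. by move=> [c H] [d H']; exists (c + d) => k; apply opnorm_add. Qed.
Lemma bdd_scal a X : bdd X -> bdd (sscal a X).
Proof. by move=> [c H]; exists (Cmod a * c) => k; apply opnorm_scal. Qed.
Lemma bdd_ge0 X c : (forall k, opnorm_le (nk k) (X k) c) -> 0 <= c.
Proof. by move=> H; apply: opnorm_ge0 (nk_pos O) (H O). Qed.
Lemma bdd_mul X Y : bdd X -> bdd Y -> bdd (smul X Y).
Proof.
  move=> [c H] [d H']; exists (c * d) => k; apply opnorm_mul => //.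
  exact: bdd_ge0 H.
Qed.
Lemma bdd_adj X : bdd X -> bdd (sadj X).
Proof. by move=> [c H]; exists c => k; apply opnorm_adj => //; exact: bdd_ge0 H. Qed.
Lemma bdd_id : bdd sid.
Proof. by exists 1 => k; exact: opnorm_id. Qed.
Lemma bdd_zero : bdd szero.
Proof.
  have -> : szero = sscal (RtoC 0) sid.
    apply functional_extensionality => k; rewrite /sscal /szero; mat_ring.
  exact: bdd_scal bdd_id.
Qed.

Definition seqv X Y : Prop := null (ssub X Y).

Lemma null_small X : (forall e, 0 < e -> exists c, c <= e /\ tail_le X c) -> null X.
Proof. by move=> H e He; have [c [Hc H']] := H e He; apply: tail_le_mono Hc H'. Qed.
Lemma null_ext X Y : (forall k, mat_eq (nk k) (X k) (Y k)) -> null X -> null Y.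
Proof. by move=> E H e He; apply: tail_le_ext E (H e He). Qed.
Lemma null_eq X Y : (forall k, X k = Y k) -> null X -> null Y.
Proof. by move=> E; apply null_ext => k; rewrite E. Qed.
Lemma null_zero : null szero.
Proof.
  by move=> e He; exists O => k _; apply opnorm_zero; lra.
Qed.
Lemma null_add X Y : null X -> null Y -> null (sadd X Y).
Proof.
  move=> H H' e He; have -> : e = e / 2 + e / 2 by field.
  by apply: tail_le_add; [apply H|apply H']; lra.
Qed.
Lemma null_scal a X : null X -> null (sscal a X).
Proof.
  move=> H; apply null_small => e He; have Ha := Cmod_ge_0 a.
  have He' : 0 < e / (Cmod a + 1) by apply Rdiv_lt_0_compat; lra.
  exists (Cmod a * (e / (Cmod a + 1))); split; last by apply tail_le_scal, H.
  have : (Cmod a + 1) * (e / (Cmod a + 1)) = e by field; lra.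
  nra.
Qed.
Lemma null_adj X : null X -> null (sadj X).
Proof. by move=> H e He; apply tail_le_adj, H. Qed.
Lemma null_mul_r X Y : bdd X -> null Y -> null (smul X Y).
Proof.
  move=> /bdd_tail_le [c Hc] H; apply null_small => e He; have Hc0 := tail_le_ge0 _ _ Hc.
  have He' : 0 < e / (c + 1) by apply Rdiv_lt_0_compat; lra.
  exists (c * (e / (c + 1))); split; last by apply tail_le_mul => //; apply H.
  have : (c + 1) * (e / (c + 1)) = e by field; lra.
  nra.
Qed.
Lemma null_mul_l X Y : null X -> bdd Y -> null (smul X Y).
Proof.
  move=> H HY; have := null_adj _ (null_mul_r (sadj Y) (sadj X) (bdd_adj _ HY) (null_adj _ H)).
  apply null_ext => k i j Hi Hj; rewrite /sadj /smul mat_adj_mul !adjK //.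
Qed.

Lemma seqv_eq X Y : (forall k, mat_eq (nk k) (X k) (Y k)) -> seqv X Y.
Proof.
  move=> E; apply: null_ext null_zero => k i j Hi Hj.
  by rewrite /ssub /mat_sub E // /szero; C_solve.
Qed.
Lemma seqv_sym X Y : seqv X Y -> seqv Y X.
Proof.
  move=> H; by apply: null_eq (null_scal (RtoC (-1)) _ H) => k; seq_ring.
Qed.
Lemma seqv_trans X Y Z : seqv X Y -> seqv Y Z -> seqv X Z.
Proof.
  move=> H H'; by apply: null_eq (null_add _ _ H H') => k; seq_ring.
Qed.
Lemma seqv_add X Y X' Y' : seqv X X' -> seqv Y Y' -> seqv (sadd X Y) (sadd X' Y').
Proof.
  move=> H H'; by apply: null_eq (null_add _ _ H H') => k; seq_ring.
Qed.
Lemma seqv_scal a X X' : seqv X X' -> seqv (sscal a X) (sscal a X').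
Proof.
  move=> H; by apply: null_eq (null_scal a _ H) => k; seq_ring.
Qed.
Lemma seqv_adj X X' : seqv X X' -> seqv (sadj X) (sadj X').
Proof.
  move=> H; by apply: null_eq (null_adj _ H) => k; seq_ring.
Qed.
Lemma seqv_mul X Y X' Y' : bdd X' -> bdd Y -> seqv X X' -> seqv Y Y' ->
  seqv (smul X Y) (smul X' Y').
Proof.
  move=> HX HY H H'.
  apply: null_eq (null_add _ _ (null_mul_l _ _ H HY) (null_mul_r _ _ HX H')) => k.
  rewrite /sadd /smul /ssub !mat_subE mat_mulDl mat_mulDr -mat_scal_mulr -mat_scal_mull.
  mat_ring.
Qed.
Lemma tail_le_seqv X Y c e : 0 < e -> seqv X Y -> tail_le X c -> tail_le Y (c + e).
Proof.
  move=> He H HX; have -> : Y = ssub X (ssub X Y); last exact: tail_le_sub HX (H e He).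
  by apply functional_extensionality => k; seq_ring.
Qed.

(** The limit superior of the operator norms, which is the norm of the class of [X] in the
    quotient. *)
Definition snorm X : R := Inf (tail_le X).

Lemma snorm_le X c : tail_le X c -> snorm X <= c.
Proof. by move=> H; apply: Inf_le H; exact: tail_le_ge0. Qed.
Lemma snorm_tail_le X e : bdd X -> 0 < e -> tail_le X (snorm X + e).
Proof.
  move=> /bdd_tail_le [c Hc] He; apply NNPP => Hn.
  suff : snorm X + e <= snorm X by lra.
  apply: Inf_ge Hc _ => d Hd; apply Rnot_lt_le => Hlt.
  by apply Hn; apply: tail_le_mono Hd; lra.
Qed.
Lemma snorm_small X c : (forall e, 0 < e -> tail_le X (c + e)) -> snorm X <= c.
Proof.
  move=> H; apply Rnot_lt_le => Hlt.
  have := snorm_le _ _ (H ((snorm X - c) / 2) ltac:(lra)); lra.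
Qed.
Lemma snorm_ge X c : bdd X -> (forall d, tail_le X d -> c <= d) -> c <= snorm X.
Proof. by move=> /bdd_tail_le [d Hd] H; apply: Inf_ge Hd H. Qed.
Lemma snorm_ge0 X : bdd X -> 0 <= snorm X.
Proof. by move=> H; apply snorm_ge => // d; exact: tail_le_ge0. Qed.
Lemma snorm_seqv X Y : bdd X -> bdd Y -> seqv X Y -> snorm X = snorm Y.
Proof.
  have H X' Y' : bdd X' -> seqv X' Y' -> snorm Y' <= snorm X'.
    move=> HX E; apply snorm_small => e He.
    have -> : snorm X' + e = (snorm X' + e / 2) + e / 2 by field.
    by apply: tail_le_seqv E _; [lra|apply snorm_tail_le => //; lra].
  by move=> HX HY E; apply Rle_antisym; apply H => //; apply seqv_sym.
Qed.

End SeqAlgebra.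

(** * Completeness of bounded sequences modulo null sequences *)

Section SeqComplete.
Context (nk : nat -> nat) (nk_pos : forall k, (0 < nk k)%nat).
Local Notation bdd := (mseq_bounded nk).

Section Geometric.
Context (Z : nat -> nat -> Mat).
Hypothesis Z0 : bdd (Z 0).
Hypothesis Zstep : forall j, tail_le nk (ssub (Z (S j)) (Z j)) ((1/2) ^ j).

Let good (j k : nat) : Prop := forall i, (i < j)%nat ->
  opnorm_le (nk k) (mat_sub (Z (S i) k) (Z i k)) ((1/2) ^ i).

Fixpoint last_good (k b : nat) : nat :=
  match b with
  | O => O
  | S b' => match excluded_middle_informative (good (S b') k) with
            | left _ => S b'
            | right _ => last_good k b'
            end
  end.

Lemma last_goodP k b : good (last_good k b) k.
Proof.
  elim: b => [|b IH] /=; first by move=> i Hi; lia.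
  by case: excluded_middle_informative.
Qed.
Lemma last_good_max j k b : good j k -> (j <= b)%nat -> (j <= last_good k b)%nat.
Proof.
  elim: b => [|b IH] Hg Hj /=; first lia.
  case: excluded_middle_informative => // Hn.
  by apply IH => //; case: (Nat.eq_dec j (S b)) => [E|]; [rewrite E in Hg|lia].
Qed.
Lemma good_eventually j : exists K, forall k, (K <= k)%nat -> good j k.
Proof.
  elim: j => [|j [K H]]; first by exists O => k _ i Hi; lia.
  have [K' H'] := Zstep j; exists (K + K')%nat => k Hk i Hi.
  case: (Nat.eq_dec i j) => [->|Hne]; first by apply H'; lia.
  by apply H; lia.
Qed.
Lemma good_telescope j d k : good (j + d) k ->
  opnorm_le (nk k) (mat_sub (Z (j + d) k) (Z j k)) (2 * (1/2) ^ j - 2 * (1/2) ^ (j + d)).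
Proof.
  elim: d => [|d IH] Hg.
    rewrite Nat.add_0_r; have -> : mat_sub (Z j k) (Z j k) = szero k by rewrite /szero; mat_ring.
    by apply opnorm_zero; lra.
  have H1 : good (j + d) k by move=> i Hi; apply Hg; lia.
  have H2 := Hg (j + d)%nat ltac:(lia).
  have := opnorm_add _ _ _ _ _ H2 (IH H1).
  have -> : mat_add (mat_sub (Z (S (j + d)) k) (Z (j + d) k)) (mat_sub (Z (j + d) k) (Z j k))
    = mat_sub (Z (j + S d) k) (Z j k) by rewrite Nat.add_succ_r; mat_ring.
  have -> : (1/2) ^ (j + d) + (2 * (1/2) ^ j - 2 * (1/2) ^ (j + d))
    = 2 * (1/2) ^ j - 2 * (1/2) ^ (j + S d); last by [].
  by rewrite Nat.add_succ_r /=; field.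
Qed.

(** A diagonal choice. The step from [Z j] to [Z (S j)] is small only from some coordinate on,
    depending on [j]; at coordinate [k] one takes the last stage, up to stage [k], before which all
    steps obey their bounds there. Each fixed stage is eventually passed, and the remaining steps
    sum to at most $2\cdot 2^{-j}$. *)
Lemma geometric_limit : exists Y, bdd Y /\ forall j, tail_le nk (ssub Y (Z j)) (2 * (1/2) ^ j).
Proof.
  pose Y k := Z (last_good k k) k.
  have HY j k : good j k -> (j <= k)%nat ->
      opnorm_le (nk k) (mat_sub (Y k) (Z j k)) (2 * (1/2) ^ j).
    move=> Hg Hj; have Hm := last_good_max j k k Hg Hj.
    have E : last_good k k = (j + (last_good k k - j))%nat by lia.
    have := last_goodP k k; rewrite /Y E => Hl.
    apply: opnorm_mono (good_telescope _ _ _ Hl).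
    have : 0 < (1/2) ^ (j + (last_good k k - j)) by apply pow_lt; lra.
    lra.
  exists Y; split.
    have [c Hc] := Z0; exists (c + 2) => k.
    have H0 : good 0 k by move=> i Hi; lia.
    have := opnorm_add _ _ _ _ _ (Hc k) (HY 0%nat k H0 ltac:(lia)).
    have -> : mat_add (Z 0%nat k) (mat_sub (Y k) (Z 0%nat k)) = Y k by mat_ring.
    by rewrite /= Rmult_1_r.
  move=> j; have [K HK] := good_eventually j; exists (K + j)%nat => k Hk.
  by apply HY; [apply HK|]; lia.
Qed.
End Geometric.

Lemma seq_complete (U : nat -> nat -> Mat) : (forall n, bdd (U n)) ->
  (forall eps, 0 < eps -> exists N, forall m n, (N <= m)%nat -> (N <= n)%nat ->
     snorm nk (ssub (U m) (U n)) < eps) ->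
  exists Y, bdd Y /\ forall eps, 0 < eps -> exists N, forall n, (N <= n)%nat ->
     snorm nk (ssub (U n) Y) < eps.
Proof.
  move=> HU HC.
  have Hp j : 0 < (1/2) ^ j by apply pow_lt; lra.
  have [N HN] : exists N : nat -> nat, forall j m n, (N j <= m)%nat -> (N j <= n)%nat ->
      snorm nk (ssub (U m) (U n)) < (1/2) ^ j.
    exists (fun j => epsilon (inhabits O) (fun N => forall m n, (N <= m)%nat -> (N <= n)%nat ->
      snorm nk (ssub (U m) (U n)) < (1/2) ^ j)) => j.
    exact: (epsilon_spec (inhabits O) _ (HC _ (Hp j))).
  have [a [Ha Ham]] : exists a : nat -> nat, (forall j, (N j <= a j)%nat) /\
      forall j, (a j <= a (S j))%nat.
    exists (fix a j := match j with O => N O | S j' => Nat.max (a j') (N j) end).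
    by split => [[|j]|j] //; lia.
  have Hbs X Y : bdd X -> bdd Y -> bdd (ssub X Y).
    by move=> [c Hc] [d Hd]; exists (c + d) => k; apply opnorm_sub.
  have [|j|Y [HY HYl]] := geometric_limit (fun j => U (a j)); first exact: HU.
    have Hlt := HN j (a (S j)) (a j) ltac:(by have := Ha j; have := Ham j; lia) (Ha j).
    set s := snorm _ _ in Hlt.
    have -> : (1/2) ^ j = s + ((1/2) ^ j - s) by ring.
    by apply snorm_tail_le => //; [apply Hbs|lra].
  exists Y; split => // eps He.
  (* One unit of $2^{-j}$ comes from the Cauchy condition and two from the geometric tail; the
     fourth is for strictness. *)
  have [j Hj] : exists j, 4 * (1/2) ^ j < eps.
    have [j Hj] := pow_lt_1_zero (1/2) ltac:(by rewrite Rabs_pos_eq; lra) (eps / 4) ltac:(lra).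
    by exists j; have := Hj j (le_n _); rewrite Rabs_pos_eq; [lra|apply Rlt_le].
  exists (a j) => n Hn.
  have Hlt := HN j n (a j) ltac:(by have := Ha j; lia) (Ha j).
  have H1 : tail_le nk (ssub (U n) (U (a j))) ((1/2) ^ j).
    set s := snorm _ _ in Hlt.
    have -> : (1/2) ^ j = s + ((1/2) ^ j - s) by ring.
    by apply snorm_tail_le => //; [apply Hbs|lra].
  have := tail_le_sub nk _ _ _ _ H1 (HYl j).
  have -> : ssub (ssub (U n) (U (a j))) (ssub Y (U (a j))) = ssub (U n) Y.
    apply functional_extensionality => k; rewrite /ssub; mat_ring.
  move=> /(snorm_le nk nk_pos); have := Hp j; lra.
Qed.

End SeqComplete.

Lemma product_slack x y eps : 0 <= x -> 0 <= y -> 0 < eps ->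
  exists d, 0 < d /\ (x + d) * (y + d) <= x * y + eps.
Proof.
  move=> Hx Hy He; set M := x + y + 1.
  have HM : eps / M * M = eps by rewrite /M; field; lra.
  have HeM : 0 < eps / M by apply Rdiv_lt_0_compat; rewrite /M; lra.
  exists (Rmin 1 (eps / M)); have := Rmin_l 1 (eps / M); have := Rmin_r 1 (eps / M).
  have : 0 < Rmin 1 (eps / M) by apply Rmin_pos; lra.
  move: (Rmin _ _) => d Hd Hd2 Hd1; split => //.
  have HM0 : 0 <= M by rewrite /M; lra.
  have := Rmult_le_compat_r M _ _ HM0 Hd2; rewrite HM => H.
  have Hdd : d * d <= d by nra.
  move: H; rewrite /M; lra.
Qed.

(** * The quotient as a C*-algebra *)

Section Quotient.
Context (nk : nat -> nat) (nk_pos : forall k, (0 < nk k)%nat).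
Implicit Types X Y Z : nat -> Mat.
Local Notation bdd := (mseq_bounded nk).
Local Notation eqv := (seqv nk).

(** The laws of [CStar] are equalities, so an element of the quotient is a class itself, as a
    predicate on sequences, and extensionality identifies equal classes. *)
Definition is_class (S : (nat -> Mat) -> Prop) : Prop :=
  exists X, bdd X /\ S = (fun Y => bdd Y /\ eqv X Y).
Definition qcar : Type := {S | is_class S}.
Definition cls X (HX : bdd X) : qcar := exist _ _ (ex_intro _ X (conj HX eq_refl)).

Lemma rep_ex (e : qcar) : exists X, proj1_sig e X.
Proof.
  case: e => S [X [HX ES]] /=; exists X; rewrite ES; split => //.
  exact: seqv_eq.
Qed.
Definition rep (e : qcar) : nat -> Mat := epsilon (inhabits szero) (proj1_sig e).
Lemma repP e : proj1_sig e (rep e).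
Proof. exact: (epsilon_spec _ _ (rep_ex e)). Qed.
Lemma rep_bdd e : bdd (rep e).
Proof. by have := repP e; case: (proj2_sig e) => X [HX ->] []. Qed.
Lemma cls_eq X Y HX HY : eqv X Y -> cls X HX = cls Y HY.
Proof.
  move=> E; apply eq_sig_hprop => /=; first by move=> S; exact: proof_irrelevance.
  apply functional_extensionality => Z; apply propositional_extensionality.
  split => [[HZ H]|[HZ H]]; split => //.
    exact: seqv_trans (seqv_sym _ _ _ E) H.
  exact: seqv_trans E H.
Qed.
Lemma rep_cls X HX : eqv X (rep (cls X HX)).
Proof. by have := repP (cls X HX); case. Qed.
Lemma cls_inj X Y HX HY : cls X HX = cls Y HY -> eqv X Y.
Proof.
  move=> E; apply: seqv_trans (rep_cls X HX) _; rewrite E.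
  exact: seqv_sym (rep_cls Y HY).
Qed.
Lemma cls_rep e HX : cls (rep e) HX = e.
Proof.
  case: e HX => S [X [HX ES]]; subst S => HX'.
  exact: cls_eq (seqv_sym _ _ _ (rep_cls X HX)).
Qed.
Lemma cls_surj e : exists X HX, e = cls X HX.
Proof. by exists (rep e), (rep_bdd e); rewrite cls_rep. Qed.

(** The operations are opaque so that rewriting never unfolds them to representatives. *)
Lemma qadd_spec : {op : qcar -> qcar -> qcar | forall X Y HX HY,
  op (cls X HX) (cls Y HY) = cls (sadd X Y) (bdd_add _ _ _ HX HY)}.
Proof.
  exists (fun e f => cls (sadd (rep e) (rep f)) (bdd_add _ _ _ (rep_bdd e) (rep_bdd f))).
  by move=> X Y HX HY; apply cls_eq, seqv_sym, seqv_add; apply rep_cls.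
Qed.
Lemma qscal_spec : {op : C -> qcar -> qcar | forall a X HX,
  op a (cls X HX) = cls (sscal a X) (bdd_scal _ a _ HX)}.
Proof.
  exists (fun a e => cls (sscal a (rep e)) (bdd_scal _ a _ (rep_bdd e))).
  by move=> a X HX; apply cls_eq, seqv_sym, seqv_scal, rep_cls.
Qed.
Lemma qmul_spec : {op : qcar -> qcar -> qcar | forall X Y HX HY,
  op (cls X HX) (cls Y HY) = cls (smul nk X Y) (bdd_mul _ nk_pos _ _ HX HY)}.
Proof.
  exists (fun e f =>
    cls (smul nk (rep e) (rep f)) (bdd_mul _ nk_pos _ _ (rep_bdd e) (rep_bdd f))).
  move=> X Y HX HY; apply cls_eq, seqv_sym, seqv_mul => //; try exact: rep_cls.
  exact: rep_bdd.
Qed.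
Lemma qadj_spec : {op : qcar -> qcar | forall X HX,
  op (cls X HX) = cls (sadj X) (bdd_adj _ nk_pos _ HX)}.
Proof.
  exists (fun e => cls (sadj (rep e)) (bdd_adj _ nk_pos _ (rep_bdd e))).
  by move=> X HX; apply cls_eq, seqv_sym, seqv_adj => //; apply rep_cls.
Qed.
Definition qadd := proj1_sig qadd_spec.
Definition qscal := proj1_sig qscal_spec.
Definition qmul := proj1_sig qmul_spec.
Definition qadj := proj1_sig qadj_spec.
Definition qadd_cls : forall X Y HX HY,
  qadd (cls X HX) (cls Y HY) = cls (sadd X Y) _ := proj2_sig qadd_spec.
Definition qscal_cls : forall a X HX,
  qscal a (cls X HX) = cls (sscal a X) _ := proj2_sig qscal_spec.
Definition qmul_cls : forall X Y HX HY,
  qmul (cls X HX) (cls Y HY) = cls (smul nk X Y) _ := proj2_sig qmul_spec.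
Definition qadj_cls : forall X HX, qadj (cls X HX) = cls (sadj X) _ := proj2_sig qadj_spec.
Definition qone := cls sid (bdd_id nk).
Definition qzero := cls szero (bdd_zero nk).
Definition qnorm e := snorm nk (rep e).

Lemma qnorm_cls X HX : qnorm (cls X HX) = snorm nk X.
Proof. by symmetry; apply snorm_seqv => //; [exact: rep_bdd|exact: rep_cls]. Qed.

Ltac q_solve :=
  repeat (lazymatch goal with |- forall e : qcar, _ =>
     let X := fresh "X" in let HX := fresh "HX" in
     let e := fresh "e" in
     intro e; destruct (cls_surj e) as [X [HX E]]; subst e end);
  rewrite /qone /qzero;
  repeat rewrite ?qadd_cls ?qscal_cls ?qmul_cls ?qadj_cls;
  apply cls_eq, seqv_eq => k; rewrite /sadd /sscal /smul /sadj /sid /szero.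
Ltac q_eq := lazymatch goal with |- mat_eq _ ?M ?N => suff -> : M = N by [] end.

Definition seq_quotient : CStar.
Proof.
  refine {| cs := qcar; cs_zero := qzero; cs_one := qone; cs_add := qadd;
            cs_opp := qscal (RtoC (-1)); cs_scal := qscal; cs_mul := qmul;
            cs_star := qadj; cs_norm := qnorm |}.
  - q_solve; q_eq; mat_ring.
  - q_solve; q_eq; mat_ring.
  - q_solve; q_eq; mat_ring.
  - q_solve; q_eq; mat_ring.
  - move=> a; q_solve; q_eq; mat_ring.
  - move=> a b; q_solve; q_eq; mat_ring.
  - move=> a b; q_solve; q_eq; mat_ring.
  - q_solve; q_eq; mat_ring.
  - q_solve; q_eq; exact: mat_mulA.
  - q_solve; exact: mat_mul1l.
  - q_solve; exact: mat_mul1r.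
  - q_solve; q_eq; exact: mat_mulDl.
  - q_solve; q_eq; exact: mat_mulDr.
  - move=> a; q_solve; q_eq; exact: mat_scal_mull.
  - move=> a; q_solve; q_eq; exact: mat_scal_mulr.
  - q_solve; q_eq; exact: adjK.
  - q_solve; q_eq; mat_ring.
  - move=> a; q_solve; q_eq; mat_ring.
  - q_solve; q_eq; exact: mat_adj_mul.
  - move=> e; have [X [HX ->]] := cls_surj e; rewrite qnorm_cls => H0.
    apply cls_eq; apply null_ext with (X := X).
      by move=> k i j _ _; rewrite /ssub /mat_sub /szero; C_solve.
    by move=> eps He; have := snorm_tail_le nk X eps HX He; rewrite H0 Rplus_0_l.
  - move=> e f; have [X [HX ->]] := cls_surj e; have [Y [HY ->]] := cls_surj f.
    rewrite qadd_cls !qnorm_cls; apply snorm_small => // eps He.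
    have -> : snorm nk X + snorm nk Y + eps = (snorm nk X + eps / 2) + (snorm nk Y + eps / 2).
      by field.
    by apply tail_le_add; apply snorm_tail_le => //; lra.
  - have le a X : bdd X -> snorm nk (sscal a X) <= Cmod a * snorm nk X.
      move=> HX; have Ha := Cmod_ge_0 a; apply snorm_small => // eps He.
      have He' : 0 < eps / (Cmod a + 1) by apply Rdiv_lt_0_compat; lra.
      apply: tail_le_mono (tail_le_scal _ a _ _ (snorm_tail_le nk X _ HX He')).
      have : (Cmod a + 1) * (eps / (Cmod a + 1)) = eps by field; lra.
      nra.
    move=> a e; have [X [HX ->]] := cls_surj e; rewrite qscal_cls !qnorm_cls.
    apply Rle_antisym; first exact: le.
    case: (Ceq_dec a (RtoC 0)) => [->|Ha].
      by rewrite Cmod_0 Rmult_0_l; apply snorm_ge0 => //; exact: bdd_scal.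
    have Ha0 := Cmod_gt_0 a; have {Ha0} Ha0 : 0 < Cmod a by apply Ha0.
    have := le (Cinv a) (sscal a X) (bdd_scal _ a _ HX).
    have -> : sscal (Cinv a) (sscal a X) = X.
      apply functional_extensionality => k; apply mat_ext => i j; rewrite /sscal /mat_scal.
      by rewrite Cmult_assoc Cinv_l // Cmult_1_l.
    rewrite Cmod_inv // => H.
    have := Rmult_le_compat_l _ _ _ (Rlt_le _ _ Ha0) H.
    by rewrite -Rmult_assoc Rinv_r ?Rmult_1_l //; lra.
  - move=> e f; have [X [HX ->]] := cls_surj e; have [Y [HY ->]] := cls_surj f.
    rewrite qmul_cls !qnorm_cls; apply snorm_small => // eps He.
    have Hx := snorm_ge0 nk nk_pos X HX; have Hy := snorm_ge0 nk nk_pos Y HY.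
    have [d [Hd Hle]] := product_slack _ _ _ Hx Hy He; apply: tail_le_mono Hle _.
    by apply tail_le_mul => //; apply snorm_tail_le.
  - move=> e; have [X [HX ->]] := cls_surj e; rewrite qadj_cls qmul_cls !qnorm_cls.
    have Hx := snorm_ge0 nk nk_pos X HX; apply Rle_antisym.
      apply snorm_small => // eps He.
      have [d [Hd Hle]] := product_slack _ _ _ Hx Hx He; apply: tail_le_mono Hle _.
      by apply tail_le_mul => //; [apply tail_le_adj => //|]; apply snorm_tail_le.
    apply snorm_ge => //; first by apply bdd_mul => //; apply bdd_adj.
    move=> d Hd; have Hd0 := tail_le_ge0 nk nk_pos _ _ Hd.
    have : snorm nk X <= sqrt d.
      apply snorm_le => //; case: Hd => K HK; exists K => k Hk.
      apply opnorm_cstar; first exact: sqrt_pos.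
      by rewrite sqrt_sqrt //; apply HK.
    by move=> H; rewrite -(sqrt_sqrt d) //; have := sqrt_pos d; nra.
  - move=> u Hu.
    have E e f : qnorm (qadd e (qscal (RtoC (-1)) f)) = snorm nk (ssub (rep e) (rep f)).
      rewrite -{1}(cls_rep e (rep_bdd e)) -{1}(cls_rep f (rep_bdd f)) qscal_cls qadd_cls qnorm_cls.
      congr snorm; apply functional_extensionality => k; rewrite /sadd /sscal /ssub; mat_ring.
    have [n|eps He|Y [HY HYl]] := seq_complete nk nk_pos (fun n => rep (u n)).
    - exact: rep_bdd.
    - by have [N HN] := Hu eps He; exists N => m n Hm Hn; rewrite -E; apply HN.
    - exists (cls Y HY) => eps He; have [N HN] := HYl eps He; exists N => n Hn.
      rewrite -(cls_rep (u n) (rep_bdd (u n))) qscal_cls qadd_cls qnorm_cls.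
      have -> : sadd (rep (u n)) (sscal (RtoC (-1)) Y) = ssub (rep (u n)) Y; last exact: HN.
      apply functional_extensionality => k; rewrite /sadd /sscal /ssub; mat_ring.
Defined.

End Quotient.
(** * Asymptotic representations *)

(** The conditions defining an MF algebra, without injectivity. *)
Definition asym_hom (A : CStar) (nk : nat -> nat) (Phi : A -> nat -> Mat) : Prop :=
  (forall a, mseq_bounded nk (Phi a)) /\
  (forall x y, seqv nk (Phi (cs_add x y)) (sadd (Phi x) (Phi y))) /\
  (forall c x, seqv nk (Phi (cs_scal c x)) (sscal c (Phi x))) /\
  (forall x y, seqv nk (Phi (cs_mul x y)) (smul nk (Phi x) (Phi y))) /\
  (forall x, seqv nk (Phi (cs_star x)) (sadj (Phi x))) /\
  seqv nk (Phi cs_one) sid.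

Section AsymHom.
Context {A : CStar} {nk : nat -> nat} (nk_pos : forall k, (0 < nk k)%nat).
Local Notation E := (seq_quotient nk nk_pos).

Lemma asym_hom_class (Phi : A -> nat -> Mat) : asym_hom A nk Phi ->
  exists p : A -> E, is_ustarhom A E p /\ forall a, exists HX, p a = cls nk (Phi a) HX.
Proof.
  move=> [Hb [Ha [Hs [Hm [Ht H1]]]]].
  exists (fun a => cls nk (Phi a) (Hb a)); split; last by move=> a; exists (Hb a).
  split; [|split; [|split; [|split]]].
  - by move=> x y; rewrite /= qadd_cls; apply cls_eq.
  - by move=> a x; rewrite /= qscal_cls; apply cls_eq.
  - by move=> x y; rewrite /= qmul_cls; apply cls_eq.
  - by move=> x; rewrite /= qadj_cls; apply cls_eq.
  - by apply cls_eq.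
Qed.

Lemma hom_asym_hom (p : A -> E) : is_ustarhom A E p ->
  asym_hom A nk (fun a => rep nk (p a)).
Proof.
  move=> Hp; split; first by move=> a; exact: rep_bdd.
  have R X HX : seqv nk (rep nk (cls nk X HX)) X by apply seqv_sym, rep_cls.
  have R' X HX : seqv nk X (rep nk (cls nk X HX)) by exact: rep_cls.
  split; [|split; [|split; [|split]]].
  - move=> x y; rewrite (homD _ Hp); move: (p x) (p y) => e f.
    have [X [HX ->]] := cls_surj nk e; have [Y [HY ->]] := cls_surj nk f.
    by rewrite /= qadd_cls; apply: seqv_trans (R _ _) _; apply seqv_add.
  - move=> a x; rewrite (homZ _ Hp); move: (p x) => e.
    have [X [HX ->]] := cls_surj nk e.
    by rewrite /= qscal_cls; apply: seqv_trans (R _ _) _; apply seqv_scal.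
  - move=> x y; rewrite (homM _ Hp); move: (p x) (p y) => e f.
    have [X [HX ->]] := cls_surj nk e; have [Y [HY ->]] := cls_surj nk f.
    rewrite /= qmul_cls; apply: seqv_trans (R _ _) _; apply seqv_mul => //.
    exact: rep_bdd.
  - move=> x; rewrite (hom_star _ Hp); move: (p x) => e.
    have [X [HX ->]] := cls_surj nk e.
    by rewrite /= qadj_cls; apply: seqv_trans (R _ _) _; apply seqv_adj.
  - by rewrite (hom1 _ Hp); exact: R.
Qed.

(** Injectivity modulo null sequences makes the induced homomorphism injective, hence isometric.
    This is how norms in [A] are read off from matrices. *)
Lemma asym_hom_isometric (Phi : A -> nat -> Mat) : asym_hom A nk Phi ->
  (forall x y, seqv nk (Phi x) (Phi y) -> x = y) ->
  forall a, snorm nk (Phi a) = cs_norm a.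
Proof.
  move=> HP Hinj a; have [p [Hp Hc]] := asym_hom_class Phi HP.
  rewrite -(hom_isometric p Hp); last first.
    move=> x y; have [HX ->] := Hc x; have [HY ->] := Hc y.
    by move=> /cls_inj; exact: Hinj.
  by have [HX ->] := Hc a; rewrite /= qnorm_cls.
Qed.

Lemma hom_MF (p : A -> E) : is_ustarhom A E p -> (forall x y, p x = p y -> x = y) -> MF A.
Proof.
  move=> Hp Hinj; have [H1 [H2 [H3 [H4 [H5 H6]]]]] := hom_asym_hom p Hp.
  exists nk, (fun a => rep nk (p a)); do 7 (split => //).
  move=> x y H; apply Hinj.
  rewrite -(cls_rep nk (p x) (rep_bdd nk (p x))) -(cls_rep nk (p y) (rep_bdd nk (p y))).
  exact: cls_eq.
Qed.

End AsymHom.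

Fixpoint cs_sum {A : CStar} (n : nat) (F : nat -> A) : A :=
  match n with O => cs_zero | S n => cs_add (cs_sum n F) (F n) end.
Definition msum (n : nat) (F : nat -> Mat) : Mat := fun i j => csum n (fun l => F l i j).

Section Represents.
Context {A : CStar} {nk : nat -> nat} (nk_pos : forall k, (0 < nk k)%nat).
Context {Phi : A -> nat -> Mat} (HPhi : asym_hom A nk Phi).

(** [Phi] of an expression and the same expression in values of [Phi] differ by a null sequence.
    This relation allows an explicit matrix expression to stand in for [Phi x]. *)
Definition represents (x : A) (X : nat -> Mat) : Prop :=
  mseq_bounded nk X /\ seqv nk (Phi x) X.

Lemma represents_self x : represents x (Phi x).
Proof. by split; [apply HPhi|apply seqv_eq]. Qed.
Lemma represents_add x y X Y : represents x X -> represents y Y ->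
  represents (cs_add x y) (fun k => mat_add (X k) (Y k)).
Proof.
  move=> [HX EX] [HY EY]; split; first exact: bdd_add.
  by apply: seqv_trans (seqv_add _ _ _ _ _ EX EY); apply HPhi.
Qed.
Lemma represents_scal a x X : represents x X -> represents (cs_scal a x) (fun k => mat_scal a (X k)).
Proof.
  move=> [HX EX]; split; first exact: bdd_scal.
  by apply: seqv_trans (seqv_scal _ a _ _ EX); apply HPhi.
Qed.
Lemma represents_mul x y X Y : represents x X -> represents y Y ->
  represents (cs_mul x y) (fun k => mat_mul (nk k) (X k) (Y k)).
Proof.
  move=> [HX EX] [HY EY]; split; first exact: bdd_mul.
  apply: seqv_trans (seqv_mul nk nk_pos _ _ _ _ HX _ EX EY); apply HPhi.
Qed.
Lemma represents_star x X : represents x X -> represents (cs_star x) (fun k => mat_adj (X k)).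
Proof.
  move=> [HX EX]; split; first exact: bdd_adj.
  by apply: seqv_trans (seqv_adj _ nk_pos _ _ EX); apply HPhi.
Qed.
Lemma represents_one : represents cs_one (fun _ => mat_id).
Proof. by split; [exact: bdd_id|apply HPhi]. Qed.
Lemma represents_zero : represents cs_zero szero.
Proof.
  have -> : @szero = sscal (RtoC 0) sid.
    apply functional_extensionality => k; rewrite /szero /sscal; mat_ring.
  by rewrite -(cs_scal0l cs_one); apply represents_scal, represents_one.
Qed.
Lemma represents_sum n F (G : nat -> nat -> Mat) :
  (forall l, (l < n)%nat -> represents (F l) (G l)) ->
  represents (cs_sum n F) (fun k => msum n (fun l => G l k)).
Proof.
  elim: n => [|n IH] H /=; first exact: represents_zero.
  by apply (represents_add _ _ _ (G n)); [apply IH => l Hl|]; apply H; lia.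
Qed.

End Represents.
(** * Finite-dimensional approximate representations *)

Lemma csum_cat n m f : csum (n + m) f = Cplus (csum n f) (csum m (fun i => f (n + i)%nat)).
Proof.
  elim: m => [|m IH]; first by rewrite Nat.add_0_r /=; C_solve.
  by rewrite Nat.add_succ_r /= IH; C_solve.
Qed.

Definition vcat (n : nat) (u v : Vec) : Vec :=
  fun i => if Nat.ltb i n then u i else v (i - n)%nat.
Definition dsum (n : nat) (M N : Mat) : Mat := fun i j =>
  if Nat.ltb i n then (if Nat.ltb j n then M i j else RtoC 0)
  else (if Nat.ltb j n then RtoC 0 else N (i - n)%nat (j - n)%nat).

Lemma vcat_l n u v i : (i < n)%nat -> vcat n u v i = u i.
Proof. by move=> H; rewrite /vcat; case: (Nat.ltb_spec i n) => //; lia. Qed.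
Lemma vcat_r n u v i : vcat n u v (n + i)%nat = v i.
Proof.
  rewrite /vcat; case: (Nat.ltb_spec (n + i) n) => [|_]; first lia.
  by congr v; lia.
Qed.

Lemma apply_dsum n m M N u v i :
  mat_apply (n + m) (dsum n M N) (vcat n u v) i
  = vcat n (mat_apply n M u) (mat_apply m N v) i.
Proof.
  rewrite {1}/mat_apply csum_cat /dsum /vcat; case: (Nat.ltb_spec i n) => Hi.
    rewrite -[RHS]Cplus_0_r; congr Cplus.
      by apply csum_ext => j Hj; case: (Nat.ltb_spec j n) => //; lia.
    apply csum_eq0 => j Hj; case: (Nat.ltb_spec (n + j) n) => H; first lia.
    C_solve.
  rewrite -[RHS]Cplus_0_l; congr Cplus.
    by apply csum_eq0 => j Hj; case: (Nat.ltb_spec j n) => H; [C_solve|lia].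
  apply csum_ext => j Hj; case: (Nat.ltb_spec (n + j) n) => H; first lia.
  by have -> : (n + j - n)%nat = j by lia.
Qed.

Lemma vcat_split n (w : Vec) i : vcat n w (fun j => w (n + j)%nat) i = w i.
Proof.
  by rewrite /vcat; case: (Nat.ltb_spec i n) => // H; congr w; lia.
Qed.
Lemma pip_vcat n m u v u' v' :
  vip (n + m) (vcat n u v) (vcat n u' v') = Cplus (vip n u u') (vip m v v').
Proof.
  rewrite /= csum_cat; congr Cplus; apply csum_ext => i Hi.
    by rewrite !vcat_l.
  by rewrite !vcat_r.
Qed.
Lemma vnorm_vcat n m u v : vnorm (n + m) (vcat n u v) ^ 2 = vnorm n u ^ 2 + vnorm m v ^ 2.
Proof. by rewrite !vnormE !pnorm_sq /psq pip_vcat. Qed.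

Lemma opnorm_dsum n m M N c : 0 <= c ->
  opnorm_le n M c -> opnorm_le m N c -> opnorm_le (n + m) (dsum n M N) c.
Proof.
  move=> Hc HM HN w; set u := w; set v : Vec := fun j => w (n + j)%nat.
  have Ew i : (i < n + m)%nat -> w i = vcat n u v i by move=> _; rewrite vcat_split.
  rewrite (apply_ext _ _ _ _ Ew) (vnorm_ext _ w _ Ew).
  rewrite (vnorm_ext _ _ (vcat n (mat_apply n M u) (mat_apply m N v))); last first.
    by move=> i _; rewrite apply_dsum.
  apply le_of_sq_le; first by apply Rmult_le_pos => //; exact: vnorm_ge0.
  have := vnorm_vcat n m (mat_apply n M u) (mat_apply m N v).
  have := vnorm_vcat n m u v; have := HM u; have := HN v.
  have := vnorm_ge0 n u; have := vnorm_ge0 m v.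
  have := vnorm_ge0 n (mat_apply n M u); have := vnorm_ge0 m (mat_apply m N v).
  move=> H1 H2 H3 H4 H5 H6 H7 H8.
  have : vnorm n (mat_apply n M u) ^ 2 <= (c * vnorm n u) ^ 2 by apply pow_incr; lra.
  have : vnorm m (mat_apply m N v) ^ 2 <= (c * vnorm m v) ^ 2 by apply pow_incr; lra.
  nra.
Qed.

Definition unitary (n : nat) (U : Mat) : Prop :=
  mat_eq n (mat_mul n (mat_adj U) U) mat_id /\ mat_eq n (mat_mul n U (mat_adj U)) mat_id.
Definition conjm (n : nat) (U M : Mat) : Mat := mat_mul n U (mat_mul n M (mat_adj U)).

Lemma mat_eq_sym n M N : mat_eq n M N -> mat_eq n N M.
Proof. by move=> H i j Hi Hj; rewrite H. Qed.
Lemma mat_eq_trans n M N P : mat_eq n M N -> mat_eq n N P -> mat_eq n M P.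
Proof. by move=> H H' i j Hi Hj; rewrite H // H'. Qed.
Lemma mat_eq_mul n M N M' N' : mat_eq n M M' -> mat_eq n N N' ->
  mat_eq n (mat_mul n M N) (mat_mul n M' N').
Proof. by move=> H H' i j Hi Hj; apply csum_ext => k Hk; rewrite H // H'. Qed.
Lemma mat_eq_adj n M N : mat_eq n M N -> mat_eq n (mat_adj M) (mat_adj N).
Proof. by move=> H i j Hi Hj; rewrite /mat_adj H. Qed.

Lemma unitary_adj n U : unitary n U -> unitary n (mat_adj U).
Proof. by move=> [H H']; split; rewrite adjK. Qed.
Lemma unitary_norm n U v : unitary n U -> vnorm n (mat_apply n U v) = vnorm n v.
Proof.
  move=> [H _]; rewrite !vnormE /pnorm /psq pip_adj -apply_mul; congr (sqrt (Re _)).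
  apply pip_vec_ext => // i Hi; rewrite (mat_eq_apply _ _ _ _ _ H) // apply_id //.
Qed.
Lemma unitary_opnorm n U : unitary n U -> opnorm_le n U 1.
Proof. by move=> H v; rewrite unitary_norm //; lra. Qed.
Lemma opnorm_conjm n U M c : 0 <= c -> unitary n U -> opnorm_le n M c -> opnorm_le n (conjm n U M) c.
Proof.
  move=> Hc HU HM; have -> : c = 1 * (c * 1) by ring.
  apply opnorm_mul; [lra|exact: unitary_opnorm|].
  by apply opnorm_mul => //; apply unitary_opnorm, unitary_adj.
Qed.

Section Natural.
Context {A : Type}.
Local Notation fam := (A -> Mat).

Definition fam_dsum (n : nat) (r r' : fam) : fam := fun a => dsum n (r a) (r' a).
Definition fam_conj (n : nat) (U : Mat) (r : fam) : fam := fun a => conjm n U (r a).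

(** Constructions on matrix tuples that commute with direct sums and unitary
    conjugation, so that norm bounds pass from [Phi] to all of [level m]. *)
Definition natural (F : nat -> fam -> Mat) : Prop :=
  (forall n m r r', mat_eq (n + m) (F (n + m)%nat (fam_dsum n r r')) (dsum n (F n r) (F m r'))) /\
  (forall n U r, unitary n U -> mat_eq n (F n (fam_conj n U r)) (conjm n U (F n r))).

Lemma natural_var a : natural (fun _ r => r a).
Proof. by split. Qed.
Lemma natural_add F G : natural F -> natural G -> natural (fun n r => mat_add (F n r) (G n r)).
Proof.
  move=> [HF HF'] [HG HG']; split => [n m r r'|n U r HU] i j Hi Hj.
    rewrite /mat_add HF // HG // /dsum.
    by case: (Nat.ltb i n); case: (Nat.ltb j n) => //; C_solve.
  rewrite /mat_add HF' // HG' // /conjm.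
  by rewrite -/(mat_add _ _ i j) -mat_mulDr -mat_mulDl.
Qed.
Lemma natural_scal a F : natural F -> natural (fun n r => mat_scal a (F n r)).
Proof.
  move=> [HF HF']; split => [n m r r'|n U r HU] i j Hi Hj.
    rewrite /mat_scal HF // /dsum.
    by case: (Nat.ltb i n); case: (Nat.ltb j n) => //; C_solve.
  rewrite /mat_scal HF' // /conjm -/(mat_scal a _ i j).
  by rewrite mat_scal_mulr mat_scal_mull.
Qed.
Lemma natural_sub F G : natural F -> natural G -> natural (fun n r => mat_sub (F n r) (G n r)).
Proof.
  move=> HF HG; have [H H'] := natural_add _ _ HF (natural_scal (RtoC (-1)) _ HG).
  by split => [n m r r'|n U r HU]; rewrite !mat_subE; [apply H|apply H'].
Qed.
Lemma natural_mul F G : natural F -> natural G ->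
  natural (fun n r => mat_mul n (F n r) (G n r)).
Proof.
  move=> [HF HF'] [HG HG']; split => [n m r r'|n U r HU].
    apply: mat_eq_trans (mat_eq_mul _ _ _ _ _ (HF _ _ _ _) (HG _ _ _ _)) _ => i j Hi Hj.
    rewrite mat_mulE (apply_ext _ _ _ (vcat n (fun k => if Nat.ltb j n then G n r k j else RtoC 0)
      (fun k => if Nat.ltb j n then RtoC 0 else G m r' k (j - n)%nat))); last first.
      by move=> k _; rewrite /dsum /vcat; case: (Nat.ltb k n).
    rewrite apply_dsum /vcat /dsum; case: (Nat.ltb i n); case: (Nat.ltb j n) => //.
      by apply csum_eq0 => k _; C_solve.
    by apply csum_eq0 => k _; C_solve.
  apply: mat_eq_trans (mat_eq_mul _ _ _ _ _ (HF' _ _ _ HU) (HG' _ _ _ HU)) _.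
  have [HU1 _] := HU; rewrite /conjm.
  rewrite -!mat_mulA (mat_mulA _ (mat_adj U) U).
  apply mat_eq_mul => //; apply mat_eq_mul => //.
  apply: mat_eq_trans (mat_eq_mul _ _ _ _ _ HU1 (mat_eq_refl _ _)) _.
  exact: mat_mul1l.
Qed.
Lemma natural_adj F : natural F -> natural (fun n r => mat_adj (F n r)).
Proof.
  move=> [HF HF']; split => [n m r r'|n U r HU].
    move=> i j Hi Hj; rewrite /mat_adj HF // /dsum.
    by case: (Nat.ltb i n); case: (Nat.ltb j n) => //; C_solve.
  apply: mat_eq_trans (mat_eq_adj _ _ _ (HF' _ _ _ HU)) _.
  by rewrite /conjm !mat_adj_mul adjK mat_mulA.
Qed.
Lemma natural_id : natural (fun _ _ => mat_id).
Proof.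
  split => [n m r r'|n U r [_ HU]].
    move=> i j Hi Hj; rewrite /dsum /mat_id.
    case: (Nat.ltb_spec i n) => H; case: (Nat.ltb_spec j n) => H' //.
    - by case: (Nat.eqb_spec i j) => // E; lia.
    - by case: (Nat.eqb_spec i j) => // E; lia.
    - by case: (Nat.eqb_spec i j); case: (Nat.eqb_spec (i - n) (j - n)) => //; lia.
  apply mat_eq_sym; apply: mat_eq_trans HU.
  by apply mat_eq_mul => //; exact: mat_mul1l.
Qed.

End Natural.

Section Level.
Context {A : CStar} {nk : nat -> nat} (nk_pos : forall k, (0 < nk k)%nat).
Context (Phi : A -> nat -> Mat).

Inductive level (m : nat) : nat -> (A -> Mat) -> Prop :=
| level_base : forall k, (m <= k)%nat -> level m (nk k) (fun a => Phi a k)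
| level_dsum : forall n n' r r', level m n r -> level m n' r' ->
    level m (n + n') (fam_dsum n r r')
| level_conj : forall n U r, unitary n U -> level m n r -> level m n (fam_conj n U r).

Lemma level_pos m n r : level m n r -> (0 < n)%nat.
Proof. by elim => [k _|n1 n2 r1 r2 _ H1 _ H2|] //; lia. Qed.

Lemma level_bound m n r F c : natural F -> level m n r ->
  (forall k, (m <= k)%nat -> opnorm_le (nk k) (F (nk k) (fun a => Phi a k)) c) ->
  opnorm_le n (F n r) c.
Proof.
  move=> [HF HF'] Hl Hc; have Hc0 : 0 <= c by apply: opnorm_ge0 (nk_pos m) (Hc m (le_n _)).
  elim: Hl => [k Hk|n1 n2 r1 r2 _ H1 _ H2|n1 U r1 HU _ H1]; first exact: Hc.
    by apply: opnorm_ext (mat_eq_sym _ _ _ (HF _ _ _ _)) _; exact: opnorm_dsum.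
  by apply: opnorm_ext (mat_eq_sym _ _ _ (HF' _ _ _ HU)) _; exact: opnorm_conjm.
Qed.

(** Each defining condition is smallness of a natural expression. If it is small in all blocks of
    index at least [K], it is small in the [j]-th map for every $j\ge K$, since that map has level
    [j]. *)
Lemma level_asym_hom (d : nat -> nat) (r : nat -> A -> Mat) : asym_hom A nk Phi ->
  (forall j, level j (d j) (r j)) -> asym_hom A d (fun a j => r j a).
Proof.
  move=> [Hb [Ha [Hs [Hm [Ht H1]]]]] Hl.
  have tail F : natural F ->
      (forall e, 0 < e -> exists K, forall k, (K <= k)%nat ->
         opnorm_le (nk k) (F (nk k) (fun a => Phi a k)) e) ->
      mseq_null d (fun j => F (d j) (r j)).
    move=> HF Hn e He; have [K HK] := Hn e He; exists K => j Hj.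
    by apply: level_bound HF (Hl j) _ => k Hk; apply HK; lia.
  split; [|split; [|split; [|split; [|split]]]].
  - move=> a; have [c Hc] := Hb a; exists c => j.
    by apply: (level_bound _ _ _ (fun _ r => r a) c (natural_var a) (Hl j)).
  - move=> x y; apply (tail (fun _ r => mat_sub (r (cs_add x y)) (mat_add (r x) (r y)))).
      by apply natural_sub; [|apply natural_add]; apply natural_var.
    exact: Ha.
  - move=> c x; apply (tail (fun _ r => mat_sub (r (cs_scal c x)) (mat_scal c (r x)))).
      by apply natural_sub; [|apply natural_scal]; apply natural_var.
    exact: Hs.
  - move=> x y; apply (tail (fun n r => mat_sub (r (cs_mul x y)) (mat_mul n (r x) (r y)))).
      by apply natural_sub; [|apply natural_mul]; apply natural_var.
    exact: Hm.
  - move=> x; apply (tail (fun _ r => mat_sub (r (cs_star x)) (mat_adj (r x)))).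
      by apply natural_sub; [|apply natural_adj]; apply natural_var.
    exact: Ht.
  - apply (tail (fun _ r => mat_sub (r cs_one) mat_id)).
      by apply natural_sub; [apply natural_var|apply natural_id].
    exact: H1.
Qed.

End Level.
Arguments level {A} nk Phi m _ _.
(** * Positivity of matrix-valued forms *)

Section CsSum.
Local Open Scope cs_scope.
Context {A : CStar}.
Implicit Types F G : nat -> A.

Lemma cs_sum_ext n F G : (forall i, (i < n)%nat -> F i = G i) -> cs_sum n F = cs_sum n G.
Proof.
  elim: n => [|n IH] H //=; rewrite IH; last by move=> i Hi; apply H; lia.
  by rewrite H.
Qed.
Lemma cs_sum0 n F : (forall i, (i < n)%nat -> F i = 0) -> cs_sum n F = 0.
Proof.
  elim: n => [|n IH] H //=; rewrite IH; last by move=> i Hi; apply H; lia.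
  by rewrite H // cs_add0.
Qed.
Lemma cs_sum_add n F G : cs_sum n (fun i => F i + G i) = cs_sum n F + cs_sum n G.
Proof. elim: n => [|n IH] /=; [nc|rewrite IH; nc]. Qed.
Lemma cs_sum_mull n x F : x * cs_sum n F = cs_sum n (fun i => x * F i).
Proof. elim: n => [|n IH] /=; [nc|rewrite -IH; nc]. Qed.
Lemma cs_sum_mulr n x F : cs_sum n F * x = cs_sum n (fun i => F i * x).
Proof. elim: n => [|n IH] /=; [nc|rewrite -IH; nc]. Qed.
Lemma cs_sum_star n F : (cs_sum n F)^* = cs_sum n (fun i => (F i)^*).
Proof. by elim: n => [|n IH] /=; rewrite ?cs_star0 // cs_starD IH. Qed.
Lemma cs_sum_swap n m (F : nat -> nat -> A) :
  cs_sum n (fun i => cs_sum m (fun j => F i j)) = cs_sum m (fun j => cs_sum n (fun i => F i j)).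
Proof.
  elim: n => [|n IH] /=; first by rewrite cs_sum0.
  by rewrite IH -cs_sum_add.
Qed.
Lemma cs_sum_delta n i F : (i < n)%nat ->
  cs_sum n (fun j => if Nat.eqb i j then F j else 0) = F i.
Proof.
  elim: n => [|n IH] Hi /=; first lia.
  case: (Nat.eqb_spec i n) => [->|Hne]; last by rewrite IH ?cs_addr0 //; lia.
  rewrite cs_sum0 ?cs_add0 // => j Hj; by case: (Nat.eqb_spec n j) => // E; lia.
Qed.
End CsSum.

Lemma hom_sum {A B : CStar} (f : A -> B) (Hf : is_ustarhom A B f) n F :
  f (cs_sum n F) = cs_sum n (fun i => f (F i)).
Proof. by elim: n => [|n IH] /=; rewrite ?(hom0 _ Hf) // (homD _ Hf) IH. Qed.

Lemma st_sum {D : CStar} (f : state D) n F : f (cs_sum n F) = rsum n (fun i => f (F i)).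
Proof.
  elim: n => [|n IH] /=; last by rewrite st_add IH.
  by rewrite -(cs_scal0l cs_zero) st_scal; ring.
Qed.

Lemma pip_cs_sum {D : CStar} (f : state D) n (F : nat -> D) (y : D) :
  @pip (st_hilb f) (cs_sum n F) y = csum n (fun j => @pip (st_hilb f) (F j) y).
Proof.
  elim: n => [|n IH] /=; last by rewrite -IH /= cs_mulDr st_cD.
  by rewrite cs_mul0r -(cs_scal0l cs_zero) st_cZ; C_solve.
Qed.

Lemma rsum_swap n m f :
  rsum n (fun i => rsum m (fun j => f i j)) = rsum m (fun j => rsum n (fun i => f i j)).
Proof.
  elim: n => [|n IH] /=; first by rewrite rsum_const; ring.
  by rewrite IH -rsum_add.
Qed.
Lemma rsum_eq0 n f : (forall i, (i < n)%nat -> f i = 0) -> rsum n f = 0.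
Proof. by move=> /rsum_ext ->; rewrite rsum_const; ring. Qed.
Lemma rsum_delta n i f : (i < n)%nat ->
  rsum n (fun j => if Nat.eqb i j then f j else 0) = f i.
Proof.
  elim: n => [|n IH] Hi /=; first lia.
  case: (Nat.eqb_spec i n) => [->|Hne]; last by rewrite IH ?Rplus_0_r //; lia.
  rewrite rsum_eq0 ?Rplus_0_l // => j Hj; by case: (Nat.eqb_spec n j) => // E; lia.
Qed.
Lemma rsum_abs n f : Rabs (rsum n f) <= rsum n (fun i => Rabs (f i)).
Proof.
  elim: n => [|n IH] /=; first by rewrite Rabs_R0; lra.
  by have := Rabs_triang (rsum n f) (f n); lra.
Qed.

Lemma finite_bound n (P : nat -> R -> Prop) :
  (forall i c d, c <= d -> P i c -> P i d) -> (forall i, exists c, P i c) ->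
  exists c, 0 <= c /\ forall i, (i < n)%nat -> P i c.
Proof.
  move=> Hm HP; elim: n => [|n [c [Hc H]]]; first by exists 0; split => [|i Hi]; [lra|lia].
  have [d Hd] := HP n; exists (Rmax c d); split; first by apply: Rle_trans Hc (Rmax_l _ _).
  move=> i Hi; case: (Nat.eq_dec i n) => [->|Hne].
    by apply: Hm Hd; exact: Rmax_r.
  by apply: Hm (H i _); [exact: Rmax_l|lia].
Qed.
Lemma finite_bound2 n (P : nat -> nat -> R -> Prop) :
  (forall i j c d, c <= d -> P i j c -> P i j d) -> (forall i j, exists c, P i j c) ->
  exists c, 0 <= c /\ forall i j, (i < n)%nat -> (j < n)%nat -> P i j c.
Proof.
  move=> Hm HP.
  have [c [Hc H]] := finite_bound n (fun i c => forall j, (j < n)%nat -> P i j c)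
    ltac:(by move=> i c d Hcd H j Hj; apply: Hm Hcd (H j Hj))
    ltac:(by move=> i; have [c [_ H]] := finite_bound n (P i) (Hm i) (HP i); exists c).
  by exists c; split => // i j Hi Hj; apply H.
Qed.

Definition vsum (n : nat) (F : nat -> Vec) : Vec := fun x => csum n (fun l => F l x).

Lemma pip_vsum n r F (v : vec n) : vip n (vsum r F) v = csum r (fun l => vip n (F l) v).
Proof.
  rewrite /= csum_swap; apply csum_ext => i _.
  by rewrite Cmult_comm -csum_scal; apply csum_ext => l _; C_solve.
Qed.

(** Elements of $M_r(M_n)$ are kept as arrays of matrices acting on [r]-tuples of vectors and are
    never flattened to size $rn$. *)
Definition block_op (n r : nat) (S : nat -> nat -> Mat) (w : nat -> Vec) : nat -> Vec :=
  fun i => vsum r (fun j => mat_apply n (S i j) (w j)).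
Definition tuple_sq (n r : nat) (w : nat -> Vec) : R := rsum r (fun i => vnorm n (w i) ^ 2).
Definition block_form (n r : nat) (S : nat -> nat -> Mat) (w : nat -> Vec) : R :=
  rsum r (fun i => rsum r (fun j => Re (vip n (mat_apply n (S i j) (w j)) (w i)))).

Lemma tuple_sqE n r w : tuple_sq n r w = @psq (tuples (vec n) r) w.
Proof.
  rewrite /tuple_sq /psq; have -> : Re (@pip (tuples (vec n) r) w w)
    = rsum r (fun i => Re (vip n (w i) (w i))) by exact: csum_re.
  by apply rsum_ext => i _; rewrite vnormE pnorm_sq.
Qed.
Lemma tuple_sq_ge0 n r w : 0 <= tuple_sq n r w.
Proof. by apply rsum_ge0 => i _; exact: pow2_ge_0. Qed.
Lemma block_formE n r S w : block_form n r S w = Re (@pip (tuples (vec n) r) (block_op n r S w) w).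
Proof.
  have -> : Re (@pip (tuples (vec n) r) (block_op n r S w) w)
    = rsum r (fun i => Re (vip n (block_op n r S w i) (w i))) by exact: csum_re.
  by apply rsum_ext => i _; rewrite pip_vsum csum_re.
Qed.
Lemma block_op_sym n r S : (forall i j, (i < r)%nat -> (j < r)%nat -> S j i = mat_adj (S i j)) ->
  forall v w, @pip (tuples (vec n) r) (block_op n r S v) w = @pip (tuples (vec n) r) v (block_op n r S w).
Proof.
  move=> H v w.
  transitivity (csum r (fun i => csum r (fun j => vip n (mat_apply n (S i j) (v j)) (w i)))).
    by apply csum_ext => i _; exact: pip_vsum.
  rewrite csum_swap; apply csum_ext => j Hj.
  rewrite (pip_conj (vec n) (block_op n r S w j)) pip_vsum -csum_conj; apply csum_ext => i Hi.
  by rewrite -pip_conj (H i j) // pip_adj.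
Qed.

Lemma re_pip_le n (u v : Vec) : Rabs (Re (vip n u v)) <= vnorm n u * vnorm n v.
Proof.
  rewrite !vnormE; apply Rabs_le; split; last exact: pip_re_le.
  have := @pip_re_le (vec n) (@pscal (vec n) (RtoC (-1)) u) v.
  rewrite (pipZ (vec n)) pnorm_scal Cmod_R Rabs_Ropp Rabs_R1 Rmult_1_l.
  by case: (vip n u v) => a b; rewrite /=; lra.
Qed.

Lemma block_form_bound n r S c w : 0 <= c ->
  (forall i j, (i < r)%nat -> (j < r)%nat -> opnorm_le n (S i j) c) ->
  Rabs (block_form n r S w) <= c * INR r * tuple_sq n r w.
Proof.
  move=> Hc H; apply: Rle_trans (rsum_abs _ _) _.
  apply Rle_trans with (rsum r (fun i => rsum r (fun j => c * (vnorm n (w i) ^ 2 + vnorm n (w j) ^ 2) / 2))).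
    apply rsum_le => i Hi; apply: Rle_trans (rsum_abs _ _) _; apply rsum_le => j Hj.
    apply: Rle_trans (re_pip_le _ _ _) _.
    have := H i j Hi Hj (w j); have := vnorm_ge0 n (w i); have := vnorm_ge0 n (w j).
    move: (vnorm n (mat_apply n (S i j) (w j))) (vnorm n (w i)) (vnorm n (w j)) => a b d Hd Hb Ha.
    have : a * b <= (c * d) * b by apply Rmult_le_compat_r.
    have := Rmult_le_pos _ _ Hc (pow2_ge_0 (b - d)); lra.
  apply Req_le.
  transitivity (rsum r (fun i => c * INR r / 2 * vnorm n (w i) ^ 2 + c / 2 * tuple_sq n r w)).
    apply rsum_ext => i _.
    transitivity (rsum r (fun j => c * vnorm n (w i) ^ 2 / 2 + c / 2 * vnorm n (w j) ^ 2)).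
      by apply rsum_ext => j _; field.
    by rewrite rsum_add rsum_const rsum_scal /tuple_sq; field.
  by rewrite rsum_add rsum_scal rsum_const -/(tuple_sq n r w); field.
Qed.

Lemma block_form_add n r S T w : block_form n r (fun i j => mat_add (S i j) (T i j)) w
  = block_form n r S w + block_form n r T w.
Proof.
  rewrite /block_form -rsum_add; apply rsum_ext => i _; rewrite -rsum_add; apply rsum_ext => j _.
  by rewrite apply_add (pipD (vec n)).
Qed.
Lemma block_form_scal n r (a : R) S w : block_form n r (fun i j => mat_scal (RtoC a) (S i j)) w
  = a * block_form n r S w.
Proof.
  rewrite /block_form -rsum_scal; apply rsum_ext => i _; rewrite -rsum_scal; apply rsum_ext => j _.
  rewrite apply_scal (pipZ (vec n)).
  by move: (vip n (mat_apply n (S i j) (w j)) (w i)) => [x y]; rewrite /=; ring.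
Qed.
Lemma block_form_adj n r S w : block_form n r (fun i j => mat_adj (S j i)) w = block_form n r S w.
Proof.
  rewrite {1}/block_form rsum_swap; apply rsum_ext => i Hi; apply rsum_ext => j Hj.
  by rewrite -(adjK (S i j)) pip_adj adjK pip_conj.
Qed.
Lemma block_form_diag n r w :
  block_form n r (fun i j => if Nat.eqb i j then mat_id else fun _ _ => RtoC 0) w = tuple_sq n r w.
Proof.
  apply rsum_ext => i Hi.
  rewrite -(rsum_delta r i (fun j => vnorm n (w j) ^ 2)) //; apply rsum_ext => j Hj.
  case: (Nat.eqb_spec i j) => [->|_].
    rewrite vnormE pnorm_sq /psq; congr Re; apply pip_vec_ext => // x Hx; exact: apply_id.
  have -> : vip n (mat_apply n (fun _ _ => RtoC 0) (w j)) (w i) = RtoC 0; last by [].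
  apply csum_eq0 => x _; rewrite /mat_apply csum_eq0; first C_solve.
  by move=> y _; C_solve.
Qed.
Lemma block_form_close n r S T e w : 0 <= e ->
  (forall i j, (i < r)%nat -> (j < r)%nat -> opnorm_le n (mat_sub (S i j) (T i j)) e) ->
  Rabs (block_form n r S w - block_form n r T w) <= e * INR r * tuple_sq n r w.
Proof.
  move=> He H; have := block_form_bound n r (fun i j => mat_sub (S i j) (T i j)) e w He H.
  have -> : block_form n r (fun i j => mat_sub (S i j) (T i j)) w
    = block_form n r S w + (-1) * block_form n r T w; last by have -> : forall a b, a + (-1) * b = a - b by move=> a b; ring.
  rewrite -block_form_scal -block_form_add /block_form; apply rsum_ext => i _; apply rsum_ext => j _.
  by rewrite mat_subE.
Qed.

(** * Powers of block matrices, over matrices and over an algebra *)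

Section BlockPowers.
Context (n r : nat) (S : nat -> nat -> Mat).

Fixpoint block_pow (p : nat) (i j : nat) : Mat :=
  match p with
  | O => if Nat.eqb i j then mat_id else fun _ _ => RtoC 0
  | Datatypes.S p => msum r (fun l => mat_mul n (S i l) (block_pow p l j))
  end.

Lemma apply_msum m F v : mat_apply n (msum m F) v = vsum m (fun l => mat_apply n (F l) v).
Proof.
  apply functional_extensionality => i; rewrite /vsum /mat_apply csum_swap.
  apply csum_ext => j _; rewrite Cmult_comm -csum_scal; apply csum_ext => l _; C_solve.
Qed.

(** Applying column [j] of the power to [v] amounts to iterating the contraction on the tuple with
    [v] in place [j] and zeros elsewhere. *)
Lemma opnorm_block_pow p i j : (i < r)%nat -> (j < r)%nat ->
  (forall w, tuple_sq n r (block_op n r S w) <= tuple_sq n r w) -> opnorm_le n (block_pow p i j) 1.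
Proof.
  move=> Hi Hj Hc v; pose w q (l : nat) := mat_apply n (block_pow q l j) v.
  have Hw q : tuple_sq n r (w q) <= vnorm n v ^ 2.
    elim: q => [|q IH].
      rewrite /tuple_sq -(rsum_delta r j (fun _ => vnorm n v ^ 2)) //; apply rsum_le => l Hl.
      rewrite /w /= (Nat.eqb_sym l j); case: (Nat.eqb j l).
        by rewrite (vnorm_ext n _ v) => [|x Hx]; [lra|exact: apply_id].
      have := opnorm_zero n 0 (Rle_refl _) v; rewrite Rmult_0_l.
      have := vnorm_ge0 n (mat_apply n (fun _ _ => RtoC 0) v); nra.
    apply: Rle_trans IH; apply: Rle_trans (Hc (w q)); apply Req_le.
    apply rsum_ext => l _; congr (vnorm n _ ^ 2); rewrite /w /= apply_msum.
    by congr vsum; apply functional_extensionality => x; rewrite apply_mul.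
  rewrite Rmult_1_l; apply le_of_sq_le; first exact: vnorm_ge0.
  have := Hw p; have := rsum_term r (fun l => vnorm n (w p l) ^ 2) i
    ltac:(by move=> l _; exact: pow2_ge_0) Hi.
  rewrite /tuple_sq /w; lra.
Qed.

End BlockPowers.

Section CsPowers.
Local Open Scope cs_scope.
Context {A : CStar} (r : nat) (Z : nat -> nat -> A).

Fixpoint cpow (p : nat) (i j : nat) : A :=
  match p with
  | O => if Nat.eqb i j then 1 else 0
  | Datatypes.S p => cs_sum r (fun l => Z i l * cpow p l j)
  end.

Context {D : CStar} (s : A -> D) (Hs : is_ustarhom A D s).

Definition cop (q : nat -> D) : nat -> D := fun i => cs_sum r (fun j => s (Z i j) * q j).

Lemma cop_iter p q i : (i < r)%nat ->
  Nat.iter p cop q i = cs_sum r (fun j => s (cpow p i j) * q j).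
Proof.
  elim: p i => [|p IH] i Hi.
    rewrite /= -(cs_sum_delta r i q) //; apply cs_sum_ext => j _.
    by case: (Nat.eqb i j); rewrite ?(hom1 _ Hs) ?(hom0 _ Hs) ?cs_mul1l ?cs_mul0l.
  change (Nat.iter (Datatypes.S p) cop q i)
    with (cs_sum r (fun l => s (Z i l) * Nat.iter p cop q l)).
  transitivity (cs_sum r (fun l => cs_sum r (fun j => s (Z i l) * (s (cpow p l j) * q j)))).
    by apply cs_sum_ext => l Hl; rewrite IH // cs_sum_mull.
  rewrite cs_sum_swap; apply cs_sum_ext => j _ /=.
  rewrite (hom_sum s Hs) cs_sum_mulr; apply cs_sum_ext => l _.
  by rewrite (homM _ Hs) cs_mulA.
Qed.

End CsPowers.

Section FormNonneg.
Context {A D : CStar} (s : A -> D) (Hs : is_ustarhom A D s) (f : state D).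
Context {nk : nat -> nat} (nk_pos : forall k, (0 < nk k)%nat).
Context {Phi : A -> nat -> Mat} (HPhi : asym_hom A nk Phi).
Hypothesis Phi_inj : forall x y, seqv nk (Phi x) (Phi y) -> x = y.

Definition cform (r : nat) (X : nat -> nat -> A) (q : nat -> D) : R :=
  rsum r (fun i => rsum r (fun j =>
    f (cs_mul (cs_star (q i)) (cs_mul (s (X i j)) (q j))))).

(** Otherwise the moments of the contraction [Z = (t - Re X)/(t + eps)] at [q]
    would be unbounded, whereas the entries of the powers of [Z] have norm at
    most [1], as they do in every late enough block representation. *)
Lemma form_nonneg r (X : nat -> nat -> A) :
  (forall eps, 0 < eps -> exists K, forall k, (K <= k)%nat -> forall w,
     - eps * tuple_sq (nk k) r w <= block_form (nk k) r (fun i j => Phi (X i j) k) w) ->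
  forall q, 0 <= cform r X q.
Proof.
  move=> HX q; set N := @psq (tuples (st_hilb f) r) q.
  have HN : 0 <= N := pip_pos (tuples (st_hilb f) r) q.
  have [c [Hc Hcb]] : exists c, 0 <= c /\ forall i j, (i < r)%nat -> (j < r)%nat ->
      forall k, opnorm_le (nk k) (Phi (X i j) k) c.
    apply (finite_bound2 r (fun i j c => forall k, opnorm_le (nk k) (Phi (X i j) k) c)).
      by move=> i j c d Hcd H k; apply: opnorm_mono Hcd (H k).
    by move=> i j; apply HPhi.
  (* [c * INR r] bounds the block forms at every [k], so $t-X$ is nonnegative in all of them; the 1
     keeps [t] positive. *)
  set t := c * INR r + 1.
  have Ht : 0 < t by have := pos_INR r; rewrite /t; nra.
  have Hup k w : block_form (nk k) r (fun i j => Phi (X i j) k) w <= t * tuple_sq (nk k) r w.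
    have := block_form_bound (nk k) r (fun i j => Phi (X i j) k) c w Hc
      ltac:(by move=> i j Hi Hj; apply Hcb).
    have := Rle_abs (block_form (nk k) r (fun i j => Phi (X i j) k) w).
    have := tuple_sq_ge0 (nk k) r w; rewrite /t; lra.
  suff Heps eps : 0 < eps -> - eps * N <= cform r X q.
    apply Rnot_lt_le => Hlt.
    have H1 : 0 < - cform r X q / (N + 1) by apply Rdiv_lt_0_compat; lra.
    have := Heps _ H1.
    have : - cform r X q / (N + 1) * (N + 1) = - cform r X q by field; lra.
    nra.
  move=> He; have [K HK] := HX eps He.
  set u := / (t + eps); have Hu : 0 < u by apply Rinv_0_lt_compat; lra.
  have Hut : u * (t + eps) = 1 by apply Rinv_l; lra.
  (* Since [X] need not be hermitian, its hermitian part is used, which has the same real quadratic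
     form. Division by $t+\varepsilon$ makes the late blocks contractions, the forms of [X] there
     being at least $-\varepsilon$. *)
  pose Z i j : A := cs_scal (RtoC u) (cs_add
    (cs_scal (RtoC t) (if Nat.eqb i j then cs_one else cs_zero))
    (cs_scal (RtoC (-1/2)) (cs_add (X i j) (cs_star (X j i))))).
  pose S k i j : Mat := mat_scal (RtoC u) (mat_add
    (mat_scal (RtoC t) (if Nat.eqb i j then mat_id else fun _ _ => RtoC 0))
    (mat_scal (RtoC (-1/2)) (mat_add (Phi (X i j) k) (mat_adj (Phi (X j i) k))))).
  have HSZ i j : represents (nk := nk) (Phi := Phi) (Z i j) (fun k => S k i j).
    apply (represents_scal HPhi), (represents_add HPhi); apply (represents_scal HPhi).
      by case: (Nat.eqb i j); [exact: represents_one|exact: represents_zero].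
    apply (represents_add HPhi); first exact: represents_self.
    by apply represents_star => //; exact: represents_self.
  have HSsym k i j : S k j i = mat_adj (S k i j).
    rewrite /S Nat.eqb_sym; case: (Nat.eqb_spec i j) => [->|_]; last by mat_ring.
    rewrite -{1}mat_adj_id; mat_ring.
  have HSform k w : block_form (nk k) r (S k) w
      = u * (t * tuple_sq (nk k) r w - block_form (nk k) r (fun i j => Phi (X i j) k) w).
    rewrite /S block_form_scal block_form_add !block_form_scal block_form_diag block_form_add.
    by rewrite (block_form_adj (nk k) r (fun i j => Phi (X i j) k)); field.
  have HScontr k : (K <= k)%nat -> forall w, tuple_sq (nk k) r (block_op (nk k) r (S k) w) <= tuple_sq (nk k) r w.
    move=> Hk w; rewrite !tuple_sqE.
    apply (@positive_contraction (tuples (vec (nk k)) r)) => [|v|v].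
    - by apply block_op_sym => i j _ _; exact: HSsym.
    - rewrite -block_formE HSform; apply Rmult_le_pos; first lra.
      by have := Hup k v; lra.
    - rewrite -block_formE -tuple_sqE HSform; have := HK k Hk v; have := tuple_sq_ge0 (nk k) r v => H0 H1.
      have : u * (t * tuple_sq (nk k) r v - block_form (nk k) r (fun i j => Phi (X i j) k) v)
        <= u * ((t + eps) * tuple_sq (nk k) r v) by apply Rmult_le_compat_l; lra.
      by rewrite -Rmult_assoc Hut; lra.
  have Hrep p i j : (i < r)%nat -> (j < r)%nat ->
      represents (nk := nk) (Phi := Phi) (cpow r Z p i j) (fun k => block_pow (nk k) r (S k) p i j).
    elim: p i j => [|p IH] i j Hi Hj.
      by rewrite /=; case: (Nat.eqb i j); [apply represents_one|apply represents_zero].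
    apply (represents_sum HPhi r) => l Hl.
    by apply (represents_mul nk_pos HPhi) => //; exact: IH.
  have Hpow p i j : (i < r)%nat -> (j < r)%nat -> cs_norm (cpow r Z p i j) <= 1.
    move=> Hi Hj; rewrite -(asym_hom_isometric nk_pos Phi HPhi Phi_inj).
    have [_ Hr] := Hrep p i j Hi Hj.
    apply snorm_small => // e He'; apply: tail_le_seqv (He') (seqv_sym _ _ _ Hr) _.
    by exists K => k Hk; apply opnorm_block_pow => //; exact: HScontr.
  pose T : tuples (st_hilb f) r -> tuples (st_hilb f) r := cop r Z s.
  have HZsym i j : cs_star (Z i j) = Z j i.
    rewrite /Z !cs_starZR cs_starD !cs_starZR cs_starD cs_starK Nat.eqb_sym.
    by case: (Nat.eqb j i); rewrite ?cs_star1 ?cs_star0; nc.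
  have HTsym x y : pip (T x) y = pip x (T y).
    transitivity (csum r (fun i => csum r (fun j => @pip (st_hilb f) (cs_mul (s (Z i j)) (x j)) (y i)))).
      by apply csum_ext => i _; exact: pip_cs_sum.
    rewrite csum_swap; apply csum_ext => j Hj.
    rewrite (pip_conj (st_hilb f) (T y j)) pip_cs_sum -csum_conj; apply csum_ext => i Hi.
    rewrite -pip_conj /= -(HZsym i j) (hom_star _ Hs) cs_starM cs_starK; congr st_c.
    by rewrite !cs_mulA.
  have HT p x : Re (pip (Nat.iter p T x) x) = rsum r (fun i => rsum r (fun j =>
      f (cs_mul (cs_star (x i)) (cs_mul (s (cpow r Z p i j)) (x j))))).
    transitivity (rsum r (fun i => Re (@pip (st_hilb f) (Nat.iter p T x i) (x i)))).
      exact: csum_re.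
    apply rsum_ext => i Hi; rewrite /T cop_iter // pip_cs_sum csum_re.
    by apply rsum_ext => j _.
  have Hmom : Re (pip (T q) q) <= N.
    apply Rnot_lt_le => Hlt.
    set B := rsum r (fun i => rsum r (fun j => cs_norm (q i) * cs_norm (q j))).
    have [p Hp] := moments_unbounded T HTsym q B Hlt.
    suff : Re (pip (Nat.iter p T q) q) <= B by lra.
    rewrite HT; apply rsum_le => i Hi; apply rsum_le => j Hj.
    apply: Rle_trans (st_norm _ f _) _; apply: Rle_trans (cs_normM _ _ _) _.
    rewrite cs_norm_star; apply Rmult_le_compat_l; first exact: cs_norm_ge0.
    apply: Rle_trans (cs_normM _ _ _) _.
    have := Rle_trans _ _ _ (hom_contractive s Hs (cpow r Z p i j)) (Hpow p i j Hi Hj).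
    have := cs_norm_ge0 (q j); nra.
  (* Together with [Hmom] this reads $tN-c\le(t+\varepsilon)N$, where $c$ is the form at [q], and
     hence $c\ge-\varepsilon N$. *)
  have : Re (pip (T q) q) = u * (t * N - cform r X q).
    rewrite (HT 1%nat).
    transitivity (rsum r (fun i => rsum r (fun j => u * t *
        (if Nat.eqb i j then f (cs_mul (cs_star (q i)) (q j)) else 0)
      + u * (-1/2) * f (cs_mul (cs_star (q i)) (cs_mul (s (X i j)) (q j)))
      + u * (-1/2) * f (cs_mul (cs_star (q j)) (cs_mul (s (X j i)) (q i)))))).
      apply rsum_ext => i Hi; apply rsum_ext => j Hj.
      have -> : cpow r Z 1 i j = Z i j.
        rewrite /= -(cs_sum_delta r j (fun l => Z i l)) //; apply cs_sum_ext => l _.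
        by rewrite Nat.eqb_sym; case: (Nat.eqb j l); rewrite ?cs_mul1r ?cs_mul0r.
      rewrite -(st_star _ f (cs_mul (cs_star (q j)) _)) !cs_starM cs_starK -(hom_star _ Hs).
      rewrite -!st_scal.
      have -> : u * t * (if Nat.eqb i j then f (cs_mul (cs_star (q i)) (q j)) else 0)
        = f (cs_scal (RtoC (u * t)) (cs_mul (cs_star (q i))
             (cs_mul (s (if Nat.eqb i j then cs_one else cs_zero)) (q j)))).
        rewrite st_scal; case: (Nat.eqb i j).
          by rewrite (hom1 _ Hs) cs_mul1l.
        rewrite (hom0 _ Hs) cs_mul0l cs_mul0r; congr Rmult.
        by rewrite -(cs_scal0l cs_zero) st_scal; ring.
      rewrite -!st_add; congr (st _ f _).
      rewrite /Z (homZ _ Hs) (homD _ Hs) !(homZ _ Hs) (homD _ Hs); nc.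
    pose a i j := f (cs_mul (cs_star (q i)) (cs_mul (s (X i j)) (q j))).
    have Ea : rsum r (fun i => rsum r (fun j => a j i)) = cform r X q by rewrite rsum_swap.
    transitivity (rsum r (fun i => u * t * f (cs_mul (cs_star (q i)) (q i))
      + u * (-1/2) * rsum r (fun j => a i j) + u * (-1/2) * rsum r (fun j => a j i))).
      apply rsum_ext => i Hi; rewrite !rsum_add !rsum_scal.
      by rewrite (rsum_delta r i (fun j => f (cs_mul (cs_star (q i)) (q j)))).
    rewrite !rsum_add !rsum_scal Ea -/(cform r X q).
    have -> : rsum r (fun i => f (cs_mul (cs_star (q i)) (q i))) = N.
      by symmetry; exact: csum_re.
    field.
  move=> E; rewrite E in Hmom.
  have := Rmult_le_compat_l (t + eps) _ _ ltac:(lra) Hmom.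
  have -> : (t + eps) * (u * (t * N - cform r X q)) = (u * (t + eps)) * (t * N - cform r X q) by ring.
  rewrite Hut; lra.
Qed.

End FormNonneg.
(** * Approximating Gram matrices *)

Lemma csum_if n i (f : nat -> C) : (i < n)%nat ->
  csum n (fun j => if Nat.eqb i j then f j else RtoC 0) = f i.
Proof.
  move=> Hi; rewrite -(csum_delta n i f) //; apply csum_ext => j _.
  by case: (Nat.eqb i j); C_solve.
Qed.

Lemma block_form_msum n r p (F : nat -> nat -> nat -> Mat) w :
  block_form n r (fun i j => msum p (fun t => F t i j)) w = rsum p (fun t => block_form n r (F t) w).
Proof.
  rewrite /block_form rsum_swap.
  transitivity (rsum r (fun j => rsum p (fun t => rsum r (fun i =>
    Re (vip n (mat_apply n (F t i j) (w j)) (w i)))))).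
    apply rsum_ext => j _; rewrite rsum_swap; apply rsum_ext => i _.
    by rewrite apply_msum pip_vsum csum_re.
  by rewrite rsum_swap; apply rsum_ext => t _; rewrite rsum_swap.
Qed.
Lemma block_form_square n r (B : nat -> Mat) w :
  block_form n r (fun k l => mat_mul n (mat_adj (B k)) (B l)) w
  = vnorm n (vsum r (fun l => mat_apply n (B l) (w l))) ^ 2.
Proof.
  rewrite vnormE pnorm_sq /psq pip_vsum csum_re /block_form rsum_swap; apply rsum_ext => l _.
  rewrite (pip_conj (vec n) (vsum _ _)) pip_vsum -csum_conj csum_re; apply rsum_ext => k _.
  by rewrite apply_mul pip_adj adjK -pip_conj.
Qed.

Section Gram.
Context {A D : CStar} (s : A -> D) (Hs : is_ustarhom A D s) (f : state D).
Context {nk : nat -> nat} (nk_pos : forall k, (0 < nk k)%nat).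
Context {Phi : A -> nat -> Mat} (HPhi : asym_hom A nk Phi).
Hypothesis Phi_inj : forall x y, seqv nk (Phi x) (Phi y) -> x = y.

Context (r : nat) (q : nat -> D) (p : nat) (ta : nat -> A) (ti tj : nat -> nat).
Hypothesis ti_lt : forall t, (t < p)%nat -> (ti t < r)%nat.
Hypothesis tj_lt : forall t, (t < p)%nat -> (tj t < r)%nat.
Hypothesis trel : forall t, (t < p)%nat -> cs_mul (s (ta t)) (q (ti t)) = q (tj t).

Definition gram (i j : nat) : C := @pip (st_hilb f) (q i) (q j).
(** All relations are collected in one number that is quadratic in [w], so that it adds under direct
    sums and scales exactly as Gram matrices do. *)
Definition defect (n : nat) (rho : A -> Mat) (w : nat -> Vec) : R := rsum p (fun t =>
  vnorm n (vsub (mat_apply n (rho (ta t)) (w (ti t))) (w (tj t))) ^ 2).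

(** Regarded as a real vector space. Entries outside the $r\times r$ corner are present but
    invisible to [dnorm], which is therefore only a seminorm. *)
Definition data : Type := ((nat -> nat -> C) * R)%type.
Definition dadd (x y : data) : data := (fun i j => Cplus (fst x i j) (fst y i j), snd x + snd y).
Definition dscal (a : R) (x : data) : data := (fun i j => Cmult (RtoC a) (fst x i j), a * snd x).
Definition dzero : data := (fun _ _ => RtoC 0, 0).
Definition dnorm (x : data) : R :=
  rsum r (fun i => rsum r (fun j => Cmod (fst x i j))) + Rabs (snd x).
Definition datum (n : nat) (rho : A -> Mat) (w : nat -> Vec) : data :=
  (fun i j => vip n (w i) (w j), defect n rho w).
(** Already a convex cone without taking hulls: direct sums add data, and multiplying the vectors by
    $\sqrt a$ scales data by [a]. *)
Definition cone (m : nat) (x : data) : Prop :=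
  exists n rho w, level nk Phi m n rho /\ x = datum n rho w.

Lemma data_ext (x y : data) : (forall i j, fst x i j = fst y i j) -> snd x = snd y -> x = y.
Proof.
  case: x => G a; case: y => G' a' /= H ->; congr pair.
  by apply mat_ext => i j.
Qed.
Lemma dnorm_add x y : dnorm (dadd x y) <= dnorm x + dnorm y.
Proof.
  rewrite /dnorm /dadd /=.
  have := Rabs_triang (snd x) (snd y).
  suff : rsum r (fun i => rsum r (fun j => Cmod (Cplus (fst x i j) (fst y i j))))
    <= rsum r (fun i => rsum r (fun j => Cmod (fst x i j)))
     + rsum r (fun i => rsum r (fun j => Cmod (fst y i j))) by lra.
  rewrite -rsum_add; apply rsum_le => i _; rewrite -rsum_add; apply rsum_le => j _.
  exact: Cmod_triangle.
Qed.
Lemma dnorm_scal a x : dnorm (dscal a x) = Rabs a * dnorm x.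
Proof.
  rewrite /dnorm /dscal /= Rabs_mult Rmult_plus_distr_l; congr Rplus.
  rewrite -rsum_scal; apply rsum_ext => i _; rewrite -rsum_scal; apply rsum_ext => j _.
  by rewrite Cmod_mult Cmod_R.
Qed.
Lemma dnorm_ge0 x : 0 <= dnorm x.
Proof.
  have := Rabs_pos (snd x); rewrite /dnorm.
  suff : 0 <= rsum r (fun i => rsum r (fun j => Cmod (fst x i j))) by lra.
  by do 2 (apply rsum_ge0 => ? _); exact: Cmod_ge_0.
Qed.
Lemma dnorm0 x : (forall i j, (i < r)%nat -> (j < r)%nat -> fst x i j = RtoC 0) ->
  snd x = 0 -> dnorm x = 0.
Proof.
  move=> H H0; rewrite /dnorm H0 Rabs_R0 rsum_eq0; first ring.
  move=> i Hi; apply rsum_eq0 => j Hj; by rewrite H // Cmod_0.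
Qed.

Lemma datum_dsum n n' rho rho' w w' :
  datum (n + n') (fam_dsum n rho rho') (fun i => vcat n (w i) (w' i))
  = dadd (datum n rho w) (datum n' rho' w').
Proof.
  apply data_ext => [i j|]; first exact: pip_vcat.
  rewrite /= /defect -rsum_add; apply rsum_ext => t _.
  rewrite -vnorm_vcat; congr (_ ^ 2); apply vnorm_ext => x _.
  rewrite /vsub /vadd /vscal /fam_dsum apply_dsum /vcat.
  by case: (Nat.ltb x n).
Qed.
Lemma cone_add m x y : cone m x -> cone m y -> cone m (dadd x y).
Proof.
  move=> [n [rho [w [H ->]]]] [n' [rho' [w' [H' ->]]]].
  exists (n + n')%nat, (fam_dsum n rho rho'), (fun i => vcat n (w i) (w' i)).
  by split; [exact: level_dsum|rewrite datum_dsum].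
Qed.
Lemma cone_scal m a x : 0 <= a -> cone m x -> cone m (dscal a x).
Proof.
  move=> Ha [n [rho [w [H ->]]]]; have Hs2 := sqrt_sqrt a Ha.
  exists n, rho, (fun i => vscal (RtoC (sqrt a)) (w i)); split => //.
  apply data_ext => [i j|] /=.
    rewrite -csum_scal; apply csum_ext => x' _; rewrite /vscal -{1}Hs2; C_solve.
  rewrite /defect -rsum_scal; apply rsum_ext => t _.
  have -> : vsub (mat_apply n (rho (ta t)) (vscal (RtoC (sqrt a)) (w (ti t))))
      (vscal (RtoC (sqrt a)) (w (tj t)))
    = vscal (RtoC (sqrt a)) (vsub (mat_apply n (rho (ta t)) (w (ti t))) (w (tj t))).
    rewrite apply_vscal; apply functional_extensionality => y.
    by rewrite /vsub /vadd /vscal; C_solve.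
  rewrite vnorm_scal Cmod_R Rabs_pos_eq; last exact: sqrt_pos.
  by rewrite Rpow_mult_distr pow2_sqrt.
Qed.
Lemma cone_base m k w : (m <= k)%nat -> cone m (datum (nk k) (fun a => Phi a k) w).
Proof. by move=> H; exists (nk k), (fun a => Phi a k), w; split => //; exact: level_base. Qed.
Lemma cone_zero m : cone m dzero.
Proof.
  have := cone_scal m 0 _ (Rle_refl _) (cone_base m m (fun _ _ => RtoC 0) (le_n _)).
  have -> : dscal 0 (datum (nk m) (fun a => Phi a m) (fun _ _ => RtoC 0)) = dzero => //.
  by apply data_ext => [i j|] /=; [C_solve|ring].
Qed.

(** The distance from $-x$ to the cone. With this sign a linear functional below [cdist] is
    nonnegative on the cone. *)
Definition cdist (m : nat) (x : data) : R :=
  Inf (fun d => exists y, cone m y /\ d = dnorm (dadd x y)).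

Lemma cdist_le m x y : cone m y -> cdist m x <= dnorm (dadd x y).
Proof.
  move=> Hy; apply (Inf_le _ 0); last by exists y.
  by move=> d [z [_ ->]]; exact: dnorm_ge0.
Qed.
Lemma cdist_ge m x b : (forall y, cone m y -> b <= dnorm (dadd x y)) -> b <= cdist m x.
Proof.
  move=> H; apply: Inf_ge; first by exists dzero; split => //; exact: cone_zero.
  by move=> d [y [Hy ->]]; exact: H.
Qed.
Lemma cdist_sublinear m : sublinear dadd dscal (cdist m).
Proof.
  apply Inf_sublinear => [x|x y _ _ [u [Hu ->]] [v [Hv ->]]|a x _ Ha [u [Hu ->]]].
  - exists 0, (dnorm (dadd x dzero)); split; first by exists dzero; split => //; exact: cone_zero.
    by move=> d [z [_ ->]]; exact: dnorm_ge0.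
  - eexists; split; first by exists (dadd u v); split; [exact: cone_add|].
    have -> : dadd (dadd x y) (dadd u v) = dadd (dadd x u) (dadd y v).
      by apply data_ext => [i j|] /=; [C_solve|ring].
    exact: dnorm_add.
  - eexists; split; first by exists (dscal a u); split; [apply cone_scal; [lra|]|].
    have -> : dadd (dscal a x) (dscal a u) = dscal a (dadd x u).
      by apply data_ext => [i j|] /=; [C_solve|ring].
    rewrite dnorm_scal Rabs_pos_eq; lra.
Qed.

Fixpoint dsumn (n : nat) (F : nat -> data) : data :=
  match n with O => dzero | S n => dadd (dsumn n F) (F n) end.
Lemma dsumn_fst n F i j : fst (dsumn n F) i j = csum n (fun l => fst (F l) i j).
Proof. by elim: n => [|n IH] //=; rewrite IH. Qed.
Lemma dsumn_snd n F : snd (dsumn n F) = rsum n (fun l => snd (F l)).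
Proof. by elim: n => [|n IH] //=; rewrite IH. Qed.

(** Expansion in matrix units. A functional dominated by [dnorm] vanishes on data with zero corner
    and zero defect, so only finitely many coefficients matter. *)
Lemma linear_coefficients (L : data -> R) :
  (forall x y, L (dadd x y) = L x + L y) -> (forall a x, L (dscal a x) = a * L x) ->
  (forall x, L x <= dnorm x) ->
  exists (c : nat -> nat -> C) (mu : R), forall x,
    L x = rsum r (fun i => rsum r (fun j => Re (Cmult (c i j) (fst x i j)))) + mu * snd x.
Proof.
  move=> LD LZ Ln.
  have L0 x : dnorm x = 0 -> L x = 0.
    move=> Hx; have := Ln x; have := Ln (dscal (-1) x).
    by rewrite LZ dnorm_scal Hx; lra.
  have Lsum n F : L (dsumn n F) = rsum n (fun l => L (F l)).
    elim: n => [|n IH] /=; last by rewrite LD IH.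
    by apply L0, dnorm0.
  pose e i j z : data := (fun i' j' => if Nat.eqb i' i then if Nat.eqb j' j then z else RtoC 0
                                       else RtoC 0, 0).
  have Le i j z : L (e i j z) = Re z * L (e i j (RtoC 1)) + Im z * L (e i j Ci).
    rewrite -!LZ -LD; congr L; apply data_ext => [i' j'|] /=; last ring.
    by case: z => a b; case: (Nat.eqb i' i); case: (Nat.eqb j' j); C_solve.
  exists (fun i j => (L (e i j (RtoC 1)), - L (e i j Ci))), (L (fun _ _ => RtoC 0, 1)) => x.
  set y := dadd (dsumn r (fun i => dsumn r (fun j => e i j (fst x i j))))
    (dscal (snd x) (fun _ _ => RtoC 0, 1)).
  have -> : L x = L y.
    have : L (dadd x (dscal (-1) y)) = 0.
      apply L0, dnorm0 => [i j Hi Hj|].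
        have E : fst y i j = fst x i j.
          rewrite /y /= dsumn_fst.
          have -> : csum r (fun l => fst (dsumn r (fun j0 => e l j0 (fst x l j0))) i j) = fst x i j.
            rewrite -(csum_if r i (fun l => fst x l j)) //; apply csum_ext => l _.
            rewrite dsumn_fst /=; case: (Nat.eqb i l); last exact: csum0.
            exact: csum_if.
          C_solve.
        change (Cplus (fst x i j) (Cmult (RtoC (-1)) (fst y i j)) = RtoC 0).
        by rewrite E; C_solve.
      rewrite /= dsumn_snd rsum_eq0; first ring.
      by move=> i _; rewrite dsumn_snd rsum_eq0.
    rewrite LD LZ; lra.
  rewrite /y LD LZ Lsum Rmult_comm; congr Rplus; apply rsum_ext => i _.
  rewrite Lsum; apply rsum_ext => j _; rewrite Le.
  by case: (fst x i j) => a b; rewrite /=; ring.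
Qed.

(** * The matrix over [A] attached to a separating functional *)

Section Separation.
Context (c : nat -> nat -> C) (mu : R).
Let L (x : data) : R :=
  rsum r (fun i => rsum r (fun j => Re (Cmult (c i j) (fst x i j)))) + mu * snd x.

(** Relation [t] as a row over [A]: applied to the tuple [q] it gives $a_tq_{i_t}-q_{j_t}$. The two
    terms are added separately because both indices may coincide. *)
Let tv (t k : nat) : A := cs_add (if Nat.eqb (ti t) k then ta t else cs_zero)
  (cs_scal (RtoC (-1)) (if Nat.eqb (tj t) k then cs_one else cs_zero)).
(** The coefficients appear transposed because the entry $(k,l)$ contributes $\langle
    X_{kl}q_l,q_k\rangle$. [Y] below is the same expression formed from matrices, where its block
    form is exactly [L] of the datum. *)
Let X (k l : nat) : A := cs_add (cs_scal (c l k) cs_one)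
  (cs_scal (RtoC mu) (cs_sum p (fun t => cs_mul (cs_star (tv t k)) (tv t l)))).
Let tvm (h t k : nat) : Mat := mat_add (if Nat.eqb (ti t) k then Phi (ta t) h else szero h)
  (mat_scal (RtoC (-1)) (if Nat.eqb (tj t) k then mat_id else szero h)).
Let Y (h k l : nat) : Mat := mat_add (mat_scal (c l k) mat_id)
  (mat_scal (RtoC mu) (msum p (fun t => mat_mul (nk h) (mat_adj (tvm h t k)) (tvm h t l)))).

Lemma functional_represents k l : represents (nk := nk) (Phi := Phi) (X k l) (fun h => Y h k l).
Proof.
  apply (represents_add HPhi); apply (represents_scal HPhi); first exact: represents_one.
  apply (represents_sum HPhi p) => t _.
  have Htv k' : represents (nk := nk) (Phi := Phi) (tv t k') (fun h => tvm h t k').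
    apply (represents_add HPhi); last apply (represents_scal HPhi).
      by case: (Nat.eqb (ti t) k'); [exact: represents_self|exact: represents_zero].
    by case: (Nat.eqb (tj t) k'); [exact: represents_one|exact: represents_zero].
  by apply (represents_mul nk_pos HPhi) => //; apply (represents_star nk_pos HPhi).
Qed.

Lemma apply_szero n h v i : mat_apply n (szero h) v i = RtoC 0.
Proof. by apply csum_eq0 => j _; rewrite /szero; C_solve. Qed.

Lemma block_form_functional h w : block_form (nk h) r (Y h) w = L (datum (nk h) (fun a => Phi a h) w).
Proof.
  rewrite /Y (block_form_add (nk h) r (fun k l => mat_scal (c l k) mat_id)).
  rewrite (block_form_scal (nk h) r mu
    (fun k l => msum p (fun t => mat_mul (nk h) (mat_adj (tvm h t k)) (tvm h t l)))).
  rewrite (block_form_msum (nk h) r p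
    (fun t k l => mat_mul (nk h) (mat_adj (tvm h t k)) (tvm h t l))).
  rewrite /L /datum /=; congr Rplus.
    rewrite /block_form rsum_swap; apply rsum_ext => l _; apply rsum_ext => k _.
    rewrite apply_scal (pipZ (vec (nk h))); congr (Re (Cmult _ _)).
    by apply pip_vec_ext => // i Hi; exact: apply_id.
  congr Rmult; apply rsum_ext => t Ht.
  rewrite (block_form_square (nk h) r (fun k => tvm h t k)); congr (_ ^ 2).
  apply vnorm_ext => x Hx; rewrite /vsum /vsub /vadd.
  transitivity (Cplus
    (csum r (fun l => if Nat.eqb (ti t) l then mat_apply (nk h) (Phi (ta t) h) (w l) x else RtoC 0))
    (csum r (fun l => if Nat.eqb (tj t) l then vscal (RtoC (-1)) (w l) x else RtoC 0))).
    rewrite -csum_add; apply csum_ext => l _; rewrite /tvm apply_add apply_scal /vadd /vscal.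
    congr Cplus; first by case: (Nat.eqb (ti t) l) => //; exact: apply_szero.
    by case: (Nat.eqb (tj t) l); rewrite ?apply_id // apply_szero; C_solve.
  by rewrite !csum_if //; [exact: tj_lt|exact: ti_lt].
Qed.

(** In [D] the relations hold exactly, so every row annihilates [q] and the part with factor [mu]
    drops out. *)
Lemma cform_functional : cform s f r X q = L (gram, 0).
Proof.
  rewrite /L; cbn [fst snd]; rewrite Rmult_0_r Rplus_0_r /cform rsum_swap.
  transitivity (rsum r (fun l => rsum r (fun k => Re (Cmult (c l k) (gram l k))))
    + rsum r (fun l => mu * rsum r (fun k => f (cs_mul (cs_star (q k)) (cs_mul
        (s (cs_sum p (fun t => cs_mul (cs_star (tv t k)) (tv t l)))) (q l)))))).
    rewrite -rsum_add; apply rsum_ext => l _; rewrite -rsum_scal -rsum_add; apply rsum_ext => k _.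
    change (gram l k) with (st_c f (cs_mul (cs_star (q k)) (q l))).
    rewrite -st_cZ -st_scal.
    have Re_st d : Re (st_c f d) = f d by [].
    rewrite Re_st -st_add; congr (st _ f _).
    rewrite /X (homD _ Hs) !(homZ _ Hs) (hom1 _ Hs); nc.
  suff -> : rsum r (fun l => mu * rsum r (fun k => f (cs_mul (cs_star (q k)) (cs_mul
        (s (cs_sum p (fun t => cs_mul (cs_star (tv t k)) (tv t l)))) (q l))))) = 0 by ring.
  rewrite rsum_scal.
  pose w t := cs_sum r (fun l => cs_mul (s (tv t l)) (q l)).
  have Hw t : (t < p)%nat -> w t = cs_zero.
    move=> Ht; transitivity (cs_add
      (cs_sum r (fun l => if Nat.eqb (ti t) l then cs_mul (s (ta t)) (q l) else cs_zero))
      (cs_sum r (fun l => if Nat.eqb (tj t) l then cs_opp (q l) else cs_zero))).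
      rewrite -cs_sum_add; apply cs_sum_ext => l _; rewrite /tv (homD _ Hs) (homZ _ Hs) cs_mulDl.
      by case: (Nat.eqb (ti t) l); case: (Nat.eqb (tj t) l);
        rewrite ?(hom0 _ Hs) ?(hom1 _ Hs); nc.
    by rewrite !cs_sum_delta ?trel ?cs_subrr //; [exact: tj_lt|exact: ti_lt].
  rewrite -(Rmult_0_r mu); congr Rmult.
  transitivity (f (cs_sum p (fun t => cs_mul (cs_star (w t)) (w t)))).
    rewrite rsum_swap.
    transitivity (f (cs_sum r (fun k => cs_sum r (fun l => cs_sum p (fun t =>
      cs_mul (cs_star (cs_mul (s (tv t k)) (q k))) (cs_mul (s (tv t l)) (q l))))))).
      rewrite st_sum; apply rsum_ext => k _; rewrite st_sum; apply rsum_ext => l _.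
      congr (st _ f _); rewrite (hom_sum s Hs) cs_sum_mulr cs_sum_mull.
      apply cs_sum_ext => t _; rewrite (homM _ Hs) (hom_star _ Hs) cs_starM; nc.
    congr (st _ f _).
    transitivity (cs_sum r (fun k => cs_sum p (fun t =>
      cs_mul (cs_star (cs_mul (s (tv t k)) (q k))) (w t)))).
      apply cs_sum_ext => k _; rewrite cs_sum_swap; apply cs_sum_ext => t _.
      by rewrite /w cs_sum_mull.
    rewrite cs_sum_swap; apply cs_sum_ext => t _.
    by rewrite -cs_sum_mulr {3}/w cs_sum_star.
  rewrite cs_sum0; first by rewrite -(cs_scal0l cs_zero) st_scal; ring.
  by move=> t Ht; rewrite Hw // cs_mul0r.
Qed.

Lemma functional_nonneg m : (forall x, cone m x -> 0 <= L x) -> 0 <= L (gram, 0).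
Proof.
  move=> HL; rewrite -cform_functional.
  apply (form_nonneg s Hs f nk_pos HPhi Phi_inj) => eps He.
  have Hr := pos_INR r.
  (* [block_form_close] multiplies the entrywise error by [INR r]; the added 1 avoids division by
     zero. *)
  have He' : 0 < eps / (INR r + 1) by apply Rdiv_lt_0_compat; lra.
  have [K [HK Hcl]] : exists K, (m <= K)%nat /\ forall k, (K <= k)%nat ->
      forall i j, (i < r)%nat -> (j < r)%nat ->
      opnorm_le (nk k) (mat_sub (Phi (X i j) k) (Y k i j)) (eps / (INR r + 1)).
    have H1 i j : exists K, forall k, (K <= k)%nat ->
        opnorm_le (nk k) (mat_sub (Phi (X i j) k) (Y k i j)) (eps / (INR r + 1)).
      by have [_ H] := functional_represents i j; exact: H.
    (* The finitely many thresholds are merged as real numbers, the form in which [finite_bound2]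
       takes monotone families. *)
    have [b [_ Hb]] := finite_bound2 r (fun i j b => forall k, b <= INR k ->
        opnorm_le (nk k) (mat_sub (Phi (X i j) k) (Y k i j)) (eps / (INR r + 1)))
      ltac:(by move=> i j b d Hbd H k Hk; apply H; lra)
      ltac:(by move=> i j; have [K HK] := H1 i j; exists (INR K) => k Hk; apply HK, INR_le).
    have [K HK] := INR_unbounded b; exists (m + K)%nat; split => [|k Hk i j Hi Hj]; first lia.
    apply Hb => //; have : INR K <= INR k by apply le_INR; lia.
    lra.
  exists K => k Hk w.
  have := block_form_close (nk k) r (fun i j => Phi (X i j) k) (Y k) (eps / (INR r + 1)) w
    ltac:(lra) (Hcl k Hk).
  rewrite block_form_functional.
  have := HL _ (cone_base m k w ltac:(lia)); have := tuple_sq_ge0 (nk k) r w.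
  move: (L _) (tuple_sq _ _ _) (block_form _ _ _ _) => l t b Ht Hl Hab.
  have E : eps / (INR r + 1) * (INR r + 1) = eps by field; lra.
  have := Rle_abs (- (b - l)); rewrite Rabs_Ropp.
  nra.
Qed.
End Separation.

Lemma approximate_gram m eps : 0 < eps -> exists n rho w, level nk Phi m n rho /\
  rsum r (fun i => rsum r (fun j => Cmod (Cminus (vip n (w i) (w j)) (gram i j)))) < eps /\
  defect n rho w < eps.
Proof.
  move=> He; set x0 := dscal (-1) (gram, 0).
  case: (Rlt_le_dec (cdist m x0) eps) => Hd.
    have [y [Hy Hn]] : exists y, cone m y /\ dnorm (dadd x0 y) < eps.
      apply NNPP => Hno; suff : eps <= cdist m x0 by lra.
      by apply cdist_ge => y Hy; apply Rnot_lt_le => Hlt; apply Hno; exists y.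
    have [n [rho [w [Hl Ey]]]] := Hy; exists n, rho, w; split => //.
    move: Hn; rewrite Ey /dnorm /x0 /=.
    have -> : -1 * 0 + defect n rho w = defect n rho w by ring.
    set a := rsum r _; have Ha : 0 <= a by do 2 (apply rsum_ge0 => ? _); exact: Cmod_ge_0.
    have -> : rsum r (fun i => rsum r (fun j =>
      Cmod (Cminus (csum n (fun l => Cmult (w i l) (Cconj (w j l)))) (gram i j)))) = a.
      by apply rsum_ext => i _; apply rsum_ext => j _; congr Cmod; C_solve.
    by have := Rle_abs (defect n rho w); have := Rabs_pos (defect n rho w); lra.
  exfalso.
  have [L [LD [LZ [Lle L0]]]] : exists L : data -> R,
      (forall x y, L (dadd x y) = L x + L y) /\ (forall a x, L (dscal a x) = a * L x) /\
      (forall x, L x <= cdist m x) /\ L x0 = cdist m x0.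
    apply (hahn_banach dadd dzero dscal); last exact: cdist_sublinear.
    - by move=> x y z; apply data_ext => [i j|] /=; [C_solve|ring].
    - by move=> x y; apply data_ext => [i j|] /=; [C_solve|ring].
    - by move=> x; apply data_ext => [i j|] /=; [C_solve|ring].
    - by move=> a x y; apply data_ext => [i j|] /=; [C_solve|ring].
    - by move=> a b x; apply data_ext => [i j|] /=; [C_solve|ring].
    - by move=> a b x; apply data_ext => [i j|] /=; [C_solve|ring].
    - by move=> x; apply data_ext => [i j|] /=; [C_solve|ring].
    - by move=> x; apply data_ext => [i j|] /=; [C_solve|ring].
  have Ln x : L x <= dnorm x.
    apply: Rle_trans (Lle x) _; apply: Rle_trans (cdist_le m x _ (cone_zero m)) _.
    apply Req_le; congr dnorm; by apply data_ext => [i j|] /=; [C_solve|ring].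
  have Lcone x : cone m x -> 0 <= L x.
    move=> Hx; have := Lle (dscal (-1) x); rewrite LZ.
    have := cdist_le m (dscal (-1) x) x Hx; rewrite dnorm0; first lra.
      by move=> i j _ _ /=; C_solve.
    by rewrite /=; ring.
  have [c [mu HL]] := linear_coefficients L LD LZ Ln.
  have Hc x : cone m x ->
      0 <= rsum r (fun i => rsum r (fun j => Re (Cmult (c i j) (fst x i j)))) + mu * snd x.
    by move=> Hx; rewrite -HL; exact: Lcone.
  (* The point [x0] is minus the target datum, and $L(x_0)$ is the distance of the target from the
     cone, at least [eps]; nonnegativity at the target contradicts this. *)
  have Hg : 0 <= L (gram, 0) by rewrite HL; exact: (functional_nonneg c mu m Hc).
  by move: L0; rewrite /x0 LZ -/x0; lra.
Qed.

End Gram.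
Lemma csum_term n f i : (forall j, (j < n)%nat -> j <> i -> f j = RtoC 0) -> (i < n)%nat ->
  csum n f = f i.
Proof.
  move=> H Hi; rewrite -(csum_if n i f) //; apply csum_ext => j Hj.
  by case: (Nat.eqb_spec i j) => [_|Hne] //; apply H => // E; apply Hne.
Qed.

(** * Small perturbations of scalar matrices as Gram matrices *)

Section Realizable.
Context {A : CStar} {nk : nat -> nat} (nk_pos : forall k, (0 < nk k)%nat).
Context (Phi : A -> nat -> Mat) (m r : nat).

Definition realizable (G : nat -> nat -> C) : Prop :=
  exists n rho w, level nk Phi m n rho /\
    forall i j, (i < r)%nat -> (j < r)%nat -> vip n (w i) (w j) = G i j.

Lemma realizable_ext G G' : (forall i j, (i < r)%nat -> (j < r)%nat -> G i j = G' i j) ->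
  realizable G -> realizable G'.
Proof.
  move=> E [n [rho [w [Hl H]]]]; exists n, rho, w; split => // i j Hi Hj.
  by rewrite H // E.
Qed.
Lemma realizable_rank1 (x : nat -> C) : realizable (fun i j => Cmult (x i) (Cconj (x j))).
Proof.
  exists (nk m), (fun a => Phi a m), (fun i y => if Nat.eqb 0 y then x i else RtoC 0).
  split; first exact: level_base.
  move=> i j _ _; apply (csum_term (nk m) (fun y => Cmult (if Nat.eqb 0 y then x i else RtoC 0)
    (Cconj (if Nat.eqb 0 y then x j else RtoC 0))) 0%nat); last exact: nk_pos.
  move=> y _ Hy; case: (Nat.eqb_spec 0 y) => [E|_]; [by case: Hy|C_solve].
Qed.
Lemma realizable_add G G' : realizable G -> realizable G' ->
  realizable (fun i j => Cplus (G i j) (G' i j)).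
Proof.
  move=> [n [rho [w [Hl H]]]] [n' [rho' [w' [Hl' H']]]].
  exists (n + n')%nat, (fam_dsum n rho rho'), (fun i => vcat n (w i) (w' i)).
  split; first exact: level_dsum.
  by move=> i j Hi Hj; rewrite pip_vcat H // H'.
Qed.
Lemma realizable_sum n (F : nat -> nat -> nat -> C) :
  (forall l, realizable (F l)) -> realizable (fun i j => csum n (fun l => F l i j)).
Proof.
  move=> H; elim: n => [|n IH] /=; last exact: realizable_add.
  apply: realizable_ext (realizable_rank1 (fun _ => RtoC 0)) => i j _ _; C_solve.
Qed.

(** Each entry [H a b] is produced by the rank-one matrix of
    [sqrt eps e_a + conj (H a b) / (2 sqrt eps) e_b]; the diagonal terms this
    adds are absorbed by [theta]. *)
Lemma realizable_near_scalar (H : nat -> nat -> C) eps theta : 0 < eps ->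
  (forall i j, H j i = Cconj (H i j)) ->
  (forall i j, (i < r)%nat -> (j < r)%nat -> Cmod (H i j) <= eps) ->
  2 * INR r * eps <= theta ->
  realizable (fun i j => Cplus (H i j) (if Nat.eqb i j then RtoC theta else RtoC 0)).
Proof.
  move=> He Hh Hs Ht; set k := sqrt eps.
  have Hk : 0 < k by apply sqrt_lt_R0.
  have Hkk : k * k = eps by apply sqrt_sqrt; lra.
  pose c a b := Cmod (H a b) ^ 2 / (4 * eps).
  (* What remains of [theta] on the diagonal. At most $r\varepsilon+r\varepsilon/4$ is subtracted,
     which the assumption $2r\varepsilon\le\theta$ covers. *)
  pose d i := theta - (INR r * eps + rsum r (fun a => c a i)).
  have Hd i : (i < r)%nat -> 0 <= d i.
    move=> Hi; have : rsum r (fun a => c a i) <= INR r * (eps / 4).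
      rewrite -rsum_const; apply rsum_le => a Ha; have H1 := Hs a i Ha Hi.
      rewrite /c; apply (Rmult_le_reg_r (4 * eps)); first lra.
      have -> : Cmod (H a i) ^ 2 / (4 * eps) * (4 * eps) = Cmod (H a i) ^ 2 by field; lra.
      have := pow_incr _ _ 2 (conj (Cmod_ge_0 (H a i)) H1); lra.
    by rewrite /d; have := pos_INR r; nra.
  pose y a b i := Cplus (if Nat.eqb i a then RtoC k else RtoC 0)
    (if Nat.eqb i b then Cmult (RtoC (/ (2 * k))) (Cconj (H a b)) else RtoC 0).
  pose z a i := if Nat.eqb i a then RtoC (sqrt (d a)) else RtoC 0.
  apply: realizable_ext (realizable_add _ _
    (realizable_sum r _ (fun a => realizable_sum r _ (fun b => realizable_rank1 (y a b))))
    (realizable_sum r _ (fun a => realizable_rank1 (z a)))) => i j Hi Hj.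
  have -> : csum r (fun a => Cmult (z a i) (Cconj (z a j)))
    = if Nat.eqb i j then RtoC (d i) else RtoC 0.
    transitivity (csum r (fun a => if Nat.eqb i a then
        (if Nat.eqb j a then RtoC (d a) else RtoC 0) else RtoC 0)).
      apply csum_ext => a Ha; rewrite /z -{3}(sqrt_sqrt (d a) (Hd a Ha)).
      by case: (Nat.eqb i a); case: (Nat.eqb j a); C_solve.
    by rewrite csum_if // Nat.eqb_sym.
  transitivity (Cplus (csum r (fun a => Cplus (Cplus
      (if Nat.eqb i a then csum r (fun b => if Nat.eqb j a then RtoC eps else RtoC 0) else RtoC 0)
      (if Nat.eqb i a then csum r (fun b => if Nat.eqb j b then Cmult (RtoC (1/2)) (H a b) else RtoC 0)
       else RtoC 0))
    (Cplus (if Nat.eqb j a then csum r (fun b => if Nat.eqb i b then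
              Cmult (RtoC (1/2)) (Cconj (H a b)) else RtoC 0) else RtoC 0)
      (csum r (fun b => if Nat.eqb i b then (if Nat.eqb j b then RtoC (c a b) else RtoC 0)
         else RtoC 0))))) (if Nat.eqb i j then RtoC (d i) else RtoC 0)).
    congr Cplus; apply csum_ext => a _.
    transitivity (csum r (fun b => Cplus (Cplus
        (if Nat.eqb i a then if Nat.eqb j a then RtoC eps else RtoC 0 else RtoC 0)
        (if Nat.eqb i a then if Nat.eqb j b then Cmult (RtoC (1/2)) (H a b) else RtoC 0 else RtoC 0))
      (Cplus (if Nat.eqb j a then if Nat.eqb i b then Cmult (RtoC (1/2)) (Cconj (H a b)) else RtoC 0
              else RtoC 0)
        (if Nat.eqb i b then if Nat.eqb j b then RtoC (c a b) else RtoC 0 else RtoC 0)))).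
      apply csum_ext => b _.
      have -> : c a b = / (2 * k) * / (2 * k) * (fst (H a b) ^ 2 + snd (H a b) ^ 2).
        rewrite /c /Cmod pow2_sqrt -?Hkk; [field; lra|nra].
      rewrite /y -Hkk; case: (H a b) => u v; clear -Hk.
      by case: (Nat.eqb i a); case: (Nat.eqb i b); case: (Nat.eqb j a); case: (Nat.eqb j b); C_solve.
    rewrite !csum_add; congr (Cplus (Cplus _ _) (Cplus _ _)).
    - by case: (Nat.eqb i a) => //; rewrite csum0.
    - by case: (Nat.eqb i a) => //; rewrite csum0.
    - by case: (Nat.eqb j a) => //; rewrite csum0.
  rewrite !csum_add !csum_if //.
  have -> : csum r (fun a => csum r (fun b => if Nat.eqb i b then
      (if Nat.eqb j b then RtoC (c a b) else RtoC 0) else RtoC 0))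
    = if Nat.eqb j i then RtoC (rsum r (fun a => c a i)) else RtoC 0.
    rewrite (csum_ext _ _ (fun a => if Nat.eqb j i then RtoC (c a i) else RtoC 0)); last first.
      by move=> a _; rewrite csum_if.
    case: (Nat.eqb j i); last exact: csum0.
    elim: (r) => [|n IH] //=; rewrite IH; C_solve.
  rewrite (Nat.eqb_sym j i) (Hh i j); case: (Nat.eqb i j).
    have -> : csum r (fun _ => RtoC eps) = RtoC (INR r * eps).
      elim: (r) => [|n IH]; first by rewrite /=; C_solve.
      rewrite S_INR [csum _ _]/= IH; C_solve.
    rewrite /d; case: (H i j) => u v; C_solve.
  rewrite csum0; case: (H i j) => u v; C_solve.
Qed.

End Realizable.
Arguments realizable {A} nk Phi m r G.

(** * Prescribed Gram matrices with small defect *)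

Section ExactGram.
Context {A D : CStar} (s : A -> D) (Hs : is_ustarhom A D s) (f : state D).
Context {nk : nat -> nat} (nk_pos : forall k, (0 < nk k)%nat).
Context {Phi : A -> nat -> Mat} (HPhi : asym_hom A nk Phi).
Hypothesis Phi_inj : forall x y, seqv nk (Phi x) (Phi y) -> x = y.
Context (r : nat) (q : nat -> D) (p : nat) (ta : nat -> A) (ti tj : nat -> nat).
Hypothesis ti_lt : forall t, (t < p)%nat -> (ti t < r)%nat.
Hypothesis tj_lt : forall t, (t < p)%nat -> (tj t < r)%nat.
Hypothesis trel : forall t, (t < p)%nat -> cs_mul (s (ta t)) (q (ti t)) = q (tj t).

(** The error of an approximate Gram matrix is hermitian but not positive; after adding $\theta I$
    it is realizable, and a direct summand then corrects it exactly. [K] precedes [m] and [theta]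
    because the letters are bounded uniformly over all [k]. *)
Lemma exact_gram : exists K, 0 <= K /\ forall m theta, 0 < theta ->
  exists n rho w, level nk Phi m n rho /\
    (forall i j, (i < r)%nat -> (j < r)%nat -> vip n (w i) (w j)
       = Cplus (gram f q i j) (if Nat.eqb i j then RtoC theta else RtoC 0)) /\
    defect p ta ti tj n rho w <= K * theta.
Proof.
  have [c [Hc Hcb]] : exists c, 0 <= c /\ forall t, (t < p)%nat ->
      forall k, opnorm_le (nk k) (Phi (ta t) k) c.
    apply (finite_bound p (fun t c => forall k, opnorm_le (nk k) (Phi (ta t) k) c)).
      by move=> t c d Hcd H k; apply: opnorm_mono Hcd (H k).
    by move=> t; apply HPhi.
  have Hp := pos_INR p.
  (* The 1 pays for the approximate summand. In the correcting one the vectors have length at most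
     $\sqrt{2\theta}$, so each relation fails by at most $(c+1)\sqrt{2\theta}$. *)
  exists (1 + INR p * (2 * (c + 1) ^ 2)); split; first by have := pow2_ge_0 (c + 1); nra.
  move=> m theta Ht.
  (* Ensures both $2r\varepsilon\le\theta$, needed for the correction, and
     $\varepsilon\le\theta$. *)
  set eps := theta / (2 * INR r + 1); have Hr := pos_INR r.
  have He : 0 < eps by apply Rdiv_lt_0_compat; lra.
  have Heps : eps * (2 * INR r + 1) = theta by rewrite /eps; field; lra.
  have [n [rho [w [Hl [HG Hdef]]]]] := approximate_gram s Hs f nk_pos HPhi Phi_inj
    r q p ta ti tj ti_lt tj_lt trel m eps He.
  have HGij i j : (i < r)%nat -> (j < r)%nat ->
      Cmod (Cminus (vip n (w i) (w j)) (gram f q i j)) <= eps.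
    move=> Hi Hj; apply Rlt_le; apply: Rle_lt_trans HG.
    apply Rle_trans with (rsum r (fun j => Cmod (Cminus (vip n (w i) (w j)) (gram f q i j)))).
      apply (rsum_term r (fun j => Cmod (Cminus (vip n (w i) (w j)) (gram f q i j)))) => //.
      by move=> l _; exact: Cmod_ge_0.
    apply (rsum_term r (fun i => rsum r (fun j =>
      Cmod (Cminus (vip n (w i) (w j)) (gram f q i j))))) => //.
    by move=> l _; apply rsum_ge0 => l' _; exact: Cmod_ge_0.
  pose H i j := Cminus (gram f q i j) (vip n (w i) (w j)).
  have HH i j : (i < r)%nat -> (j < r)%nat -> Cmod (H i j) <= eps.
    move=> Hi Hj; rewrite -Cmod_opp; apply: Rle_trans (HGij i j Hi Hj); apply Req_le.
    by congr Cmod; rewrite /H; C_solve.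
  have [n' [rho' [w' [Hl' HG']]]] := realizable_near_scalar nk_pos Phi m r H eps theta He
    ltac:(by move=> i j; rewrite /H /gram (pip_conj (st_hilb f) (q i)) (pip_conj (vec n) (w i)); C_solve)
    HH ltac:(lra).
  have Hw' i : (i < r)%nat -> vnorm n' (w' i) ^ 2 <= 2 * theta.
    move=> Hi; rewrite vnormE pnorm_sq /psq HG' // Nat.eqb_refl.
    have := Rle_trans _ _ _ (re_le_Cmod _) (HH i i Hi Hi).
    move=> /Rabs_le_between; case: (H i i) => u v /=; nra.
  exists (n + n')%nat, (fam_dsum n rho rho'), (fun i => vcat n (w i) (w' i)).
  split; first exact: level_dsum.
  split; first by move=> i j Hi Hj; rewrite pip_vcat HG' // /H; C_solve.
  have := f_equal snd (datum_dsum p ta ti tj n n' rho rho' w w'); rewrite /= => ->.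
  suff : defect p ta ti tj n' rho' w' <= INR p * (2 * (c + 1) ^ 2) * theta by nra.
  rewrite Rmult_assoc -rsum_const; apply rsum_le => t Htp.
  have Hb : opnorm_le n' (rho' (ta t)) c.
    apply (level_bound nk_pos Phi m n' rho' (fun _ rho => rho (ta t)) c (natural_var (ta t)) Hl').
    by move=> k _; apply Hcb.
  set u := w' (ti t); set v := w' (tj t).
  have Hu : vnorm n' u ^ 2 <= 2 * theta by apply Hw', ti_lt.
  have Hv : vnorm n' v ^ 2 <= 2 * theta by apply Hw', tj_lt.
  have H1 := vnorm_sub n' (mat_apply n' (rho' (ta t)) u) v; have H2 := Hb u.
  have Hu0 := vnorm_ge0 n' u; have Hv0 := vnorm_ge0 n' v.
  have H0 := vnorm_ge0 n' (vsub (mat_apply n' (rho' (ta t)) u) v).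
  have Hst := sqrt_sqrt (2 * theta) ltac:(lra); have Hs0 := sqrt_pos (2 * theta).
  have Hu1 : vnorm n' u <= sqrt (2 * theta) by apply le_of_sq_le => //; nra.
  have Hv1 : vnorm n' v <= sqrt (2 * theta) by apply le_of_sq_le => //; nra.
  have : vnorm n' (vsub (mat_apply n' (rho' (ta t)) u) v) <= (c + 1) * sqrt (2 * theta) by nra.
  move=> H3; have := pow_incr _ _ 2 (conj H0 H3).
  rewrite Rpow_mult_distr pow2_sqrt; lra.
Qed.

End ExactGram.
(** * Matching vectors by unitaries *)

Definition rank1_pert (a : C) (z : Vec) : Mat :=
  fun x y => Cplus (mat_id x y) (Cmult a (Cmult (z x) (Cconj (z y)))).

Lemma apply_rank1_pert n a (z v : Vec) x : (x < n)%nat ->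
  mat_apply n (rank1_pert a z) v x = Cplus (v x) (Cmult (Cmult a (vip n v z)) (z x)).
Proof.
  move=> Hx; rewrite -{1}(apply_id n v x Hx) /mat_apply /=.
  have -> : Cmult (Cmult a (csum n (fun i => Cmult (v i) (Cconj (z i))))) (z x)
    = csum n (fun i => Cmult (Cmult a (z x)) (Cmult (v i) (Cconj (z i)))).
    by rewrite csum_scal; C_solve.
  by rewrite -csum_add; apply csum_ext => j _; rewrite /rank1_pert; C_solve.
Qed.
Lemma rank1_pert_mul n a b (z : vec n) :
  Cplus (Cplus a b) (Cmult (Cmult a b) (RtoC (psq z))) = RtoC 0 ->
  mat_eq n (mat_mul n (rank1_pert a z) (rank1_pert b z)) mat_id.
Proof.
  move=> H x y Hx Hy; rewrite mat_mulE apply_rank1_pert //.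
  have -> : vip n (fun k => rank1_pert b z k y) z
    = Cplus (Cconj (z y)) (Cmult (Cmult b (Cconj (z y))) (RtoC (psq z))).
    rewrite -pip_diag.
    transitivity (Cplus (csum n (fun k => Cmult (if Nat.eqb y k then RtoC 1 else RtoC 0) (Cconj (z k))))
      (Cmult (Cmult b (Cconj (z y))) (pip z z))).
      rewrite /= -csum_scal -csum_add; apply csum_ext => k _; rewrite /rank1_pert /mat_id.
      by rewrite Nat.eqb_sym; case: (Nat.eqb y k); C_solve.
    by rewrite csum_delta.
  rewrite {1}/rank1_pert.
  have -> : forall i w zx zy, Cplus (Cplus i (Cmult b (Cmult zx zy)))
      (Cmult (Cmult a (Cplus zy (Cmult (Cmult b zy) w))) zx)
    = Cplus i (Cmult (Cplus (Cplus a b) (Cmult (Cmult a b) w)) (Cmult zx zy)).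
    by move=> i w zx zy; C_solve.
  by rewrite H; C_solve.
Qed.
Lemma rank1_pert_adj a z : mat_adj (rank1_pert a z) = rank1_pert (Cconj a) z.
Proof.
  apply mat_ext => x y.
  rewrite /mat_adj /rank1_pert /mat_id Nat.eqb_sym.
  by case: (Nat.eqb x y); C_solve.
Qed.

Lemma unitary_mul n U V : unitary n U -> unitary n V -> unitary n (mat_mul n U V).
Proof.
  have H U' V' : unitary n U' -> unitary n V' ->
      mat_eq n (mat_mul n (mat_adj (mat_mul n U' V')) (mat_mul n U' V')) mat_id.
    move=> [HU _] [HV _]; rewrite mat_adj_mul -mat_mulA (mat_mulA _ (mat_adj U')).
    apply: mat_eq_trans (mat_eq_mul _ _ _ _ _ (mat_eq_refl _ _)
      (mat_eq_mul _ _ _ _ _ HU (mat_eq_refl _ _))) _.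
    by apply: mat_eq_trans (mat_eq_mul _ _ _ _ _ (mat_eq_refl _ _) (mat_mul1l _ _)) _.
  move=> HU HV; split; first exact: H.
  have := H _ _ (unitary_adj _ _ HV) (unitary_adj _ _ HU).
  by rewrite mat_adj_mul !adjK mat_adj_mul.
Qed.
Lemma unitary_id n : unitary n mat_id.
Proof. by split; rewrite mat_adj_id; exact: mat_mul1l. Qed.
Lemma unitary_pip n U (u v : vec n) : unitary n U ->
  vip n (mat_apply n U u) (mat_apply n U v) = vip n u v.
Proof.
  move=> [H _]; rewrite pip_adj -apply_mul; apply pip_vec_ext => // i Hi.
  by rewrite (mat_eq_apply _ _ _ _ _ H) // apply_id.
Qed.

Lemma psq_vec0 n (z : vec n) i : psq z = 0 -> (i < n)%nat -> z i = RtoC 0.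
Proof.
  move=> Hz Hi; have := rsum_term n (fun j => Cmod (z j) ^ 2) i
    ltac:(by move=> j _; exact: pow2_ge_0) Hi.
  have -> : rsum n (fun j => Cmod (z j) ^ 2) = psq z.
    by rewrite -pnorm_sq -vnormE /vnorm pow2_sqrt //; apply rsum_ge0 => j _; exact: pow2_ge_0.
  rewrite Hz => H; apply Cmod_eq_0; have := Cmod_ge_0 (z i); nra.
Qed.

(** One complex Householder reflection fixes each further vector: it maps [u]
    to [v] and fixes the orthogonal complement of [u - v]. *)
Lemma householder n (u v : vec n) : psq u = psq v -> exists W, unitary n W /\
  (forall x, (x < n)%nat -> mat_apply n W u x = v x) /\
  forall w : vec n, vip n w u = vip n w v ->
    forall x, (x < n)%nat -> mat_apply n W w x = w x.
Proof.
  move=> Huv; set z : vec n := vsub u v.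
  have Hpz (w : vec n) : vip n w z = Cminus (vip n w u) (vip n w v).
    rewrite /z /vsub (pipDr (H := vec n) u (vscal (RtoC (-1)) v)).
    by rewrite (pipZr (H := vec n) (RtoC (-1)) v); C_solve.
  have Hz : psq z = 2 * Re (vip n u z).
    have -> : psq z = Re (vip n u z) - Re (vip n v z).
      rewrite {1}/psq {1}/z /vsub (pipD (vec n) u) (pipZ (vec n) (RtoC (-1)) v).
      by move: (vip n u z) (vip n v z) => [a b] [c d]; rewrite /=; ring.
    rewrite !Hpz (pip_conj (vec n) u v) !pip_diag -Huv.
    by move: (pip u v) => [a b]; rewrite /=; ring.
  set s := vip n u z in Hz.
  case: (Req_dec (psq z) 0) => Hz0.
    exists mat_id; split; first exact: unitary_id; split => [x Hx|w _ x Hx]; last exact: apply_id.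
    rewrite apply_id //; have := psq_vec0 n z x Hz0 Hx.
    by rewrite /z /vsub /vadd /vscal; case: (u x) => a b; case: (v x) => c d [E1 E2];
      apply injective_projections => /=; lra.
  have Hs : s <> RtoC 0 by move=> E; apply Hz0; rewrite Hz E /=; ring.
  (* With $a=-1/s$ the perturbation sends [u] to $u+asz=u-z=v$. It is unitary because equality of
     norms gives $\|z\|^2=2\,\mathrm{Re}\,s$. *)
  set a := Copp (Cinv s).
  have Ha : Cplus (Cplus a (Cconj a)) (Cmult (Cmult a (Cconj a)) (RtoC (psq z))) = RtoC 0.
    rewrite /a Hz; clear -Hs; clearbody s; case: s Hs => p q Hs.
    have Hpq : p * p + q * q <> 0.
      move=> E; apply Hs; apply injective_projections => /=; nra.
    by apply injective_projections; rewrite /=; field; rewrite ?Rmult_1_r.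
  have Ha' : Cplus (Cplus (Cconj a) a) (Cmult (Cmult (Cconj a) a) (RtoC (psq z))) = RtoC 0.
    by rewrite -Ha; C_solve.
  exists (rank1_pert a z); split; last split.
  - split; rewrite rank1_pert_adj; exact: rank1_pert_mul.
  - move=> x Hx; rewrite apply_rank1_pert // -/s.
    have -> : Cmult a s = RtoC (-1).
      have -> : Cmult a s = Copp (Cmult (Cinv s) s) by rewrite /a; ring.
      by rewrite Cinv_l //; C_solve.
    by rewrite /z /vsub /vadd /vscal; C_solve.
  - move=> w Hw x Hx; rewrite apply_rank1_pert // Hpz Hw; C_solve.
Qed.

(** Induction without orthonormalisation: a reflection moves $Uu_r$ to $v_r$ and fixes the earlier
    $v_i$, whose inner products with both vectors agree. Linearly dependent systems need no separate
    treatment. *)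
Lemma unitary_match n r (u v : nat -> vec n) :
  (forall i j, (i < r)%nat -> (j < r)%nat -> vip n (u i) (u j) = vip n (v i) (v j)) ->
  exists U, unitary n U /\ forall i, (i < r)%nat -> forall x, (x < n)%nat ->
    mat_apply n U (u i) x = v i x.
Proof.
  elim: r => [|r IH] H; first by exists mat_id; split; [exact: unitary_id|move=> i Hi; lia].
  have [U [HU HUu]] := IH ltac:(by move=> i j Hi Hj; apply H; lia).
  have [|W [HW [HWu HWf]]] := householder n (mat_apply n U (u r)) (v r).
    by rewrite /psq unitary_pip // H //; lia.
  exists (mat_mul n W U); split; first exact: unitary_mul.
  move=> i Hi x Hx; rewrite apply_mul.
  case: (Nat.eq_dec i r) => [->|Hne]; first exact: HWu.
  have Hir : (i < r)%nat by lia.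
  rewrite (apply_ext n W _ (v i)); last exact: HUu.
  apply HWf => //; rewrite -H; try lia.
  rewrite -(unitary_pip n U (u i) (u r) HU); apply pip_vec_ext => // y Hy.
  by rewrite HUu.
Qed.

(** * Changing size and basis of a representation *)

Section Multiplicity.
Context {A : CStar} {nk : nat -> nat} (Phi : A -> nat -> Mat).
Context (p : nat) (ta : nat -> A) (ti tj : nat -> nat).

(** Extra copies of the same map carry zero vectors, which enlarges the space without affecting
    inner products or defect. It brings the two sides to a common size. *)
Lemma level_multiple m k n rho w : level nk Phi m n rho ->
  exists rho' w', level nk Phi m (S k * n) rho' /\
    datum p ta ti tj (S k * n) rho' w' = datum p ta ti tj n rho w.
Proof.
  move=> Hl; elim: k => [|k [rho' [w' [Hl' E]]]].
    by rewrite Nat.mul_1_l; exists rho, w.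
  exists (fam_dsum n rho rho'), (fun i => vcat n (w i) (fun _ => RtoC 0)); split.
    exact: level_dsum.
  have -> : (S (S k) * n = n + S k * n)%nat by [].
  rewrite (datum_dsum p ta ti tj n (S k * n) rho rho' w (fun _ _ => RtoC 0)).
  apply data_ext => [i j|] /=.
    by rewrite [X in Cplus _ X]csum_eq0; [C_solve|move=> x _; C_solve].
  rewrite [X in _ + X]rsum_eq0; first ring.
  move=> t _; set v := vsub _ _.
  have -> : vnorm (n + k * n) v = 0; last by ring.
  rewrite (vnorm_ext _ v (vscal (RtoC 0) (fun _ => RtoC 0))).
    by rewrite vnorm_scal Cmod_0; ring.
  move=> x _; rewrite /v /vsub /vadd /vscal /mat_apply csum_eq0; first C_solve.
  by move=> y _; C_solve.
Qed.

Lemma defect_conj n U rho (u v : nat -> Vec) r : unitary n U ->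
  (forall t, (t < p)%nat -> (ti t < r)%nat /\ (tj t < r)%nat) ->
  (forall i, (i < r)%nat -> forall x, (x < n)%nat -> mat_apply n U (u i) x = v i x) ->
  defect p ta ti tj n (fam_conj n (mat_adj U) rho) u = defect p ta ti tj n rho v.
Proof.
  move=> HU Ht Huv; apply rsum_ext => t Htp; have [Hi Hj] := Ht t Htp; congr (_ ^ 2).
  rewrite -(unitary_norm n U _ HU) /fam_conj /conjm !apply_mul adjK.
  apply vnorm_ext => x Hx; rewrite {1}/vsub apply_vadd apply_vscal /vsub /vadd /vscal.
  rewrite Huv // -apply_mul; case: HU => _ HU.
  rewrite (mat_eq_apply _ _ _ _ _ HU) // apply_id //.
  by rewrite (apply_ext n _ _ (v (ti t))) //; exact: Huv.
Qed.
End Multiplicity.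
(** * Noncommutative polynomials in two algebras *)

Section Poly.
Context (A B : CStar).
Definition letter : Type := (A + B)%type.
Definition word : Type := list letter.
(** Words stay formal and unreduced because matrix evaluation is letter by letter, and the maps
    evaluated need not be multiplicative. *)
Definition poly : Type := list (C * word).

Section Values.
Context {E : CStar} (s1 : A -> E) (s2 : B -> E).
Definition lval (l : letter) : E := match l with inl a => s1 a | inr b => s2 b end.
Fixpoint wval (w : word) : E :=
  match w with [] => cs_one | l :: w => cs_mul (lval l) (wval w) end.
Fixpoint pval (p : poly) : E :=
  match p with [] => cs_zero | m :: p => cs_add (cs_scal (fst m) (wval (snd m))) (pval p) end.
End Values.

Section Matrices.
Context (n : nat) (ra : A -> Mat) (rb : B -> Mat).
Definition lmat (l : letter) : Mat := match l with inl a => ra a | inr b => rb b end.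
Fixpoint wmat (w : word) : Mat :=
  match w with [] => mat_id | l :: w => mat_mul n (lmat l) (wmat w) end.
Fixpoint pmat (p : poly) : Mat :=
  match p with
  | [] => fun _ _ => RtoC 0
  | m :: p => mat_add (mat_scal (fst m) (wmat (snd m))) (pmat p)
  end.
End Matrices.

Fixpoint suffixes (w : word) : list word :=
  match w with [] => [[]] | l :: w' => w :: suffixes w' end.
Lemma suffixes_self w : In w (suffixes w).
Proof. by case: w => [|l w]; left. Qed.
Lemma suffixes_tail l w v : In (l :: w) (suffixes v) -> In w (suffixes v).
Proof.
  elim: v => [|l' v IH] /=; first by case.
  case=> [[_ ->]|H]; right; [exact: suffixes_self|exact: IH].
Qed.
End Poly.

(** * Representations nearly attaining the norm of one polynomial *)

Section ApproximateNorm.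
Context {A B D : CStar} (s1 : A -> D) (s2 : B -> D).
Context (Hs1 : is_ustarhom A D s1) (Hs2 : is_ustarhom B D s2).
Hypothesis nontrivial : (cs_one : D) <> cs_zero.
Context {na nb : nat -> nat} (na_pos : forall k, (0 < na k)%nat) (nb_pos : forall k, (0 < nb k)%nat).
Context {Pa : A -> nat -> Mat} (HPa : asym_hom A na Pa) {Pb : B -> nat -> Mat} (HPb : asym_hom B nb Pb).
Hypothesis Pa_inj : forall x y, seqv na (Pa x) (Pa y) -> x = y.
Hypothesis Pb_inj : forall x y, seqv nb (Pb x) (Pb y) -> x = y.

Section Words.
Context (f : state D) (p0 : poly A B).

(** The vectors [w xi], for [w] a suffix of a word of [p0] and [xi] the cyclic
    vector of the state [f], are indexed by positions in [Ws]. *)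
Let Ws : list (word A B) := [] :: flat_map (fun m => suffixes A B (snd m)) p0.
Let r : nat := length Ws.
Let q (i : nat) : D := wval A B s1 s2 (nth i Ws []).
Let idx (w : word A B) : nat :=
  epsilon (inhabits O) (fun j => (j < r)%nat /\ nth j Ws [] = w).
(** Relation [t] on the [A] side strips the first letter of the [t]-th word. If that is not a letter
    of [A], the trivial relation $1\cdot q_t=q_t$ is imposed, so both sides have exactly [r]
    relations. *)
Let ta (t : nat) : A := match nth t Ws [] with inl a :: _ => a | _ => cs_one end.
Let ia (t : nat) : nat := match nth t Ws [] with inl _ :: w => idx w | _ => t end.
Let tb (t : nat) : B := match nth t Ws [] with inr b :: _ => b | _ => cs_one end.
Let ib (t : nat) : nat := match nth t Ws [] with inr _ :: w => idx w | _ => t end.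

Lemma idxP w : In w Ws -> (idx w < r)%nat /\ nth (idx w) Ws [] = w.
Proof.
  move=> Hw; apply (epsilon_spec (inhabits O) (fun j => (j < r)%nat /\ nth j Ws [] = w)).
  by have [j [Hj E]] := In_nth Ws w [] Hw; exists j.
Qed.
Lemma Ws_tail l w : In (l :: w) Ws -> In w Ws.
Proof.
  case=> [//|/in_flat_map [m [Hm Hw]]]; right; apply in_flat_map.
  by exists m; split => //; apply: suffixes_tail Hw.
Qed.
Lemma nth_tail i l w : (i < r)%nat -> nth i Ws [] = l :: w -> In w Ws.
Proof. by move=> Hi E; apply (Ws_tail l); rewrite -E; exact: nth_In. Qed.

Lemma ia_lt t : (t < r)%nat -> (ia t < r)%nat.
Proof.
  move=> Ht; rewrite /ia; case E: (nth t Ws []) => [//|[a|b] w] //.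
  by have [] := idxP w (nth_tail _ _ _ Ht E).
Qed.
Lemma ib_lt t : (t < r)%nat -> (ib t < r)%nat.
Proof.
  move=> Ht; rewrite /ib; case E: (nth t Ws []) => [//|[a|b] w] //.
  by have [] := idxP w (nth_tail _ _ _ Ht E).
Qed.
Lemma rel_a t : (t < r)%nat -> cs_mul (s1 (ta t)) (q (ia t)) = q t.
Proof.
  move=> Ht; rewrite /ta /ia {2}/q; case E: (nth t Ws []) => [|[a|b] w].
  - by rewrite (hom1 _ Hs1) cs_mul1l /q E.
  - by have [_ E'] := idxP w (nth_tail _ _ _ Ht E); rewrite /q E'.
  - by rewrite (hom1 _ Hs1) cs_mul1l /q E.
Qed.
Lemma rel_b t : (t < r)%nat -> cs_mul (s2 (tb t)) (q (ib t)) = q t.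
Proof.
  move=> Ht; rewrite /tb /ib {2}/q; case E: (nth t Ws []) => [|[a|b] w].
  - by rewrite (hom1 _ Hs2) cs_mul1l /q E.
  - by rewrite (hom1 _ Hs2) cs_mul1l /q E.
  - by have [_ E'] := idxP w (nth_tail _ _ _ Ht E); rewrite /q E'.
Qed.

Definition good (K theta : R) (m d : nat) (ra : A -> Mat) (rb : B -> Mat) (v : nat -> Vec) : Prop :=
  level na Pa m d ra /\ level nb Pb m d rb /\
  (forall i j, (i < r)%nat -> (j < r)%nat -> vip d (v i) (v j)
     = Cplus (gram f q i j) (if Nat.eqb i j then RtoC theta else RtoC 0)) /\
  defect r ta ia (fun t => t) d ra v <= K * theta /\ defect r tb ib (fun t => t) d rb v <= K * theta.

(** Both sides realise the same Gram matrix. Multiplicities bring sizes [n] and [n'] to $nn'$, and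
    conjugating the [B] side by the matching unitary makes the vectors coincide. *)
Lemma good_exists : exists K, 0 <= K /\ forall m theta, 0 < theta ->
  exists d ra rb v, good K theta m d ra rb v.
Proof.
  have [Ka [HKa Ha]] := exact_gram s1 Hs1 f na_pos HPa Pa_inj r q r ta ia (fun t => t)
    ia_lt ltac:(by []) rel_a.
  have [Kb [HKb Hb]] := exact_gram s2 Hs2 f nb_pos HPb Pb_inj r q r tb ib (fun t => t)
    ib_lt ltac:(by []) rel_b.
  exists (Ka + Kb); split; first lra.
  move=> m theta Ht.
  have [n [rho [u [Hl [Hu Hd]]]]] := Ha m theta Ht.
  have [n' [rho' [u' [Hl' [Hu' Hd']]]]] := Hb m theta Ht.
  have Hn := level_pos na_pos Pa _ _ _ Hl; have Hn' := level_pos nb_pos Pb _ _ _ Hl'.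
  have [ra [v [Hla Ea]]] := level_multiple Pa r ta ia (fun t => t) m (n' - 1) n rho u Hl.
  have [rb [v' [Hlb Eb]]] := level_multiple Pb r tb ib (fun t => t) m (n - 1) n' rho' u' Hl'.
  have En : (S (n' - 1) * n = n * n')%nat by rewrite Nat.mul_comm; congr Nat.mul; lia.
  have En' : (S (n - 1) * n' = n * n')%nat by congr Nat.mul; lia.
  rewrite En in Hla Ea; rewrite En' in Hlb Eb; set d := (n * n')%nat in Hla Ea Hlb Eb.
  have Gv i j : vip d (v i) (v j) = vip n (u i) (u j).
    exact: (f_equal (fun x => fst x i j) Ea).
  have Gv' i j : vip d (v' i) (v' j) = vip n' (u' i) (u' j).
    exact: (f_equal (fun x => fst x i j) Eb).
  have [|U [HU HUv]] := unitary_match d r v v'.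
    by move=> i j Hi Hj; rewrite Gv Gv' Hu // Hu'.
  exists d, ra, (fam_conj d (mat_adj U) rb), v; split => //; split.
    by apply level_conj => //; exact: unitary_adj.
  split; first by move=> i j Hi Hj; rewrite Gv Hu.
  split.
    have := f_equal snd Ea; rewrite /= => ->; nra.
  rewrite (defect_conj r tb ib (fun t => t) d U rb v v' r HU) => [|t Ht'|]; last exact: HUv.
    have := f_equal snd Eb; rewrite /= => ->; nra.
  by split; [exact: ib_lt|].
Qed.

Context (K : R) (HK : 0 <= K).

Lemma letter_bound (l : letter A B) : exists c, 0 <= c /\ forall theta m d ra rb v,
  good K theta m d ra rb v -> opnorm_le d (lmat A B ra rb l) c.
Proof.
  case: l => x /=.
  - have [c Hc] := proj1 HPa x; exists c; split; first exact: opnorm_ge0 (na_pos 0) (Hc 0%nat).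
    move=> theta m d ra rb v [Hl _].
    by apply (level_bound na_pos Pa m d ra (fun _ rho => rho x) c (natural_var x) Hl).
  - have [c Hc] := proj1 HPb x; exists c; split; first exact: opnorm_ge0 (nb_pos 0) (Hc 0%nat).
    move=> theta m d ra rb v [_ [Hl _]].
    by apply (level_bound nb_pos Pb m d rb (fun _ rho => rho x) c (natural_var x) Hl).
Qed.

Lemma vsub_tri n (u v w : Vec) : vnorm n (vsub u w) <= vnorm n (vsub u v) + vnorm n (vsub v w).
Proof.
  have -> : vsub u w = vadd (vsub u v) (vsub v w).
    by apply functional_extensionality => i; rewrite /vsub /vadd /vscal; C_solve.
  exact: vnorm_add.
Qed.

Lemma letter_step theta m d ra rb v i l w : 0 < theta -> good K theta m d ra rb v ->
  (i < r)%nat -> nth i Ws [] = l :: w ->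
  vnorm d (vsub (mat_apply d (lmat A B ra rb l) (v (idx w))) (v i)) <= sqrt K * sqrt theta.
Proof.
  move=> Ht [_ [_ [_ [Hda Hdb]]]] Hi E; rewrite -sqrt_mult //; last lra.
  apply le_of_sq_le; first exact: sqrt_pos.
  rewrite sqrt_sqrt; last by apply Rmult_le_pos; lra.
  case: l E => x E.
    apply: Rle_trans Hda.
    have := rsum_term r (fun t => vnorm d (vsub (mat_apply d (ra (ta t)) (v (ia t))) (v t)) ^ 2) i
      ltac:(by move=> t _; exact: pow2_ge_0) Hi.
    by rewrite /ta /ia E /= Rmult_1_r.
  apply: Rle_trans Hdb.
  have := rsum_term r (fun t => vnorm d (vsub (mat_apply d (rb (tb t)) (v (ib t))) (v t)) ^ 2) i
    ltac:(by move=> t _; exact: pow2_ge_0) Hi.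
  by rewrite /tb /ib E /= Rmult_1_r.
Qed.

(** Induction along suffixes: prefixing a letter multiplies the old error by the bound of the letter
    and adds $\sqrt{K\theta}$. The constant is independent of [m], [theta] and the
    representations. *)
Lemma word_estimate w : In w Ws -> exists E, 0 <= E /\ forall theta m d ra rb v,
  0 < theta -> good K theta m d ra rb v -> forall i, (i < r)%nat -> nth i Ws [] = w ->
  vnorm d (vsub (mat_apply d (wmat A B d ra rb w) (v O)) (v i)) <= E * sqrt theta.
Proof.
  elim: w => [|l w IH] Hw.
    (* The empty word may occupy several positions. Because of $\theta I$ their vectors differ, but
       only by a squared distance of at most $2\theta$. *)
    exists 2; split; first lra.
    move=> theta m d ra rb v Ht [_ [_ [Hg _]]] i Hi E.
    rewrite (vnorm_ext d _ (vsub (v O) (v i))); last first.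
      by move=> x Hx; rewrite /vsub /vadd /= apply_id.
    have Hq : q O = q i by rewrite /q E.
    have H0 : (0 < r)%nat by rewrite /r /Ws /=; lia.
    apply le_of_sq_le; first by have := sqrt_pos theta; lra.
    have -> : vnorm d (vsub (v O) (v i)) * vnorm d (vsub (v O) (v i))
      = psq (H := vec d) (vsub (v O) (v i)) by rewrite -pnorm_sq -vnormE; ring.
    rewrite /psq /vsub (pipD (vec d) (v O)) !(pipDr (H := vec d)) (pipZ (vec d)).
    rewrite (pipZ (vec d) _ (v i)) !(pipZr (H := vec d)) !Hg //.
    have Hs := sqrt_sqrt theta ltac:(lra).
    have Eg j k : (j = O \/ j = i) -> (k = O \/ k = i) -> gram f q j k = gram f q O O.
      by rewrite /gram; case=> ->; case=> ->; rewrite -?Hq.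
    rewrite (Eg O i) ?(Eg i O) ?(Eg i i); try tauto.
    rewrite !Nat.eqb_refl (Nat.eqb_sym i 0).
    case: (gram f q O O) => g1 g2; case: (Nat.eqb 0 i) => /=; nra.
  have Hw' := Ws_tail l w Hw; have [E [HE IHw]] := IH Hw'.
  have [c [Hc Hcb]] := letter_bound l.
  exists (c * E + sqrt K); split; first by have := sqrt_pos K; nra.
  move=> theta m d ra rb v Ht Hg i Hi Ei.
  have [Hj Ej] := idxP w Hw'.
  rewrite /= apply_mul; apply: Rle_trans (vsub_tri d _ (mat_apply d (lmat A B ra rb l) (v (idx w))) _) _.
  have H1 := letter_step theta m d ra rb v i l w Ht Hg Hi Ei.
  have H2 := IHw theta m d ra rb v Ht Hg (idx w) Hj Ej.
  have H3 := Hcb theta m d ra rb v Hg (vsub (mat_apply d (wmat A B d ra rb w) (v O)) (v (idx w))).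
  rewrite {1}/vsub apply_vadd apply_vscal -/(vsub _ _) in H3.
  have := Rmult_le_compat_l c _ _ Hc H2; nra.
Qed.

(** The point is that the same coefficients [b] express the value of [p] in [D] exactly and its
    action on [v O] approximately. *)
Lemma poly_estimate p : (forall m, In m p -> In (snd m) Ws) -> exists (b : nat -> C) E, 0 <= E /\
  pval A B s1 s2 p = cs_sum r (fun i => cs_scal (b i) (q i)) /\
  forall theta m d ra rb v, 0 < theta -> good K theta m d ra rb v ->
  vnorm d (vsub (mat_apply d (pmat A B d ra rb p) (v O)) (vsum r (fun i => vscal (b i) (v i))))
  <= E * sqrt theta.
Proof.
  elim: p => [|[c w] p IH] Hp.
    exists (fun _ => RtoC 0), 0; split; first lra; split.
      by rewrite cs_sum0 // => i _; exact: cs_scal0l.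
    move=> theta m d ra rb v Ht Hg; rewrite (vnorm_ext d _ (vscal (RtoC 0) (fun _ => RtoC 0))).
      by rewrite vnorm_scal Cmod_0; lra.
    move=> x _; rewrite /vsub /vadd /vscal /vsum /= /mat_apply !csum_eq0; first C_solve.
      by move=> j _; C_solve.
    by move=> j _; C_solve.
  have [b [E [HE [Hv He]]]] := IH ltac:(by move=> m Hm; apply Hp; right).
  have Hw : In w Ws by apply (Hp (c, w)); left.
  have [F [HF Hf]] := word_estimate w Hw; have [Hj Ej] := idxP w Hw.
  exists (fun i => Cplus (if Nat.eqb (idx w) i then c else RtoC 0) (b i)), (Cmod c * F + E).
  split; first by have := Cmod_ge_0 c; nra.
  split.
    cbn [pval fst snd]; rewrite Hv; transitivity (cs_add
      (cs_sum r (fun i => if Nat.eqb (idx w) i then cs_scal c (q i) else cs_zero))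
      (cs_sum r (fun i => cs_scal (b i) (q i)))).
      by rewrite cs_sum_delta // {2}/q Ej.
    rewrite -cs_sum_add; apply cs_sum_ext => i _.
    by rewrite cs_scalDl; case: (Nat.eqb (idx w) i); rewrite ?cs_scal0l.
  move=> theta m d ra rb v Ht Hg.
  have H1 := Hf theta m d ra rb v Ht Hg (idx w) Hj Ej.
  have H2 := He theta m d ra rb v Ht Hg.
  rewrite (vnorm_ext d _ (vadd
    (vscal c (vsub (mat_apply d (wmat A B d ra rb w) (v O)) (v (idx w))))
    (vsub (mat_apply d (pmat A B d ra rb p) (v O)) (vsum r (fun i => vscal (b i) (v i)))))).
    apply: Rle_trans (vnorm_add _ _ _) _; rewrite vnorm_scal.
    have := Rmult_le_compat_l _ _ _ (Cmod_ge_0 c) H1; lra.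
  move=> x _; cbn [pmat fst snd]; rewrite apply_add apply_scal.
  set z := vsum r _; set z' := vsum r (fun i => vscal (b i) (v i)).
  have Ez : z x = Cplus (Cmult c (v (idx w) x)) (z' x).
    rewrite /z /z' /vsum -(csum_if r (idx w) (fun i => Cmult c (v i x))) // -csum_add.
    by apply csum_ext => i _; rewrite /vscal; case: (Nat.eqb (idx w) i); C_solve.
  rewrite /vsub /vadd /vscal Ez; C_solve.
Qed.

(** The added multiple of the identity can only enlarge the norm: the difference of the two sides is
    $\theta\sum_i|b_i|^2$. *)
Lemma combination_norm (b : nat -> C) theta m d ra rb v : 0 < theta -> good K theta m d ra rb v ->
  f (cs_mul (cs_star (cs_sum r (fun i => cs_scal (b i) (q i))))
            (cs_sum r (fun i => cs_scal (b i) (q i))))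
  <= vnorm d (vsum r (fun i => vscal (b i) (v i))) ^ 2.
Proof.
  move=> Ht [_ [_ [Hg _]]].
  set x := cs_sum r (fun i => cs_scal (b i) (q i)).
  have Ex : @pip (st_hilb f) x x = csum r (fun i => csum r (fun j =>
      Cmult (Cmult (b i) (Cconj (b j))) (gram f q i j))).
    rewrite {1}/x pip_cs_sum; apply csum_ext => i _.
    rewrite (pip_conj (st_hilb f) x) /x pip_cs_sum -csum_conj; apply csum_ext => j _.
    rewrite -pip_conj (pipZr (H := st_hilb f)) (pipZ (st_hilb f)) /gram; C_solve.
  set z := vsum r (fun i => vscal (b i) (v i)).
  have Ez : vip d z z = csum r (fun i => csum r (fun j =>
      Cmult (Cmult (b i) (Cconj (b j))) (vip d (v i) (v j)))).
    rewrite {1}/z pip_vsum; apply csum_ext => i _.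
    rewrite (pip_conj (vec d) z) /z pip_vsum -csum_conj; apply csum_ext => j _.
    rewrite -pip_conj (pipZr (H := vec d)) (pipZ (vec d)); C_solve.
  have -> : f (cs_mul (cs_star x) x) = Re (@pip (st_hilb f) x x) by [].
  rewrite vnormE pnorm_sq /psq Ez Ex !csum_re; apply rsum_le => i Hi; rewrite !csum_re.
  apply rsum_le => j Hj; rewrite Hg //; case: (Nat.eqb_spec i j) => [->|_].
    case: (b j) => b1 b2; case: (gram f q j j) => g1 g2 /=.
    have := pow2_ge_0 b1; have := pow2_ge_0 b2; nra.
  by apply Req_le; congr Re; C_solve.
Qed.

End Words.

(** For a state norming the value [x], the combination $\sum_i b_iv_i$ has norm at least $\|x\|$. It
    is close to the image of [v O], whose own norm is nearly 1. Attaining the norm is expressed as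
    the failure of a smaller bound. *)
Theorem approximate_norm (p : poly A B) m eps : 0 < eps -> exists d ra rb,
  level na Pa m d ra /\ level nb Pb m d rb /\
  ~ opnorm_le d (pmat A B d ra rb p) (cs_norm (pval A B s1 s2 p) - eps).
Proof.
  move=> He; set x := pval A B s1 s2 p; set M := cs_norm x.
  have HM : 0 <= M by exact: cs_norm_ge0.
  have [f Hf] := exists_norming_state nontrivial x.
  rewrite cs_Cstar -/M in Hf.
  have [K [HK Hgood]] := good_exists f p.
  have Hsub mm : In mm p -> In (snd mm) ([] :: flat_map (fun m => suffixes A B (snd m)) p).
    by move=> Hm; right; apply in_flat_map; exists mm; split => //; exact: suffixes_self.
  have [b [E [HE [Hx Hest]]]] := poly_estimate f p K HK p Hsub.
  (* A bound $M-\varepsilon$ would give $M\le(M-\varepsilon)(1+h)+Eh$, which fails as soon as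
     $(M+E)h<\varepsilon$. The error is $Eh$ because $\theta=h^2$. *)
  set h := eps / (2 * (M + E + 1)).
  have Hh : 0 < h by apply Rdiv_lt_0_compat; lra.
  have Hhe : 2 * (M + E + 1) * h = eps by rewrite /h; field; lra.
  have Hth : 0 < h * h by nra.
  have [d [ra [rb [v Hg]]]] := Hgood m (h * h) Hth.
  exists d, ra, rb; have [Hla [Hlb [Hgr _]]] := Hg; split => //; split => // Hop.
  have Hd : (0 < d)%nat by exact: level_pos na_pos Pa _ _ _ Hla.
  (* The supposed bound is nonnegative since the size is positive, so it may multiply the estimate
     of the norm of [v O] below. *)
  have Hc := opnorm_ge0 _ _ _ Hd Hop.
  have H1 := Hest _ _ _ _ _ _ Hth Hg; rewrite sqrt_square in H1; last lra.
  have H2 := combination_norm f p K b _ _ _ _ _ _ Hth Hg.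
  rewrite -Hx -/x Hf in H2.
  set z := vsum _ _ in H1 H2.
  have Hz : M <= vnorm d z by apply le_of_sq_le; [exact: vnorm_ge0|nra].
  have Hv0 : vnorm d (v O) ^ 2 = 1 + h * h.
    rewrite vnormE pnorm_sq /psq Hgr /=; try lia.
    by rewrite cs_star1 cs_mul1l st_one.
  have Hv : vnorm d (v O) <= 1 + h.
    by apply le_of_sq_le; [lra|have := vnorm_ge0 d (v O); nra].
  have H3 := Hop (v O).
  have H4 := vnorm_sub d (mat_apply d (pmat A B d ra rb p) (v O))
     (vsub (mat_apply d (pmat A B d ra rb p) (v O)) z).
  have E4 : vsub (mat_apply d (pmat A B d ra rb p) (v O))
     (vsub (mat_apply d (pmat A B d ra rb p) (v O)) z) = z.
    by apply functional_extensionality => i; rewrite /vsub /vadd /vscal; C_solve.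
  rewrite E4 in H4.
  have H5 : (M - eps) * vnorm d (v O) <= (M - eps) * (1 + h) by apply Rmult_le_compat_l.
  nra.
Qed.

End ApproximateNorm.
(** * Density and the main theorem *)

Section PolyOps.
Context {A B : CStar}.

Definition poly_mul (p p' : poly A B) : poly A B :=
  flat_map (fun m => map (fun m' => (Cmult (fst m) (fst m'), snd m ++ snd m')) p') p.
Definition poly_scal (a : C) (p : poly A B) : poly A B :=
  map (fun m => (Cmult a (fst m), snd m)) p.
Definition lstar (l : letter A B) : letter A B :=
  match l with inl a => inl (cs_star a) | inr b => inr (cs_star b) end.
Definition poly_star (p : poly A B) : poly A B :=
  map (fun m => (Cconj (fst m), rev (map lstar (snd m)))) p.

Context {E : CStar} (s1 : A -> E) (s2 : B -> E).
Context (Hs1 : is_ustarhom A E s1) (Hs2 : is_ustarhom B E s2).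
Local Notation val := (pval A B s1 s2).
Local Notation wv := (wval A B s1 s2).

Lemma wval_app v w : wv (v ++ w) = cs_mul (wv v) (wv w).
Proof. by elim: v => [|l v IH] /=; rewrite ?cs_mul1l // IH cs_mulA. Qed.
Lemma pval_app p p' : val (p ++ p') = cs_add (val p) (val p').
Proof. by elim: p => [|m p IH] /=; rewrite ?cs_add0 // IH cs_addA. Qed.
Lemma pval_scal a p : val (poly_scal a p) = cs_scal a (val p).
Proof. by elim: p => [|m p IH] /=; rewrite ?cs_scal0r // IH cs_scalDr cs_scalM. Qed.
Lemma pval_mul p p' : val (poly_mul p p') = cs_mul (val p) (val p').
Proof.
  elim: p => [|m p IH] /=; first by rewrite cs_mul0l.
  rewrite pval_app IH cs_mulDl; congr cs_add.
  case: m => c w; elim: p' {IH} => [|[c' w'] p' IH'] /=; first by rewrite cs_mul0r.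
  rewrite IH' wval_app /=; nc.
Qed.
Lemma wval_star w : wv (rev (map lstar w)) = cs_star (wv w).
Proof.
  elim: w => [|l w IH] /=; first by rewrite cs_star1.
  rewrite wval_app IH cs_starM /= cs_mul1r; congr cs_mul.
  by case: l => x /=; rewrite ?(hom_star _ Hs1) ?(hom_star _ Hs2).
Qed.
Lemma pval_star p : val (poly_star p) = cs_star (val p).
Proof.
  elim: p => [|m p IH] /=; first by rewrite cs_star0.
  by rewrite IH wval_star cs_starD cs_starZ.
Qed.
End PolyOps.

(** * A countable dense family of polynomials *)

Section Density.
Local Open Scope cs_scope.
Context {A B D : CStar} (s1 : A -> D) (s2 : B -> D).
Context (Hs1 : is_ustarhom A D s1) (Hs2 : is_ustarhom B D s2).
Context (la : list A) (lb : list B).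
Hypothesis gen_a : generates A (fun x => In x la).
Hypothesis gen_b : generates B (fun x => In x lb).
Hypothesis gen_d : generates D (fun d => (exists a, d = s1 a) \/ (exists b, d = s2 b)).
Local Notation val := (pval A B s1 s2).

(** Finite lists, closed in the union under sums, products, adjoints and the scalars $-1$, $i$,
    $1/2$. These already generate all dyadic complex scalars, and the others arise as limits. *)
Fixpoint stage (k : nat) : list (poly A B) :=
  match k with
  | O => [(RtoC 1, [])] :: map (fun a => [(RtoC 1, [inl a])]) la
                       ++ map (fun b => [(RtoC 1, [inr b])]) lb
  | S k => stage k
      ++ flat_map (fun p => flat_map (fun p' => [p ++ p'; poly_mul p p']) (stage k)) (stage k)
      ++ flat_map (fun p => [poly_scal (RtoC (-1)) p; poly_scal Ci p; poly_scal (RtoC (1/2)) p; poly_star p])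
           (stage k)
  end.

Definition approx (d : D) : Prop := forall eps, (0 < eps)%R ->
  exists k p, In p (stage k) /\ (cs_norm (d - val p) < eps)%R.

Lemma stage_mono k l p : In p (stage k) -> In p (stage (k + l)).
Proof.
  move=> H; elim: l => [|l IH]; first by rewrite Nat.add_0_r.
  by rewrite Nat.add_succ_r; apply in_or_app; left.
Qed.
Lemma stage_bin k l p p' : In p (stage k) -> In p' (stage l) ->
  In (p ++ p') (stage (S (k + l))) /\ In (poly_mul p p') (stage (S (k + l))).
Proof.
  move=> H H'; have {}H := stage_mono k l p H.
  have {}H' := stage_mono l k p' H'; rewrite Nat.add_comm in H'.
  by split; apply in_or_app; right; apply in_or_app; left; apply in_flat_map; exists p;
    split => //; apply in_flat_map; exists p'; split => //; [left|right; left].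
Qed.
Lemma stage_un k p : In p (stage k) ->
  (forall a, a = RtoC (-1) \/ a = Ci \/ a = RtoC (1/2) -> In (poly_scal a p) (stage (S k)))
  /\ In (poly_star p) (stage (S k)).
Proof.
  move=> H; split => [a Ha|]; apply in_or_app; right; apply in_or_app; right;
    apply in_flat_map; exists p; split => //=.
    by case: Ha => [->|[->|->]]; tauto.
  tauto.
Qed.

Lemma approx_lim d : (forall eps, (0 < eps)%R -> exists d', approx d' /\ (cs_norm (d - d') < eps)%R) ->
  approx d.
Proof.
  move=> H eps He; have [d' [Hd' H1]] := H (eps / 2)%R ltac:(lra).
  have [k [p [Hp H2]]] := Hd' (eps / 2)%R ltac:(lra).
  exists k, p; split => //; have := cs_norm_tri d d' (val p); lra.
Qed.
Lemma approx_add d e : approx d -> approx e -> approx (d + e).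
Proof.
  move=> Hd He eps Hp.
  have [k [p [Hk H1]]] := Hd (eps / 2)%R ltac:(lra).
  have [l [p' [Hl H2]]] := He (eps / 2)%R ltac:(lra).
  exists (S (k + l)), (p ++ p'); split; first by apply stage_bin.
  rewrite pval_app; have -> : d + e - (val p + val p') = (d - val p) + (e - val p') by nc.
  by have := cs_normD _ (d - val p) (e - val p'); lra.
Qed.
Lemma approx_mul d e : approx d -> approx e -> approx (d * e).
Proof.
  move=> Hd He eps Hp; have Nd := cs_norm_ge0 d; have Ne := cs_norm_ge0 e.
  set M := (cs_norm d + cs_norm e + 1)%R.
  have HM : (0 < M)%R by rewrite /M; lra.
  set t := Rmin 1 (eps / M).
  have Ht : (0 < t)%R by apply Rmin_pos; [lra|apply Rdiv_lt_0_compat].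
  have Ht1 : (t <= 1)%R := Rmin_l _ _.
  have HtM : (t * M <= eps)%R.
    have := Rmult_le_compat_r M _ _ ltac:(lra) (Rmin_r 1 (eps / M)); rewrite -/t.
    by have -> : (eps / M * M = eps)%R by field; lra.
  have [k [p [Hk H1]]] := Hd t Ht; have [l [p' [Hl H2]]] := He t Ht.
  exists (S (k + l)), (poly_mul p p'); split; first by apply stage_bin.
  rewrite pval_mul.
  have -> : d * e - val p * val p' = (d - val p) * e + val p * (e - val p') by nc.
  have := cs_normD _ ((d - val p) * e) (val p * (e - val p')).
  have := cs_normM _ (d - val p) e; have := cs_normM _ (val p) (e - val p').
  have := cs_norm_tri (val p) d 0.
  have -> : val p - 0 = val p by nc.
  have -> : d - 0 = d by nc.
  rewrite (cs_norm_subC (val p)); have := cs_norm_ge0 (d - val p).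
  have := cs_norm_ge0 (e - val p'); have := cs_norm_ge0 (val p).
  move: H1 H2 HtM; rewrite /M.
  move: (cs_norm (d - val p)) (cs_norm (e - val p')) (cs_norm (val p)) => a b c.
  move=> H1 H2 HtM H3 H4 H5 H6 H7 H8 H9.
  have : (a * cs_norm e <= t * cs_norm e)%R by apply Rmult_le_compat_r; lra.
  have : (c * b <= (cs_norm d + 1) * b)%R by apply Rmult_le_compat_r; lra.
  have : ((cs_norm d + 1) * b < (cs_norm d + 1) * t)%R by apply Rmult_lt_compat_l; lra.
  lra.
Qed.
Lemma approx_star d : approx d -> approx (d^*).
Proof.
  move=> Hd eps He; have [k [p [Hk H1]]] := Hd eps He.
  exists (S k), (poly_star p); split; first by apply stage_un.
  by rewrite (pval_star _ _ Hs1 Hs2) -cs_starN -cs_starD cs_norm_star.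
Qed.
Lemma approx_scal0 a d : a = RtoC (-1) \/ a = Ci \/ a = RtoC (1/2) -> approx d -> approx (a ** d).
Proof.
  move=> Ha Hd eps He; have [k [p [Hk H1]]] := Hd eps He.
  exists (S k), (poly_scal a p); split; first by apply stage_un.
  rewrite pval_scal; have -> : a ** d - a ** val p = a ** (d - val p) by nc.
  rewrite cs_normZ; have : (Cmod a <= 1)%R.
    case: Ha => [->|[->|->]]; rewrite ?Cmod_R.
    - by rewrite Rabs_Ropp Rabs_R1; lra.
    - rewrite /Cmod; have -> : (fst Ci ^ 2 + snd Ci ^ 2 = 1)%R by rewrite /=; ring.
      by rewrite sqrt_1; lra.
    - by rewrite Rabs_pos_eq; lra.
  have := cs_norm_ge0 (d - val p); nra.
Qed.
Lemma approx_zero d : approx d -> approx 0.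
Proof.
  move=> Hd; have -> : 0 = d + RtoC (-1) ** d by nc.
  by apply approx_add => //; apply approx_scal0 => //; left.
Qed.
Lemma approx_dyadic k n d : approx d -> approx (RtoC (INR n * (1/2) ^ k) ** d).
Proof.
  move=> Hd; have Hk : approx (RtoC ((1/2) ^ k) ** d).
    elim: k => [|k IH]; first by rewrite /= cs_scal1.
    have -> : RtoC ((1/2) ^ S k) ** d = RtoC (1/2) ** (RtoC ((1/2) ^ k) ** d) by rewrite /=; nc.
    by apply approx_scal0 => //; tauto.
  elim: n => [|n IH].
    have -> : RtoC (INR 0 * (1/2) ^ k) ** d = 0 by rewrite /=; nc.
    exact: approx_zero Hd.
  have -> : RtoC (INR (S n) * (1/2) ^ k) ** d
    = RtoC (INR n * (1/2) ^ k) ** d + RtoC ((1/2) ^ k) ** d by rewrite S_INR; nc.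
  exact: approx_add.
Qed.
Lemma approx_real t d : approx d -> approx (RtoC t ** d).
Proof.
  move=> Hd.
  have Hpos u : (0 <= u)%R -> approx (RtoC u ** d).
    move=> Hu; apply approx_lim => eps He; have Nd := cs_norm_ge0 d.
    have He' : (0 < eps / (cs_norm d + 1))%R by apply Rdiv_lt_0_compat; lra.
    have [k Hk] := pow_lt_1_zero (1/2) ltac:(by rewrite Rabs_pos_eq; lra) _ He'.
    have {}Hk := Hk k (le_n _); set h := ((1/2) ^ k)%R in Hk.
    have Hh : (0 < h)%R by apply pow_lt; lra.
    rewrite Rabs_pos_eq in Hk; last lra.
    have [n [Hn1 Hn2]] := nfloor_ex (u / h) ltac:(by apply Rdiv_le_0_compat).
    exists (RtoC (INR n * h) ** d); split; first exact: approx_dyadic.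
    have -> : RtoC u ** d - RtoC (INR n * h) ** d = RtoC (u - INR n * h) ** d by nc.
    have Eu : (u / h * h = u)%R by field; lra.
    have L1 := Rmult_le_compat_r h _ _ ltac:(lra) Hn1.
    have L2 := Rmult_lt_compat_r h _ _ Hh Hn2.
    rewrite cs_normZR Rabs_pos_eq; last lra.
    have : (eps / (cs_norm d + 1) * (cs_norm d + 1) = eps)%R by field; lra.
    nra.
  case: (Rle_lt_dec 0 t) => Ht; first exact: Hpos.
  have -> : RtoC t ** d = RtoC (-1) ** (RtoC (- t) ** d) by nc.
  by apply approx_scal0; [left|apply Hpos; lra].
Qed.
Lemma approx_scal a d : approx d -> approx (a ** d).
Proof.
  move=> Hd; case: a => u v.
  have -> : (u, v) ** d = RtoC u ** d + Ci ** (RtoC v ** d) by nc.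
  by apply approx_add; [|apply approx_scal0; first tauto]; apply approx_real.
Qed.
Lemma approx_stage0 p : In p (stage 0) -> approx (val p).
Proof.
  by move=> Hp eps He; exists O, p; split => //; rewrite cs_subrr cs_norm0.
Qed.
Lemma approx_one : approx 1.
Proof.
  have := approx_stage0 [(RtoC 1, [])] (or_introl eq_refl).
  by rewrite /= cs_scal1 cs_addr0.
Qed.
(** Homomorphisms are contractive, so it suffices to approximate images of generators. Applied to
    the two embeddings and to the identity of [D]. *)
Lemma approx_hom (M : CStar) (s : M -> D) (S : M -> Prop) : is_ustarhom M D s -> generates M S ->
  (forall x, S x -> approx (s x)) -> forall x, approx (s x).
Proof.
  move=> Hs Hg HS x; apply approx_lim => eps He.
  have [y [Hy Hxy]] := Hg x eps He; exists (s y); split; last first.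
    by rewrite -(homB _ Hs); apply: Rle_lt_trans Hxy; exact: hom_contractive.
  elim: Hy => {y Hxy} [y Hy||y z _ Hy _ Hz|a y _ Hy|y z _ Hy _ Hz|y _ Hy].
  - exact: HS.
  - by rewrite (hom1 _ Hs); exact: approx_one.
  - by rewrite (homD _ Hs); exact: approx_add.
  - by rewrite (homZ _ Hs); exact: approx_scal.
  - by rewrite (homM _ Hs); exact: approx_mul.
  - by rewrite (hom_star _ Hs); exact: approx_star.
Qed.

Lemma approx_all d : approx d.
Proof.
  apply (approx_hom D (fun x => x) _ ltac:(by []) gen_d) => x [[a ->]|[b ->]].
    apply (approx_hom A s1 _ Hs1 gen_a) => y Hy.
    have := approx_stage0 [(RtoC 1, [inl y])]; rewrite /= cs_scal1 cs_addr0 cs_mul1r; apply.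
    by right; apply in_or_app; left; apply (in_map (fun a => [(RtoC 1, [inl a])])).
  apply (approx_hom B s2 _ Hs2 gen_b) => y Hy.
  have := approx_stage0 [(RtoC 1, [inr y])]; rewrite /= cs_scal1 cs_addr0 cs_mul1r; apply.
  by right; apply in_or_app; right; apply (in_map (fun b => [(RtoC 1, [inr b])])).
Qed.

(** Pairs of a stage and a position are enumerated by the Cantor pairing; positions beyond the end
    of a list yield the zero polynomial. *)
Lemma dense_sequence : exists e : nat -> poly A B, forall d eps, (0 < eps)%R ->
  exists i, (cs_norm (d - val (e i)) < eps)%R.
Proof.
  exists (fun i => nth (snd (Cantor.of_nat i)) (stage (fst (Cantor.of_nat i))) []) => d eps He.
  have [k [p [Hp H]]] := approx_all d eps He.
  have [l [_ E]] := In_nth (stage k) p [] Hp.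
  by exists (Cantor.to_nat (k, l)); rewrite Cantor.cancel_of_to /= E.
Qed.

End Density.

Lemma pval_class {A B : CStar} {d : nat -> nat} (d_pos : forall j, (0 < d j)%nat)
  (ra : nat -> A -> Mat) (rb : nat -> B -> Mat)
  (p1 : A -> seq_quotient d d_pos) (p2 : B -> seq_quotient d d_pos) :
  (forall a, exists HX, p1 a = cls d (fun j => ra j a) HX) ->
  (forall b, exists HX, p2 b = cls d (fun j => rb j b) HX) ->
  forall p, exists HX, pval A B p1 p2 p = cls d (fun j => pmat A B (d j) (ra j) (rb j) p) HX.
Proof.
  move=> H1 H2.
  have Hl l : exists HX, lval A B p1 p2 l = cls d (fun j => lmat A B (ra j) (rb j) l) HX.
    by case: l => x /=; [exact: H1|exact: H2].
  have Hw w : exists HX, wval A B p1 p2 w = cls d (fun j => wmat A B (d j) (ra j) (rb j) w) HX.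
    elim: w => [|l w [HX E]]; first by exists (bdd_id d).
    have [HY E'] := Hl l; exists (bdd_mul _ d_pos _ _ HY HX).
    by rewrite /= E E' /= qmul_cls.
  elim=> [|m p [HX E]]; first by exists (bdd_zero d).
  have [HY E'] := Hw (snd m); exists (bdd_add _ _ _ (bdd_scal _ (fst m) _ HY) HX).
  by rewrite /= E E' /= qscal_cls qadd_cls.
Qed.

(** In positive size the identity matrix preserves the norm of a nonzero vector, so the identity
    sequence is not null. *)
Lemma MF_nontrivial (A : CStar) : MF A -> (cs_one : A) <> cs_zero.
Proof.
  move=> [nk [Phi [Hpos [Hb [Ha [Hs [Hm [Ht [H1 _]]]]]]]]] E.
  have HP : asym_hom A nk Phi by do 5 (split => //).
  have [_ H0] := represents_zero HP.
  have Hz : seqv nk sid szero.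
    by apply: seqv_trans (seqv_sym _ _ _ H1) _; rewrite E; exact: H0.
  have [K HK] := Hz (1/2) ltac:(lra).
  have := HK K (le_n _); set e : Vec := fun i => if Nat.eqb 0 i then RtoC 1 else RtoC 0.
  move=> /(_ e).
  have He : 1 <= vnorm (nk K) e.
    rewrite /vnorm -sqrt_1; apply sqrt_le_1_alt.
    have := rsum_term (nk K) (fun i => Cmod (e i) ^ 2) 0 ltac:(by move=> i _; nra) (Hpos K).
    by rewrite /e /= Cmod_1; lra.
  rewrite (vnorm_ext (nk K) _ e); first lra.
  move=> x Hx; rewrite apply_sub /vsub /vadd /vscal apply_id // apply_szero; C_solve.
Qed.

Theorem theorem5p4 :
  forall (A B : CStar), fin_generated A -> fin_generated B -> MF A -> MF B ->
  forall (D : CStar) (s1 : A -> D) (s2 : B -> D),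
    is_full_free_product A B D s1 s2 -> MF D.
Proof.
  move=> A B [la Hla] [lb Hlb] HA HB D s1 s2 [Hs1 [Hs2 [inj1 [_ [Hgen univ]]]]].
  have HD1 : (cs_one : D) <> cs_zero.
    move=> E; apply (MF_nontrivial A HA), inj1.
    by rewrite (hom1 _ Hs1) (hom0 _ Hs1).
  have [e He] := dense_sequence s1 s2 Hs1 Hs2 la lb Hla Hlb Hgen.
  move: HA => [na [Pa [na_pos [Ab [Aa [As [Am [At [A1 Pa_inj]]]]]]]]].
  move: HB => [nb [Pb [nb_pos [Bb [Ba [Bs [Bm [Bt [B1 Pb_inj]]]]]]]]].
  have HPa : asym_hom A na Pa by do 5 (split => //).
  have HPb : asym_hom B nb Pb by do 5 (split => //).
  (* The [j]-th representation treats the polynomial [e i] coded by [j], each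
     [e i] recurring infinitely often, which suffices as norms are upper limits. *)
  pose pj j := e (fst (Cantor.of_nat j)).
  pose Q j (x : nat * ((A -> Mat) * (B -> Mat))) :=
    level na Pa j (fst x) (fst (snd x)) /\ level nb Pb j (fst x) (snd (snd x)) /\
    ~ opnorm_le (fst x) (pmat A B (fst x) (fst (snd x)) (snd (snd x)) (pj j))
        (cs_norm (pval A B s1 s2 (pj j)) - / (INR j + 1)).
  have HQ j : exists x, Q j x.
    have Hj : 0 < / (INR j + 1) by apply Rinv_0_lt_compat; have := pos_INR j; lra.
    have [d [ra [rb H]]] := approximate_norm s1 s2 Hs1 Hs2 HD1 na_pos nb_pos HPa HPb Pa_inj Pb_inj
      (pj j) j _ Hj.
    by exists (d, (ra, rb)).
  have [x Hx] : exists x, forall j, Q j (x j).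
    exists (fun j => proj1_sig (constructive_indefinite_description _ (HQ j))) => j.
    exact: proj2_sig (constructive_indefinite_description _ (HQ j)).
  pose d j := fst (x j); pose ra j := fst (snd (x j)); pose rb j := snd (snd (x j)).
  have d_pos j : (0 < d j)%nat by exact: level_pos na_pos Pa _ _ _ (proj1 (Hx j)).
  have [p1 [Hp1 Hc1]] := asym_hom_class d_pos _
    (level_asym_hom na_pos Pa d ra HPa (fun j => proj1 (Hx j))).
  have [p2 [Hp2 Hc2]] := asym_hom_class d_pos _
    (level_asym_hom nb_pos Pb d rb HPb (fun j => proj1 (proj2 (Hx j)))).
  have [psi [Hpsi [E1 E2]]] := univ _ p1 p2 Hp1 Hp2.
  apply (hom_MF d_pos psi Hpsi) => y z Hyz; apply cs_sub_eq0; set u := cs_add y _.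
  have Hu : psi u = cs_zero by rewrite /u (homB _ Hpsi) Hyz cs_subrr.
  (* With a quarter of the norm of [u], the polynomial has norm above $3\varepsilon$ in [D], but its
     matrices are eventually bounded by $2\varepsilon$. At a late index coding it, the chosen pair
     violates the bound $\|p\|-1/(j+1)$, which exceeds $2\varepsilon$. *)
  apply cs_norm_le0, Rnot_lt_le => Hlt; set eps := cs_norm u / 4.
  have Heps : 0 < eps by rewrite /eps; lra.
  have [i Hi] := He u eps Heps; set p := e i in Hi.
  have Epsi : psi (pval A B s1 s2 p) = pval A B p1 p2 p.
    have Hw w : psi (wval A B s1 s2 w) = wval A B p1 p2 w.
      elim: w => [|[a|b] w IH] /=; first exact: (hom1 _ Hpsi).
        by rewrite (homM _ Hpsi) IH -E1.
      by rewrite (homM _ Hpsi) IH -E2.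
    elim: p {Hi} => [|m p IH] /=; first exact: (hom0 _ Hpsi).
    by rewrite (homD _ Hpsi) (homZ _ Hpsi) Hw IH.
  have [HX Ecls] := pval_class d_pos ra rb p1 p2 Hc1 Hc2 p.
  have Hsn : snorm d (fun j => pmat A B (d j) (ra j) (rb j) p) <= eps.
    rewrite -(qnorm_cls d d_pos _ HX) -Ecls -Epsi.
    have := hom_contractive psi Hpsi (cs_add (pval A B s1 s2 p) (cs_opp u)).
    rewrite (homB _ Hpsi) Hu (cs_norm_subC (pval A B s1 s2 p) u).
    have -> : cs_add (psi (pval A B s1 s2 p)) (cs_opp cs_zero) = psi (pval A B s1 s2 p) by nc.
    rewrite /=; lra.
  have [K HK] := snorm_tail_le d _ eps HX Heps.
  have [N HN] := INR_unbounded (/ eps).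
  pose j := Cantor.to_nat (i, K + N)%nat.
  have Hj : (K + N <= j)%nat by have := Cantor.to_nat_non_decreasing i (K + N); rewrite -/j; lia.
  have Ep : pj j = p by rewrite /pj /j Cantor.cancel_of_to.
  have := proj2 (proj2 (Hx j)); rewrite Ep -/(d j) -/(ra j) -/(rb j) => Hn.
  have HjN : INR N <= INR j by apply le_INR; lia.
  have Hinv : / (INR j + 1) < eps.
    rewrite -(Rinv_inv eps); apply Rinv_lt_contravar; last lra.
    have := Rinv_0_lt_compat _ Heps; have := pos_INR j; nra.
  apply Hn; apply: opnorm_mono (HK j ltac:(lia)).
  have := cs_norm_tri u (pval A B s1 s2 p) cs_zero.
  have -> : cs_add u (cs_opp cs_zero) = u by nc.
  have -> : cs_add (pval A B s1 s2 p) (cs_opp cs_zero) = pval A B s1 s2 p by nc.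
  rewrite /eps in Heps Hi Hsn Hinv *; lra.
Qed.
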